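(* Let $C$ be an integral and complete curve over an algebraically closed field $k$ (of arbitrary characteristic), with dualizing sheaf $\omega$. Suppose that $C$ is nonhyperelliptic and that every non-Gorenstein point of $C$ is unibranch. Then the natural homomorphisms $$\mathrm{Sym}^{n}\,H^{0}(C,\omega)\longrightarrow H^{0}(C,\omega^{n})$$ are surjective for all $n\geq 1$.
   Context: A curve $C$ is hyperelliptic if there is a morphism $C\to\mathbb{P}^1$ of degree $2$ (and nonhyperelliptic otherwise). A point $P\in C$ is Gorenstein if the stalk $\omega_P$ is a free $\mathcal{O}_P$-module, and non-Gorenstein otherwise. A point $P\in C$ is unibranch if exactly one point of the normalization $\overline{C}$ of $C$ lies over $P$. For a coherent sheaf $\mathcal{F}$ on $C$, $\mathcal{F}^n:=\mathrm{Sym}^n\mathcal{F}/\mathrm{Torsion}(\mathrm{Sym}^n\mathcal{F})$; in particular $\omega^n$ is the symmetric power of $\omega$ modulo torsion. The homomorphism in the claim is the natural one induced by multiplication of sections. *)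

(* Defs.v *)
From HB Require Import structures.
From mathcomp Require Import all_boot all_order all_algebra all_fingroup.
From mathcomp Require Import all_classical.

Set Implicit Arguments.
Unset Strict Implicit.
Unset Printing Implicit Defensive.

Import GRing.Theory.
Local Open Scope classical_set_scope.
Local Open Scope ring_scope.

(* Integral separated schemes of finite type over k are encoded as Chevalley's
   "schemata" (Zariski's "models"), see EGA I, section 8: such a scheme X with
   function field K is identified with the set of its local rings O_P, which
   are subrings of K.  A point of X is thus a subset P of K, the underlying
   set of O_P; the generic point is the whole of K. *)

Section Subrings.
Variable K : fieldType.
Implicit Types (A P Q p : set K) (V : lmodType K).

Definition subring A := subring_closed [in A].

Definition prime_ideal A p :=
  [/\ p `<=` A, p 0 /\ ~ p 1,
      forall x y, p x -> p y -> p (x + y),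
      forall a x, A a -> p x -> p (a * x)
    & forall a b, A a -> A b -> p (a * b) -> p a \/ p b].

Definition localization A p : set K :=
  [set x | exists a s, [/\ A a, A s, ~ p s & x = a / s]].

(* The set of local rings of Spec A. *)
Definition spec A : set (set K) :=
  [set P | exists2 p, prime_ideal A p & P = localization A p].

Definition integral_closure A : set K :=
  [set x | exists p : {poly K}, [/\ p \is monic, forall i, A p`_i & root p x]].

(* The A-submodule generated by X. *)
Definition gen_submod V A (X : set V) : set V :=
  [set v | exists m (a : 'I_m -> K) (x : 'I_m -> V),
     [/\ forall i, A (a i), forall i, X (x i) & v = \sum_i a i *: x i]].

(* A finitely generated A-module M is free. *)
Definition free_module V A (M : set V) :=
  exists m (e : 'I_m -> V), (forall i, M (e i)) /\
    forall v, M v ->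
      exists! a : 'rV[K]_m, (forall i, A (a 0 i)) /\ v = \sum_i a 0 i *: e i.

End Subrings.

(* f maps the local ring Q into the local ring P, by a local homomorphism. *)
Definition local_hom (L K : fieldType) (f : L -> K) (Q : set L) (P : set K) :=
  (forall y, Q y -> P (f y)) /\ (forall y, Q y -> P (f y)^-1 -> Q y^-1).

Definition dominates (K : fieldType) (Q P : set K) := local_hom id P Q.

Section Algebras.
Variables (k K : fieldType) (iota : {rmorphism k -> K}).

(* The k-subalgebra k[s] of K. *)
Definition subalgebra_gen (s : seq K) : set K :=
  \bigcap_(B in [set B | [/\ subring B, range iota `<=` B & [set` s] `<=` B]]) B.

Definition valuation_ring (V : set K) :=
  [/\ subring V, range iota `<=` V & forall x, V x \/ V x^-1].

Definition trdeg1 :=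
  exists2 x : K, ~ algebraicOver iota x &
    forall y : K, exists2 F : {poly {poly k}}, F != 0 &
      root (map_poly (fun c => (map_poly iota c).[x]) F) y.

End Algebras.

(* Completeness is the valuative criterion: every valuation ring of K/k has a
   unique centre (uniqueness being separatedness). *)
Record curve (k : closedFieldType) := Curve {
  funfield : fieldType;
  const : {rmorphism k -> funfield};
  points : set (set funfield);
  finite_typeP : exists ss : seq (seq funfield),
    (forall s, s \in ss -> forall x, exists a b,
       [/\ subalgebra_gen const s a, subalgebra_gen const s b & x = a / b]) /\
    points = \bigcup_(s in [set` ss]) spec (subalgebra_gen const s);
  completeP : forall V, valuation_ring const V ->
    exists! P, points P /\ dominates V P;
  dim1P : trdeg1 const }.

Arguments funfield [k] C : rename.
Arguments const [k] C : rename.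
Arguments points [k] C _ : rename.

Section Hyperelliptic.
Variable k : closedFieldType.

Let kt := {fraction {poly k}}.

Definition ratconst : {rmorphism k -> kt} := @tofrac {poly k} \o polyC.

Definition P1_points : set (set kt) :=
  let t : kt := @tofrac {poly k} 'X in
  spec (subalgebra_gen ratconst [:: t]) `|`
  spec (subalgebra_gen ratconst [:: t^-1]).

(* Dominant morphisms C -> P^1, given by their comorphism k(t) -> K. *)
Definition morphism_to_P1 (C : curve k) (f : {rmorphism kt -> funfield C}) :=
  (forall c, f (ratconst c) = const C c) /\
  (forall P, points C P -> exists2 Q, P1_points Q & local_hom f Q P).

Definition field_degree (L K : fieldType) (f : {rmorphism L -> K}) (d : nat) :=
  exists e : 'I_d -> K,
    forall x, exists! a : 'rV[L]_d, x = \sum_i f (a 0 i) * e i.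

Definition hyperelliptic (C : curve k) :=
  exists f : {rmorphism kt -> funfield C},
    morphism_to_P1 f /\ field_degree f 2.

End Hyperelliptic.

Section Curves.
Variables (k : closedFieldType) (C : curve k).
Let K := funfield C.
Implicit Types (P Q : set K) (V W : vectType K).

Definition closed_points : set (set K) := points C `\ setT.

Definition normalization_points : set (set K) :=
  \bigcup_(P in points C) spec (integral_closure P).

Definition unibranch P := exists! Q, normalization_points Q /\ dominates Q P.

(* A torsion-free coherent sheaf, as a subsheaf of the constant sheaf V of its
   generic stalk.  The sets [set Q in points C | all x of s lie in Q] form a
   basis of the Zariski topology of C; on a neighbourhood of each point, the
   sheaf is generated by a finite set S of sections. *)
Record tfsheaf V := TFSheaf {
  stalk :> set K -> set V;
  generic_stalk : stalk setT = setT;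
  coherentP : forall P, points C P -> exists (s : seq K) (S : seq V),
    [set` s] `<=` P /\
    forall Q, points C Q -> [set` s] `<=` Q -> stalk Q = gen_submod Q [set` S] }.

Definition H0 (T : Type) (F : set K -> set T) : set T :=
  \bigcap_(P in points C) F P.

(* From the flasque resolution 0 -> F -> V -> \bigoplus_P V/F_P -> 0 (P closed),
   H^1(C, F) is the cokernel of V -> \bigoplus_P V/F_P.  A linear functional on
   it is a family of linear forms lam P on V/F_P such that
   \sum_P lam P v = 0 for all v in V (a finite sum, v being in almost all F_P). *)
Definition H1_functional V (F : tfsheaf V) (lam : set K -> V -> k) :=
  [/\ forall P, closed_points P ->
        forall a u v, lam P (const C a *: u + v) = a * lam P u + lam P v,
      forall P, closed_points P -> forall v, F P v -> lam P v = 0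
    & forall v, \sum_(P \in closed_points) lam P v = 0].

Definition sheaf_hom V W (F : tfsheaf V) (G : tfsheaf W) (f : 'Hom(V, W)) :=
  forall P, points C P -> forall v, F P v -> G P (f v).

(* There is a trace tr : H^1(C, omega) -> k such that, for all F, composition
   with tr is a bijection from Hom(F, omega) to the dual of H^1(C, F).  Torsion
   in F would affect neither side, omega being torsion-free. *)
Definition dualizing W (omega : tfsheaf W) :=
  exists2 tr, H1_functional omega tr &
    forall V (F : tfsheaf V) lam, H1_functional F lam ->
      exists! f : 'Hom(V, W), sheaf_hom F omega f /\
        forall P, closed_points P -> forall v, lam P v = tr P (f v).

Definition gorenstein W (omega : tfsheaf W) P := free_module P (omega P).

End Curves.

Arguments unibranch {k} C P.
Arguments closed_points {k} C _.
Arguments normalization_points {k} C _.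
Arguments H0 {k} C {T} F _.

Section SymmetricPowers.
Variables (K : fieldType) (W : vectType K) (n : nat).

Definition multilinear_form (B : ('I_n -> W) -> K) :=
  forall (w : 'I_n -> W) i a x y,
    B (dfwith w i (a *: x + y)) = a * B (dfwith w i x) + B (dfwith w i y).

Definition symmetric_under_perm (B : ('I_n -> W) -> K) :=
  forall (s : 'S_n) w, B (w \o s) = B w.

Definition symform := {B | multilinear_form B /\ symmetric_under_perm B}.

(* Sym^n W embeds in its bidual, and the dual of Sym^n W is the space of
   symmetric n-linear forms on W: we compute in sympow, with
   sprod w = w_1 ... w_n; the symbols sprod w span Sym^n W. *)
Definition sympow : lmodType K := symform -> K^o.

Definition sprod (w : 'I_n -> W) : sympow := fun B => sval B w.

End SymmetricPowers.

Section SymmetricPowersOfSheaves.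
Variables (k : closedFieldType) (C : curve k).
Let K := funfield C.
Variables (W : vectType K) (n : nat).

(* The stalks of Sym^n F / Torsion: the torsion of Sym^n_{O_P} F_P is the kernel
   of the map to its generic stalk Sym^n_K W, and its image is spanned over O_P
   by the products of n elements of F_P. *)
Definition sympow_sheaf (F : set K -> set W) (P : set K) : set (sympow W n) :=
  gen_submod P [set s | exists2 w, forall i, F P (w i) & s = sprod w].

(* Elements of Sym^n_k U, for a k-subspace U of W, are represented by the formal
   sums \sum_j c_j w_j1 ... w_jn with w_ji in U. *)
Definition sym_tensors (U : set W) : set (seq (k * ('I_n -> W))) :=
  [set z | forall cw, cw \in z -> forall i, U (cw.2 i)].

Definition sym_mult (z : seq (k * ('I_n -> W))) : sympow W n :=
  \sum_(cw <- z) const C cw.1 *: sprod cw.2.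

End SymmetricPowersOfSheaves.

Arguments sympow_sheaf {k C W} n F P _.
Arguments sym_tensors {k C W} n U _.
Arguments sym_mult {k C W} n z.

(* Main.v *)
(* Realize the dualizing sheaf as a sheaf [om] of fractional ideals, with space of sections [V].

   Assume that [dim V >= 3] and that [V] is not of the form [c k[x]_{<g}].  By induction on [n],
   every section of the double dual of [om^n] lies in [V^n].  Otherwise duality provides a
   repartition [eta] orthogonal to [V^(n+1)] but not to some section [f] of the double dual of
   [om^(n+1)].  For [v] in [V] the repartition [eta v] is orthogonal to [V^n], hence principal,
   say equal to [f_v], modulo [om : om^n].  The determinants [v f_w - w f_v] are sections of
   [om : om^(n-1)]: they vanish for [n >= 3], are constant for [n = 2] and lie in [V] for
   [n = 1].  In each case this forces [f_v = v y] for a fixed [y]; for [n = 1] a pencil of such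
   determinants yields subspaces [A] and [B] with [A B <= V] and [dim A + dim B = dim V + 1], and
   Vosper's theorem for subspaces of a field applies.  As [V] generates [om], [eta] is equal to
   [y] modulo [om : om^(n+1)], so that [f] is orthogonal to [eta] by the residue theorem.

   If [V = c k[x]_{<g}], duality bounds the length of [O / (x - a) O] by 2, hence the growth of
   the sections of [(O + x O)^m], hence the degree of [K] over [k(x)].  Either [K = k(x)] and
   the sections of [om^n] are polynomials in [x] of the expected degree, or [x] is a double cover
   of the projective line.  If [V = 0], some [x] gives a birational morphism to the line and
   [x^2] a double cover. *)
From HB Require Import structures.
Require Import Defs.
From mathcomp Require Import all_boot all_order all_algebra all_fingroup.
From mathcomp Require Import all_classical.
From mathcomp Require Import zify.
From Stdlib Require Import setoid_ring.Ring_theory setoid_ring.Field_theory.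
From Stdlib Require Import setoid_ring.Ring setoid_ring.Field.

Set Implicit Arguments.
Unset Strict Implicit.
Unset Printing Implicit Defensive.

Import GRing.Theory.
Local Open Scope classical_set_scope.
Local Open Scope ring_scope.

(* Copies of the field operations with carrier syntactically [K], as [ring] and [field] need. *)
Section RingTac.
Variable K : fieldType.
Definition kadd (x y : K) : K := x + y.
Definition kopp (x : K) : K := - x.
Definition ksub (x y : K) : K := x - y.
Definition kmul (x y : K) : K := x * y.
Definition kinv (x : K) : K := x^-1.
Definition kdiv (x y : K) : K := x / y.
Definition kzero : K := 0.
Definition kone : K := 1.
Lemma kring_theory : ring_theory kzero kone kadd kmul ksub kopp eq.
Proof. split; [exact: add0r|exact: addrC|exact: addrA|exact: mul1r|exact: mulrC|exact: mulrA|exact: mulrDl| by []|exact: subrr]. Qed.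
Lemma kfield_theory : field_theory kzero kone kadd kmul ksub kopp kdiv kinv eq.
Proof. split; [exact: kring_theory|by apply/eqP; exact: oner_neq0|by []|by move=> p /eqP; exact: mulVf]. Qed.
End RingTac.

Ltac kfold K := repeat match goal with
 | |- context [@GRing.add ?T ?a ?b] => change (@GRing.add T a b) with (@kadd K a b)
 | |- context [@GRing.mul ?T ?a ?b] => change (@GRing.mul T a b) with (@kmul K a b)
 | |- context [@GRing.scale ?R ?T ?a ?b] => change (@GRing.scale R T a b) with (@kmul K a b)
 | |- context [@GRing.inv ?T ?a] => change (@GRing.inv T a) with (@kinv K a)
 | |- context [@GRing.opp ?T ?a] => change (@GRing.opp T a) with (@kopp K a)
 | |- context [@GRing.zero ?T] => change (@GRing.zero T) with (@kzero K)
 | |- context [@GRing.one ?T] => change (@GRing.one T) with (@kone K)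
end; match goal with |- @eq _ ?a ?b => change (@eq (GRing.Field.sort K) a b) end.

(** * Relative dimension of [k]-subspaces *)

Section Subspaces.
Variables (k : closedFieldType) (K : fieldType) (iota : {rmorphism k -> K}).

Definition ksp (X : lmodType K) (A : set X) :=
  A 0 /\ forall c x y, A x -> A y -> A (iota c *: x + y).

Definition klin (X Y : lmodType K) (f : X -> Y) :=
  forall c x y, f (iota c *: x + y) = iota c *: f x + f y.

Section OneModule.
Variable X : lmodType K.
Implicit Types (A B C D : set X) (x y : X).

Lemma ksp0 A : ksp A -> A 0. Proof. by case. Qed.

Lemma kspL A c x y : ksp A -> A x -> A y -> A (iota c *: x + y).
Proof. by case=> _; apply. Qed.

Lemma kspD A x y : ksp A -> A x -> A y -> A (x + y).
Proof. by move=> sA Ax Ay; have := kspL 1 sA Ax Ay; rewrite rmorph1 scale1r. Qed.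

Lemma kspZ A c x : ksp A -> A x -> A (iota c *: x).
Proof. by move=> sA Ax; have := kspL c sA Ax (ksp0 sA); rewrite addr0. Qed.

Lemma kspN A x : ksp A -> A x -> A (- x).
Proof. by move=> sA /(kspZ (-1) sA); rewrite rmorphN1 scaleN1r. Qed.

Lemma kspB A x y : ksp A -> A x -> A y -> A (x - y).
Proof. by move=> sA Ax Ay; apply: kspD => //; apply: kspN. Qed.

Lemma kspZV A c x : ksp A -> c != 0 -> A (iota c *: x) -> A x.
Proof.
move=> sA c0 /(kspZ c^-1 sA).
by rewrite scalerA -rmorphM mulVf // rmorph1 scale1r.
Qed.

Lemma ksp_sum A (I : Type) (r : seq I) (P : pred I) (F : I -> X) :
  ksp A -> (forall i, P i -> A (F i)) -> A (\sum_(i <- r | P i) F i).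
Proof.
move=> sA AF; elim/big_ind: _ => //; first exact: ksp0.
by move=> x y; apply: kspD.
Qed.

Lemma kspI A B : ksp A -> ksp B -> ksp (A `&` B).
Proof.
move=> sA sB; split; first by split; apply: ksp0.
by move=> c x y [Ax Bx] [Ay By]; split; apply: kspL.
Qed.

Lemma ksp_0 : ksp [set 0 : X].
Proof. by split=> // c x y -> ->; rewrite scaler0 addr0. Qed.

Definition addS A B := [set z : X | exists2 a, A a & B (z - a)].

Definition addl A x := [set y : X | exists c, A (y - iota c *: x)].

Lemma ksp_addS A B : ksp A -> ksp B -> ksp (addS A B).
Proof.
move=> sA sB; split; first by exists 0; [exact: ksp0 | rewrite subr0; exact: ksp0].
move=> c x y [a Aa Ba] [b Ab Bb]; exists (iota c *: a + b); first exact: kspL.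
by rewrite opprD addrACA -scalerBr; apply: kspL.
Qed.

Lemma addS_subl A B : ksp B -> A `<=` addS A B.
Proof. by move=> sB x Ax; exists x => //; rewrite subrr; apply: ksp0. Qed.

Lemma addS_subr A B : ksp A -> B `<=` addS A B.
Proof. by move=> sA x Bx; exists 0; [apply: ksp0 | rewrite subr0]. Qed.

Lemma addSC A B : addS A B = addS B A.
Proof.
by rewrite predeqE => z; split=> -[a Aa Ba]; exists (z - a) => //; rewrite opprB addrC subrK.
Qed.

Lemma ksp_addl A x : ksp A -> ksp (addl A x).
Proof.
move=> sA; split; first by exists 0; rewrite rmorph0 scale0r subrr; exact: ksp0.
move=> c y z [a Aa] [b Ab]; exists (c * a + b).
rewrite rmorphD rmorphM scalerDl -scalerA opprD addrACA -scalerBr; exact: kspL.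
Qed.

Lemma addl_sub A x : A `<=` addl A x.
Proof. by move=> y Ay; exists 0; rewrite rmorph0 scale0r subr0. Qed.

Lemma addl_mem A x : ksp A -> addl A x x.
Proof. by move=> sA; exists 1; rewrite rmorph1 scale1r subrr; exact: ksp0. Qed.

Lemma addl_min A x B : ksp B -> A `<=` B -> B x -> addl A x `<=` B.
Proof.
move=> sB AB Bx y [c /AB Ay]; rewrite -(subrK (iota c *: x) y).
by apply: kspD => //; apply: kspZ.
Qed.

Inductive rdim A : set X -> nat -> Prop :=
| rdim0 : rdim A A 0
| rdimS B C x n : rdim A B n -> ~ B x -> C = addl B x -> rdim A C n.+1.

Lemma rdim_sub A B n : rdim A B n -> A `<=` B.
Proof.
elim=> [|{}B C x {}n _ AB _ ->] y //.
by move=> /AB; apply: addl_sub.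
Qed.

Lemma rdim_ksp A B n : ksp A -> rdim A B n -> ksp B.
Proof. by move=> sA; elim=> [|{}B C x {}n _ sB _ ->] //; exact: ksp_addl. Qed.

Lemma rdim_trans A B C n m : rdim A B n -> rdim B C m -> rdim A C (n + m).
Proof.
move=> AB; elim=> [|D E x {}m _ AD Dx ->]; first by rewrite addn0.
by rewrite addnS; apply: rdimS AD Dx _.
Qed.

Lemma rdim0E A B : rdim A B 0 -> B = A.
Proof. by move=> H; inversion H. Qed.

Lemma rdim1 A x : ~ A x -> rdim A (addl A x) 1.
Proof. by move=> Ax; apply: rdimS (rdim0 A) Ax _. Qed.

Lemma rdimS_inv A B n : rdim A B n.+1 ->
  exists C x, [/\ rdim A C n, ~ C x & B = addl C x].
Proof. by move=> H; inversion H; subst; exists B0, x. Qed.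

Lemma rdim_mod A B D n : ksp A -> ksp D -> rdim A B n ->
  exists p q, [/\ n = (p + q)%N, rdim (addS A D) (addS B D) p
                & rdim (A `&` D) (B `&` D) q].
Proof.
move=> sA sD; elim=> [|{}B C x {}n AB [p [q [-> IHp IHq]]] Bx ->].
  by exists 0%N, 0%N; split => //; apply: rdim0.
have sB := rdim_ksp sA AB.
have [[b Bb Db]|nx] := pselect (addS B D x).
  exists p, q.+1; split; first by rewrite addnS.
    suff -> : addS (addl B x) D = addS B D by [].
    rewrite eqEsubset; split; last by move=> z [a Ba Da]; exists a => //; apply: addl_sub.
    move=> z [a [c Bc] Da].
    exists (a - iota c *: x + iota c *: b); first by apply: kspD => //; apply: kspZ.
    rewrite (_ : _ - _ = (z - a) + iota c *: (x - b)).
      by apply: kspD => //; exact: kspZ.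
    by rewrite scalerBr opprD opprB !addrA; congr (_ - _); rewrite addrAC.
  apply: (rdimS (x := x - b) IHq).
    by move=> [Bd _]; apply: Bx; rewrite -(subrK b x); apply: kspD.
  rewrite predeqE => z; split.
    move=> [[c Bc] Dz]; exists c; split.
      by rewrite scalerBr opprB addrA addrAC; apply: kspD => //; apply: kspZ.
    by apply: kspB => //; apply: kspZ.
  move=> [c [Bc Dc]]; split.
    exists c; rewrite (_ : _ - _ = z - iota c *: (x - b) - iota c *: b).
      by apply: kspB => //; apply: kspZ.
    by rewrite scalerBr opprB addrA [z + _ - _]addrAC addrK.
  by rewrite -(subrK (iota c *: (x - b)) z); apply: kspD => //; apply: kspZ.
exists p.+1, q; split => //.
  apply: (rdimS IHp nx); rewrite predeqE => z; split.
    move=> [a [c Bc] Da]; exists c, (a - iota c *: x) => //.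
    by rewrite opprB addrA subrK.
  move=> [c [a Ba Da]]; exists (a + iota c *: x); last by rewrite opprD addrCA addrC.
  by exists c; rewrite addrK.
suff -> : addl B x `&` D = B `&` D by [].
rewrite eqEsubset; split; last by move=> z [Bz Dz]; split => //; apply: addl_sub.
move=> z [[c Bc] Dz]; split => //.
have [c0|c0] := eqVneq c 0; first by move: Bc; rewrite c0 rmorph0 scale0r subr0.
case: nx; apply: (kspZV (c := - c) (ksp_addS sB sD)); first by rewrite oppr_eq0.
exists (z - iota c *: x) => //.
by rewrite rmorphN scaleNr opprB addKr; exact: kspN.
Qed.

Lemma addS_idl A B : ksp A -> ksp B -> A `<=` B -> addS A B = B.
Proof.
move=> sA sB AB; rewrite eqEsubset; split; last exact: addS_subr.
by move=> z [a /AB Ba Bz]; rewrite -(subrK a z); apply: kspD.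
Qed.

Lemma rdim_mid A D B n : ksp A -> ksp D -> A `<=` D -> D `<=` B -> rdim A B n ->
  exists p q, [/\ n = (p + q)%N, rdim A D p & rdim D B q].
Proof.
move=> sA sD AD DB AB; have sB := rdim_ksp sA AB.
have [p [q [-> Hp Hq]]] := rdim_mod sA sD AB.
exists q, p; split; first by rewrite addnC.
  by move: Hq; rewrite (setIidl AD) (setIidr DB).
by move: Hp; rewrite (addS_idl sA sD AD) addSC (addS_idl sD sB DB).
Qed.

Lemma rdim_ge1 A B n : ksp A -> rdim A B n.+1 -> ~ B `<=` A.
Proof.
move=> sA /rdimS_inv [C [x [AC Cx ->]]] BA; apply: Cx.
have sC := rdim_ksp sA AC.
exact/(rdim_sub AC)/BA/addl_mem.
Qed.

Lemma rdim_uniq A B n m : ksp A -> rdim A B n -> rdim A B m -> n = m.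
Proof.
move=> sA; elim: n B m => [|n IH] B m.
  move=> /rdim0E ->; case: m => // m /(rdim_ge1 sA); by case.
move=> nB; case: m => [/rdim0E BA|m mB]; first by case: (rdim_ge1 sA nB); rewrite BA.
congr _.+1.
have [B0 [x [AB0 B0x eB0]]] := rdimS_inv nB.
have [B1 [y [AB1 B1y eB1]]] := rdimS_inv mB.
have sB0 := rdim_ksp sA AB0; have sB1 := rdim_ksp sA AB1.
have sB := rdim_ksp sA nB.
have B0B : B0 `<=` B by rewrite eB0; exact: addl_sub.
have B1B : B1 `<=` B by rewrite eB1; exact: addl_sub.
have d0 : rdim B0 B 1 by rewrite eB0; exact: rdim1.
have d1 : rdim B1 B 1 by rewrite eB1; exact: rdim1.
have [p1 [q1 [e1]]] := rdim_mod sB1 sB0 d1.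
rewrite (setIidr B0B) [addS B B0]addSC (addS_idl sB0 sB B0B) => H1 H2.
have [p2 [q2 [e2]]] := rdim_mod sB0 sB1 d0.
rewrite (setIidr B1B) [addS B B1]addSC (addS_idl sB1 sB B1B) addSC setIC => H3 H4.
have sS := ksp_addS sB1 sB0.
have q12 : q1 = q2.
  case: p1 e1 H1 => [|p1] e1 H1; case: p2 e2 H3 => [|p2] e2 H3.
  - by rewrite -[q1]add0n -e1 e2.
  - by case: (rdim_ge1 sS H3); rewrite (rdim0E H1).
  - by case: (rdim_ge1 sS H1); rewrite (rdim0E H3).
  - by move: e1 e2; rewrite !addSn => -[e1] [e2]; case: p1 p2 q1 q2 e1 e2 {H1 H2 H3 H4}=> [|?] [|?] [|?] [|?].
have sD := kspI sB1 sB0.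
have AD : A `<=` B1 `&` B0 by move=> z Az; split; [exact: (rdim_sub AB1)|exact: (rdim_sub AB0)].
have DB0 : B1 `&` B0 `<=` B0 by move=> z [].
have [p [q [_ Hp _]]] := rdim_mid sA sD AD DB0 AB0.
rewrite (IH _ _ AB0 (rdim_trans Hp H2)) q12.
have AB1' := rdim_trans Hp H4.
have n' : n = (p + q2)%N by rewrite (IH _ _ AB0 (rdim_trans Hp H2)) q12.
by rewrite -n'; apply: IH AB1; rewrite n'.
Qed.

End OneModule.
End Subspaces.

Notation ksubspace := ksp (only parsing).

Section LinearAlgebra.
Variables (k : closedFieldType) (K : fieldType) (iota : {rmorphism k -> K}).
Local Notation ksp := (ksp iota).
Local Notation klin := (klin iota).
Local Notation addl := (addl iota).
Local Notation rdim := (rdim iota).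
Let ksp0 := @ksp0 _ _ iota.
Let kspD := @kspD _ _ iota.
Let kspN := @kspN _ _ iota.
Let kspB := @kspB _ _ iota.
Let ksp_sum := @ksp_sum _ _ iota.
Let addS_subl := @addS_subl _ _ iota.
Let addS_subr := @addS_subr _ _ iota.

Lemma klin0 (X Y : lmodType K) (f : X -> Y) : klin f -> f 0 = 0.
Proof.
move=> lf; have := lf (-1) 0 0; rewrite scaler0 addr0 => {1}->.
by rewrite rmorphN1 scaleN1r addNr.
Qed.

Lemma klinD (X Y : lmodType K) (f : X -> Y) : klin f -> {morph f : x y / x + y}.
Proof. by move=> lf x y; have := lf 1 x y; rewrite rmorph1 !scale1r. Qed.

Lemma klinZ (X Y : lmodType K) (f : X -> Y) c x :
  klin f -> f (iota c *: x) = iota c *: f x.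
Proof. by move=> lf; have := lf c x 0; rewrite (klin0 lf) !addr0. Qed.

Lemma klinB (X Y : lmodType K) (f : X -> Y) : klin f -> {morph f : x y / x - y}.
Proof.
move=> lf x y; have := klinZ (-1) y lf; rewrite rmorphN1 !scaleN1r => fN.
by rewrite (klinD lf) fN.
Qed.

Lemma ksp_preim (X Y : lmodType K) (f : X -> Y) (B : set Y) :
  klin f -> ksp B -> ksp (f @^-1` B).
Proof.
move=> lf sB; split; first by rewrite /preimage/= (klin0 lf); exact: ksp0.
by move=> c x y; rewrite /preimage/= lf; exact: kspL.
Qed.

Lemma ksp_im (X Y : lmodType K) (f : X -> Y) (A : set X) :
  klin f -> ksp A -> ksp (f @` A).
Proof.
move=> lf sA; split; first by (exists 0; [exact: ksp0 | exact: klin0]).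
move=> c _ _ [x Ax <-] [y Ay <-]; exists (iota c *: x + y); [exact: kspL|exact: lf].
Qed.

Lemma rdim_push (X Y : lmodType K) (f : X -> Y) (A B : set X) (D : set Y) n :
    klin f -> ksp A -> ksp D -> (forall a, A a -> D (f a)) ->
    (forall b, B b -> D (f b) -> A b) ->
  rdim A B n -> rdim D (addS (f @` B) D) n.
Proof.
move=> lf sA sD AD BD AB; elim: AB BD => [_|{}B C x {}n AB IH Bx -> CD].
  suff -> : addS (f @` A) D = D by apply: rdim0.
  by apply: (addS_idl (ksp_im lf sA) sD) => _ [a Aa <-]; exact: AD.
have sB := rdim_ksp sA AB.
have {}IH : rdim D (addS (f @` B) D) n.
  by apply: IH => b Bb; apply: CD; exact: addl_sub.
apply: (rdimS (x := f x) IH).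
  move=> [_ [b Bb <-]]; rewrite -(klinB lf) => /CD h; apply: Bx.
  rewrite -(subrK b x); apply: kspD => //; apply: (rdim_sub AB); apply: h.
  by apply: kspB; [exact: ksp_addl|exact: addl_mem|exact: addl_sub].
rewrite predeqE => z; split.
  move=> [_ [y [c By] <-] Dz]; exists c; exists (f (y - iota c *: x)).
    by exists (y - iota c *: x).
  by rewrite (klinB lf) (klinZ _ _ lf) opprB addrA subrK.
move=> [c [_ [b Bb <-] Dz]]; exists (f (b + iota c *: x)).
  by exists (b + iota c *: x) => //; exists c; rewrite addrK.
by rewrite (klinD lf) (klinZ _ _ lf) opprD addrA addrAC.
Qed.

Lemma rdim_im (X Y : lmodType K) (f : X -> Y) (A B : set X) n :
    klin f -> ksp A -> (forall b, B b -> f b = 0 -> A b) ->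
  rdim A B n -> rdim (f @` A) (f @` B) n.
Proof.
move=> lf sA Bf AB; have sB := rdim_ksp sA AB.
have sfA := ksp_im lf sA.
have sub : f @` A `<=` f @` B.
  by move=> _ [a Aa <-]; exists a => //; exact: (rdim_sub AB).
rewrite -(addS_idl sfA (ksp_im lf sB) sub) addSC.
apply: (rdim_push lf sA sfA _ _ AB) => [a Aa|b Bb [a Aa fab]]; first by exists a.
rewrite -(subrK a b); apply: kspD => //; apply: Bf; last by rewrite (klinB lf) fab subrr.
by apply: kspB => //; exact: (rdim_sub AB).
Qed.

Lemma rank_nullity (X Y : lmodType K) (f : X -> Y) (A B : set X) n :
    klin f -> ksp A -> rdim A B n ->
  exists p q, [/\ n = (p + q)%N, rdim (f @` A) (f @` B) p
     & rdim (A `&` [set x | f x = 0]) (B `&` [set x | f x = 0]) q].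
Proof.
move=> lf sA AB; have sD : ksp [set x | f x = 0] := ksp_preim lf (ksp_0 iota Y).
have [p [q [-> Hp Hq]]] := rdim_mod sA sD AB.
have imD (C : set X) : f @` (addS C [set x | f x = 0]) = f @` C.
  rewrite eqEsubset; split=> _ [x Cx <-].
    by case: Cx => c Cc /= /eqP; rewrite (klinB lf) subr_eq0 => /eqP ->; exists c.
  by exists x => //; exact: addS_subl.
exists p, q; split=> //; rewrite -(imD A) -(imD B).
by apply: rdim_im Hp => // [|b _ fb0]; [exact: ksp_addS|exact: addS_subr].
Qed.

Lemma rdim_preim (X Y : lmodType K) (f : X -> Y) (B : set X) (E F : set Y) n :
    klin f -> ksp B -> ksp E -> rdim E F n ->
  exists2 m, rdim (B `&` f @^-1` E) (B `&` f @^-1` F) m & (m <= n)%N.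
Proof.
move=> lf sB sE; elim=> [|{}F G u {}n EF [m IH mn] Fu ->].
  by exists 0%N => //; apply: rdim0.
have sF := rdim_ksp sE EF.
have [[y [By [c Fc]] nF]|no] := pselect (exists2 y, (B `&` f @^-1` addl F u) y & ~ F (f y)).
  exists m.+1 => //; apply: (rdimS (x := y) IH); first by case.
  have c0 : c != 0.
    by apply/eqP => c0; apply: nF; move: Fc; rewrite c0 rmorph0 scale0r subr0.
  rewrite predeqE => z; split.
    move=> [Bz [d Fd]]; exists (d / c); split; first by apply: kspB => //; exact: kspZ.
    rewrite /preimage/= (klinB lf) (klinZ _ _ lf).
    rewrite (_ : _ - _ = (f z - iota d *: u) - iota (d / c) *: (f y - iota c *: u)).
      by apply: kspB => //; exact: kspZ.
    by rewrite scalerBr scalerA -rmorphM divfK // opprB addrA subrK.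
  move=> [d [Bz Fz]]; split.
    by rewrite -(subrK (iota d *: y) z); apply: kspD => //; apply: kspZ.
  rewrite -(subrK (iota d *: y) z) /preimage/= (klinD lf).
  apply: kspD; [exact: ksp_addl|exact: addl_sub|].
  by rewrite (klinZ _ _ lf); apply: kspZ; [exact: ksp_addl|exists c].
exists m; last exact: leqW.
suff -> : B `&` f @^-1` addl F u = B `&` f @^-1` F by [].
rewrite eqEsubset; split=> z [Bz Fz]; split => //; last exact: addl_sub.
by apply: contrapT => nz; apply: no; exists z.
Qed.

Section Combinations.
Variable X : lmodType K.
Implicit Types (A B : set X) (e : nat -> X) (p q : {poly k}).

(* A linear relation among [e 0, e 1, ...] is encoded by the polynomial of its coefficients. *)
Definition lc p e := \sum_(i < size p) iota p`_i *: e i.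

Lemma lcE n p e : (size p <= n)%N -> lc p e = \sum_(i < n) iota p`_i *: e i.
Proof.
move=> pn; rewrite /lc (big_ord_widen n (fun i => iota p`_i *: e i) pn) big_mkcond /=.
apply: eq_bigr => i _; case: ltnP => // ip.
by rewrite nth_default // rmorph0 scale0r.
Qed.

Lemma lcB p q e : lc (p - q) e = lc p e - lc q e.
Proof.
set n := maxn (size (p - q)) (maxn (size p) (size q)).
rewrite !(@lcE n) ?leq_maxl // ?leq_max ?leqnn ?orbT // -sumrB.
by apply: eq_bigr => i _; rewrite coefB rmorphB scalerBl.
Qed.

Lemma lcZ c p e : lc (c *: p) e = iota c *: lc p e.
Proof.
rewrite (lcE _ (size_scale_leq c p)) scaler_sumr.
by apply: eq_bigr => i _; rewrite coefZ rmorphM scalerA.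
Qed.

Lemma lcXM p e : lc ('X * p) e = lc p (e \o S).
Proof.
rewrite (@lcE (size p).+1); last first.
  have [->|p0] := eqVneq p 0; first by rewrite mulr0 size_poly0.
  by rewrite mulrC size_mulX.
rewrite big_ord_recl coefXM /= rmorph0 scale0r add0r.
by apply: eq_bigr => i _; rewrite coefXM.
Qed.

Lemma lcXn n e : lc 'X^n e = e n.
Proof.
rewrite /lc size_polyXn big_ord_recr /= coefXn eqxx rmorph1 scale1r big1 ?add0r //.
by move=> i _; rewrite coefXn ltn_eqF // rmorph0 scale0r.
Qed.

Lemma lc_mem A p e : ksp A -> (forall i, (i < size p)%N -> A (e i)) -> A (lc p e).
Proof. by move=> sA Ae; apply: ksp_sum => // i _; apply: kspZ => //; exact: Ae. Qed.

Fixpoint spn A e n := if n is m.+1 then addl (spn A e m) (e m) else A.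

Lemma ksp_spn A e n : ksp A -> ksp (spn A e n).
Proof. by move=> sA; elim: n => //= n; apply: ksp_addl. Qed.

Lemma spn_min A B e n : ksp B -> A `<=` B -> (forall i, (i < n)%N -> B (e i)) ->
  spn A e n `<=` B.
Proof.
move=> sB AB; elim: n => //= n IH Be; apply: addl_min => //; last exact: Be.
by apply: IH => i /ltnW; exact: Be.
Qed.

Lemma spn_memP A e n x : ksp A -> spn A e n x <-> exists2 p : {poly k}, (size p <= n)%N & A (x - lc p e).
Proof.
move=> sA; elim: n x => [|n IH] x /=.
  split=> [Ax|[p]]; last by rewrite leqn0 size_poly_eq0 => /eqP ->; rewrite /lc size_poly0 big_ord0 subr0.
  by exists 0; rewrite ?size_poly0 // /lc size_poly0 big_ord0 subr0.
split=> [[c /IH[p pn Ap]]|[p pn Ap]].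
  exists (p - (- c) *: 'X^n).
    rewrite (leq_trans (size_polyD _ _)) // geq_max leqW // size_polyN.
    by rewrite (leq_trans (size_scale_leq _ _)) // size_polyXn.
  by rewrite lcB lcZ lcXn rmorphN scaleNr opprK opprD addrA addrAC.
exists p`_n; apply/IH; exists (p - p`_n *: 'X^n).
  apply/leq_sizeP => j nj; rewrite coefB coefZ coefXn.
  case: eqVneq => [->|jn]; first by rewrite mulr1 subrr.
  by rewrite mulr0 subr0 nth_default // (leq_trans pn) // ltn_neqAle eq_sym jn.
by rewrite lcB lcZ lcXn opprB addrA subrK.
Qed.

Lemma rdim_spn A e n : (forall i, (i < n)%N -> ~ spn A e i (e i)) -> rdim A (spn A e n) n.
Proof.
elim: n => [|n IH] h /=; first exact: rdim0.
apply: rdimS (IH _) (h n _) _ => // i ni; apply: h; exact: leqW.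
Qed.

Lemma rdim_dep A B n e : ksp A -> rdim A B n -> (forall i, (i <= n)%N -> B (e i)) ->
  exists p : {poly k}, [/\ p != 0, (size p <= n.+1)%N & A (lc p e)].
Proof.
move=> sA AB Be; have sB := rdim_ksp sA AB; apply: contrapT => no.
have ind i : (i < n.+1)%N -> ~ spn A e i (e i).
  move=> ni /(spn_memP _ _ _ sA) [q qi Aq]; apply: no; exists ('X^i - q).
  have sz : size ('X^i - q) = i.+1.
    by rewrite size_polyDl size_polyXn // size_polyN.
  by rewrite -size_poly_gt0 sz lcB lcXn; split.
have H := rdim_spn ind.
have sub : spn A e n.+1 `<=` B by apply: spn_min => //; exact: rdim_sub AB.
have [p [q [npq H1 _]]] := rdim_mid sA (ksp_spn e n.+1 sA) (rdim_sub H) sub AB.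
by move: npq; rewrite -(rdim_uniq sA H H1) addSn -addnS => /eqP; rewrite -{1}[n]addn0 eqn_add2l.
Qed.

Lemma spn_eq A e e' n : (forall i, (i < n)%N -> e i = e' i) -> spn A e n = spn A e' n.
Proof.
elim: n => //= n IH h; rewrite (h n) // IH // => i ni; exact/h/leqW.
Qed.

Lemma rdim_of_dep A B n : ksp A -> ksp B -> A `<=` B ->
    (forall e, (forall i, (i <= n)%N -> B (e i)) ->
       exists p : {poly k}, [/\ p != 0, (size p <= n.+1)%N & A (lc p e)]) ->
  exists2 m, rdim A B m & (m <= n)%N.
Proof.
move=> sA sB AB dep; apply: contrapT => no.
have build m : (m <= n.+1)%N ->
    exists2 e, (forall i, (i < m)%N -> B (e i)) & (forall i, (i < m)%N -> ~ spn A e i (e i)).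
  elim: m => [|m IH] mn; first by exists (fun=> 0).
  have [e Be ind] := IH (ltnW mn).
  have [x Bx nx] : exists2 x, B x & ~ spn A e m x.
    apply: contrapT => nox; apply: no; exists m => //.
    suff -> : B = spn A e m by exact: rdim_spn.
    rewrite eqEsubset; split; last exact: spn_min.
    by move=> x Bx; apply: contrapT => nx; apply: nox; exists x.
  exists (fun i => if (i < m)%N then e i else x) => i im.
    by case: ltnP => // /Be.
  rewrite (spn_eq _ (e' := e)); first by case: ltnP => [/ind //|mi]; have -> : i = m by apply/eqP; rewrite eqn_leq mi -ltnS im.
  move=> j ji; rewrite (leq_trans ji) //.
have [e Be ind] := build n.+1 (leqnn _).
have [p [p0 pn Ap]] := dep e Be.
have sp : size p = (size p).-1.+1 by rewrite prednK // size_poly_gt0.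
have l0 : lead_coef p != 0 by rewrite lead_coef_eq0.
apply: (ind (size p).-1); first by rewrite -sp.
apply: (kspZV (ksp_spn e _ sA) l0); apply/spn_memP => //.
exists (lead_coef p *: 'X^((size p).-1) - p).
  apply/leq_sizeP => j pj; rewrite coefB coefZ coefXn /lead_coef.
  case: eqVneq => [->|jn]; first by rewrite mulr1 subrr.
  rewrite mulr0 sub0r nth_default ?oppr0 // sp ltn_neqAle pj andbT.
  by rewrite eq_sym.
by rewrite lcB lcZ lcXn opprB addrC subrK.
Qed.

End Combinations.

Lemma klin_lc (X Y : lmodType K) (f : X -> Y) p e : klin f -> f (lc p e) = lc p (f \o e).
Proof.
move=> lf; rewrite /lc; elim/big_rec2: _ => [|i y1 y2 _ <-]; first exact: klin0.
exact: lf.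
Qed.

Lemma lc_sub (X : lmodType K) p (e e' : nat -> X) :
  lc p (fun i => e i - e' i) = lc p e - lc p e'.
Proof. by rewrite -sumrB; apply: eq_bigr => i _; rewrite scalerBr. Qed.

(* A pencil of linear maps between spaces of equal nonzero dimension has a singular
   member, as [k] is algebraically closed: if [g] is invertible, take an
   eigenvector of [g^-1 f]. *)
Lemma pencil (X Y : lmodType K) (f g : X -> Y) (A0 A : set X) (D0 D : set Y) n :
    klin f -> klin g -> ksp A0 -> ksp D0 ->
    (forall a, A a -> D (f a)) -> (forall a, A a -> D (g a)) ->
    (forall a, A0 a -> D0 (f a)) -> (forall a, A0 a -> D0 (g a)) ->
    rdim A0 A n.+1 -> rdim D0 D n.+1 ->
  exists l m a, [/\ (l != 0) || (m != 0), A a, ~ A0 a & D0 (iota l *: f a + iota m *: g a)].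
Proof.
move=> lf lg sA0 sD0 AfD AgD A0f A0g rA rD.
have sA := rdim_ksp sA0 rA; have sD := rdim_ksp sD0 rD.
have [[a [Aa nA Dga]]|ginj] := pselect (exists a, [/\ A a, ~ A0 a & D0 (g a)]).
  exists 0, 1, a; split => //; first by rewrite oner_neq0 orbT.
  by rewrite rmorph0 rmorph1 scale0r add0r scale1r.
have {}ginj b : A b -> D0 (g b) -> A0 b.
  by move=> Ab Db; apply: contrapT => nb; apply: ginj; exists b.
have H := rdim_push lg sA0 sD0 A0g ginj rA.
have sub : addS (g @` A) D0 `<=` D.
  move=> z [_ [a Aa <-] Dz]; rewrite -(subrK (g a) z); apply: kspD => //; last exact: AgD.
  exact: (rdim_sub rD).
have [p [q [npq H1 H2]]] := rdim_mid sD0 (ksp_addS (ksp_im lg sA) sD0) (rdim_sub H) sub rD.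
have q0 : q = 0%N.
  move: npq; rewrite -(rdim_uniq sD0 H H1) => /eqP; rewrite -{1}[n.+1]addn0 eqn_add2l.
  by move/eqP.
have gsurj d : D d -> exists a, A a /\ D0 (d - g a).
  by rewrite q0 in H2; rewrite (rdim0E H2) => -[_ [a Aa <-] Da]; exists a.
have /choice [nxt nxtP] : forall a, exists b, A a -> A b /\ D0 (f a - g b).
  move=> a; have [Aa|nAa] := pselect (A a); last by exists 0.
  by have [b] := gsurj _ (AfD _ Aa); exists b.
have [a0 Aa0 na0] : exists2 a0, A a0 & ~ A0 a0.
  apply: contrapT => no; apply: (rdim_ge1 sA0 rA) => a Aa.
  by apply: contrapT => na; apply: no; exists a.
pose e i := iter i nxt a0.
have Ae i : A (e i) by elim: i => //= i /nxtP [].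
have [p0 [p0n0 _ Ap0]] := rdim_dep sA0 rA (fun i _ => Ae i).
pose P m := `[< exists r : {poly k}, [/\ r != 0, size r = m & A0 (lc r e)] >].
have exP : exists m, P m by exists (size p0); apply/asboolP; exists p0.
case: (ex_minnP exP) => m /asboolP [r [rn0 rm Ar]] minm.
have small (s : {poly k}) : s != 0 -> (size s < m)%N -> ~ A0 (lc s e).
  move=> s0 sm As; have := minm (size s); rewrite leqNgt sm; move/(_ _)/negP.
  by case; [apply/asboolP; exists s|].
have sz1 : size r != 1%N.
  apply/eqP => /eqP /size_poly1P [c c0 rc]; apply: na0.
  by move: Ar; rewrite rc /lc size_polyC c0 big_ord_recl big_ord0 addr0 coefC; exact: kspZV.
have /closed_rootP [al /factor_theorem [s rs]] := sz1.
have s0 : s != 0 by apply: contra_neq rn0 => s0; rewrite rs s0 mul0r.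
have ssz : (size s < m)%N.
  by rewrite -rm rs size_Mmonic ?monicXsubC // size_XsubC addn2.
exists 1, (- al), (lc s e); split; first by rewrite oner_neq0.
- exact: lc_mem.
- exact: small.
rewrite rmorph1 scale1r rmorphN scaleNr.
rewrite (_ : _ - _ = lc s (fun i => f (e i) - g (e i.+1)) + g (lc r e)).
  by apply: kspD; [|apply: lc_mem => // i _; have [] := nxtP _ (Ae i)|exact: A0g].
rewrite lc_sub !(klin_lc _ _ lf) !(klin_lc _ _ lg) rs mulrBr -mulrC lcB lcXM mulrC mul_polyC lcZ.
by rewrite addrA subrK.
Qed.

Lemma functional_sep (X : lmodType K) (A : set X) x : ksp A -> ~ A x ->
  exists phi : X -> k, [/\ forall c y z, phi (iota c *: y + z) = c * phi y + phi z,
    forall a, A a -> phi a = 0 & phi x = 1].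
Proof.
move=> sA nAx; pose Q B := [/\ ksp B, A `<=` B & ~ B x].
have [M [[M0|[sM AM nMx]] maxM]] : exists M : set X, (M = set0 \/ Q M) /\
    forall B, (M `<` B) -> ~ (B = set0 \/ Q B).
- apply: Zorn_bigcup => F FP tot.
  have [[B [FB QB]]|noQ] := pselect (exists B, F B /\ Q B); last first.
    left; rewrite -subset0 => z [B FB Bz]; have [B0|QB] := FP _ FB; first by rewrite -B0.
    by case: noQ; exists B.
  right; have [sB AB nBx] := QB; split.
  + split; first by exists B => //; exact: ksp0.
    move=> c y z [B1 F1 y1] [B2 F2 z2].
    have inQ B' u : F B' -> B' u -> ksp B'.
      by move=> F' Bu; have [B0|[]//] := FP _ F'; move: Bu; rewrite B0.
    have [s12|s21] := tot _ _ F1 F2.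
      by exists B2 => //; apply: kspL (inQ _ _ F2 z2) (s12 _ y1) z2.
    by exists B1 => //; apply: kspL (inQ _ _ F1 y1) y1 (s21 _ z2).
  + by move=> a /AB Ba; exists B.
  + move=> [B1 F1 B1x]; have [B0|[]//] := FP _ F1; by rewrite B0 in B1x.
- case: (maxM A); last by right; split.
  by rewrite M0; split=> // /(_ 0); apply; exact: ksp0.
have dec y : exists c, M (y - iota c *: x).
  have [My|nMy] := pselect (M y); first by exists 0; rewrite rmorph0 scale0r subr0.
  have [[c Mc]|nx] := pselect (addl M y x).
    have c0 : c != 0.
      by apply/eqP => c0; apply: nMx; move: Mc; rewrite c0 rmorph0 scale0r subr0.
    exists c^-1; apply: (kspZV sM c0).
    rewrite scalerBr scalerA -rmorphM divff // rmorph1 scale1r -opprB; exact: kspN.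
  case: (maxM (addl M y)); last first.
    by right; split => //; [exact: ksp_addl|move=> a /AM; exact: addl_sub].
  by split=> [|/(_ y) h]; [exact: addl_sub|apply/nMy/h; exact: addl_mem].
have uniq c : M (iota c *: x) -> c = 0.
  move=> Mc; apply/eqP; apply: contraT => c0; case: nMx; exact: kspZV c0 Mc.
have [phi phiP] := choice dec.
have eqphi y c : M (y - iota c *: x) -> phi y = c.
  move=> Mc; apply/eqP; rewrite -subr_eq0; apply/eqP; apply: uniq.
  rewrite rmorphB scalerBl (_ : _ - _ = (y - iota c *: x) - (y - iota (phi y) *: x)).
    exact: kspB.
  by rewrite opprB [RHS]addrC addrA subrK.
exists phi; split=> [c y z|a Aa|].
- apply: eqphi; rewrite rmorphD rmorphM scalerDl -scalerA opprD addrACA -scalerBr.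
  exact: kspL.
- by apply: eqphi; rewrite rmorph0 scale0r subr0; exact: AM.
- by apply: eqphi; rewrite rmorph1 scale1r subrr; exact: ksp0.
Qed.

End LinearAlgebra.

(** * Products of subspaces of a field *)

Section ProductsOfSubspaces.
Variables (k : closedFieldType) (K : fieldType) (iota : {rmorphism k -> K}).
Add Field Kfield1 : (@kfield_theory K).
Local Notation ksp := (@ksp _ _ iota K^o).
Local Notation addl := (@addl _ _ iota K^o).
Local Notation rdim := (@rdim _ _ iota K^o).
Local Notation klin := (@klin _ _ iota K^o K^o).
Local Notation addS := (@addS _ K^o).
Local Notation dim := (rdim [set 0]).
Implicit Types (A B C : set K) (x y z e : K).
Let ksp0 := @ksp0 _ _ iota K^o.
Let kspD := @kspD _ _ iota K^o.
Let kspZ : forall A c x, ksp A -> A x -> A (iota c * x) := @kspZ _ _ iota K^o.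
Let kspI := @kspI _ _ iota K^o.
Let rdim_mod := @rdim_mod _ _ iota K^o.
Let rdim_mid := @rdim_mid _ _ iota K^o.
Let rdim_uniq := @rdim_uniq _ _ iota K^o.
Let addS_idl := @addS_idl _ _ iota K^o.
Let addS_subl := @addS_subl _ _ iota K^o.
Let ksp_addS := @ksp_addS _ _ iota K^o.
Let ksp_addl := @ksp_addl _ _ iota K^o.
Let addl_sub := @addl_sub _ _ iota K^o.
Let addl_mem := @addl_mem _ _ iota K^o.
Let addl_min := @addl_min _ _ iota K^o.
Let rdim_dep := @rdim_dep _ _ iota K^o.
Let spn_min := @spn_min _ _ iota K^o.
Let rdim_spn := @rdim_spn _ _ iota K^o.
Let rdim_sub := @rdim_sub _ _ iota K^o.
Let rdim_trans := @rdim_trans _ _ iota K^o.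
Let rdim_ge1 := @rdim_ge1 _ _ iota K^o.
Let rdim_ksp := @rdim_ksp _ _ iota K^o.
Let rdim0 := @rdim0 _ _ iota K^o.
Let rdimS := @rdimS _ _ iota K^o.
Let rdim1 := @rdim1 _ _ iota K^o.
Let rdim0E := @rdim0E _ _ iota K^o.
Let rdimS_inv := @rdimS_inv _ _ iota K^o.
Let spn_memP := @spn_memP _ _ iota K^o.
Let ksp00 : ksp [set 0] := ksp_0 iota K^o.

Definition peval p x := (map_poly iota p).[x].

Lemma pevalE p x : peval p x = \sum_(i < size p) iota p`_i * x ^+ i.
Proof.
rewrite /peval horner_coef size_map_poly.
by apply: eq_bigr => i _; rewrite coef_map.
Qed.

Lemma pevalD p q x : peval (p + q) x = peval p x + peval q x.
Proof. by rewrite /peval rmorphD hornerD. Qed.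

Lemma pevalB p q x : peval (p - q) x = peval p x - peval q x.
Proof. by rewrite /peval rmorphB !hornerE. Qed.

Lemma pevalM p q x : peval (p * q) x = peval p x * peval q x.
Proof. by rewrite /peval rmorphM hornerM. Qed.

Lemma pevalC c x : peval c%:P x = iota c.
Proof. by rewrite /peval map_polyC hornerC. Qed.

Lemma pevalX x : peval 'X x = x.
Proof. by rewrite /peval map_polyX hornerX. Qed.

Lemma pevalZ c p x : peval (c *: p) x = iota c * peval p x.
Proof. by rewrite -mul_polyC pevalM pevalC. Qed.

Lemma pevalXn n x : peval 'X^n x = x ^+ n.
Proof. by rewrite /peval map_polyXn hornerXn. Qed.

Lemma peval_wide n (p : {poly k}) x : (size p <= n)%N -> peval p x = \sum_(i < n) iota p`_i * x ^+ i.
Proof.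
move=> sp; rewrite /peval (@horner_coef_wide _ n) ?size_map_poly //.
by apply: eq_bigr => i _; rewrite coef_map.
Qed.

Lemma peval_comp (p q : {poly k}) x : peval (p \Po q) x = peval p (peval q x).
Proof. by rewrite /peval map_comp_poly horner_comp. Qed.

Lemma peval0 x : peval 0 x = 0.
Proof. by rewrite /peval rmorph0 horner0. Qed.

Lemma peval_factor p x : peval p x = iota (lead_coef p) *
  \prod_(c <- sval (closed_field_poly_normal p)) (x - iota c).
Proof.
rewrite {1}(svalP (closed_field_poly_normal p)) pevalZ; congr (_ * _).
elim: (sval _) => [|c r IH]; first by rewrite !big_nil -[1]/(1%:P) pevalC rmorph1.
by rewrite !big_cons pevalM pevalB pevalX pevalC IH.
Qed.

Lemma peval_eq0 p x : p != 0 -> peval p x = 0 -> exists c, x = iota c.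
Proof.
move=> p0 /eqP; rewrite peval_factor mulf_eq0 fmorph_eq0 lead_coef_eq0 (negPf p0) /=.
rewrite prodf_seq_eq0 => /hasP [c _]; rewrite subr_eq0 => /eqP ->; by exists c.
Qed.

Lemma lc_pow p c x : lc iota (X := K^o) p (fun i => c * x ^+ i) = c * peval p x.
Proof.
rewrite pevalE mulr_sumr; apply: eq_bigr => i _ /=.
by rewrite [_ *: _]/(_ * _) mulrCA.
Qed.

Lemma klin_mul e : klin ( *%R e).
Proof. by move=> c x y; rewrite mulrDr ![_ *: _]/(_ * _) mulrCA. Qed.

Lemma ksp_mul e A : ksp A -> ksp ( *%R e @` A).
Proof. exact: (ksp_im (klin_mul e)). Qed.

Lemma ksp_mul_preim e A : ksp A -> ksp ( *%R e @^-1` A).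
Proof. exact: (ksp_preim (klin_mul e)). Qed.

Lemma rdim_mul e A B n : e != 0 -> ksp A -> rdim A B n ->
  rdim ( *%R e @` A) ( *%R e @` B) n.
Proof.
move=> e0 sA; apply: (rdim_im (klin_mul e)) => // b _ /eqP.
by rewrite mulf_eq0 (negPf e0) => /eqP ->; exact: ksp0.
Qed.

Lemma im_mul0 e : *%R e @` [set 0] = [set 0].
Proof. by rewrite image_set1 mulr0. Qed.

Lemma dim_mul e A n : e != 0 -> dim A n -> dim ( *%R e @` A) n.
Proof. by move=> e0 /(rdim_mul e0 ksp00); rewrite im_mul0. Qed.

Lemma im_mulK a A : a != 0 -> *%R a^-1 @` ( *%R a @` A) = A.
Proof.
move=> a0; rewrite eqEsubset; split=> [_ [_ [x Ax <-] <-]|x Ax]; first by rewrite mulKf.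
by exists (a * x); [exists x|rewrite mulKf].
Qed.

Lemma dim_ksp A n : dim A n -> ksp A.
Proof. exact: rdim_ksp. Qed.

Lemma dim_sub A B n : ksp A -> A `<=` B -> dim B n ->
  exists p q, [/\ n = (p + q)%N, dim A p & rdim A B q].
Proof.
move=> sA AB; apply: rdim_mid => // _ ->; exact: ksp0.
Qed.

Lemma dim_le A B n m : dim A n -> dim B m -> A `<=` B -> (n <= m)%N.
Proof.
move=> An Bm AB; have [p [q [-> Ap _]]] := dim_sub (dim_ksp An) AB Bm.
by rewrite (rdim_uniq ksp00 An Ap) leq_addr.
Qed.

Lemma dim_eq A B n : dim A n -> dim B n -> A `<=` B -> A = B.
Proof.
move=> An Bn AB; have [p [q [npq Ap ABq]]] := dim_sub (dim_ksp An) AB Bn.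
move: npq; rewrite -(rdim_uniq ksp00 An Ap) => /eqP; rewrite -{1}[n]addn0 eqn_add2l => /eqP q0.
by move: ABq; rewrite -q0 => /rdim0E.
Qed.

Lemma dim_neq0 A n : dim A n.+1 -> exists2 a, A a & a != 0.
Proof.
move=> An; apply: contrapT => no; apply: (rdim_ge1 ksp00 An) => a Aa /=.
by apply/eqP; apply: contrapT => /negP a0; apply: no; exists a.
Qed.

Lemma dim_line x : x != 0 -> dim (addl [set 0] x) 1.
Proof. by move=> x0; apply: rdim1 => /= x0'; rewrite x0' eqxx in x0. Qed.

Lemma line_mem x y : addl [set 0] x y <-> exists c, y = iota c * x.
Proof.
split=> [[c /eqP]|[c ->]]; first by rewrite subr_eq0 => /eqP ->; exists c.
by exists c; apply/eqP; rewrite subr_eq0.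
Qed.

Lemma stab_const B b n z : dim B n -> B b -> b != 0 -> (forall y, B y -> B (z * y)) ->
  exists c, z = iota c.
Proof.
move=> Bn Bb b0 zB.
have Be i : B (b * z ^+ i).
  by elim: i => [|i IH]; rewrite ?expr0 ?mulr1 // exprS mulrCA; exact: zB.
have [p [p0 _]] := rdim_dep ksp00 Bn (fun i _ => Be i).
rewrite lc_pow => /eqP; rewrite mulf_eq0 (negPf b0) => /eqP.
exact: peval_eq0.
Qed.

Lemma second_iso A B p : ksp A -> ksp B -> rdim (A `&` B) A p -> rdim B (addS A B) p.
Proof.
move=> sA sB H; have sI := kspI sA sB.
have [p1 [p2 [-> H1 H2]]] := rdim_mod sI sB H.
have e : (A `&` B) `&` B = A `&` B by rewrite -setIA setIid.
rewrite e in H2; rewrite (rdim_uniq sI H2 (rdim0 _)) addn0.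
by move: H1; rewrite (addS_idl sI sB) // => z [].
Qed.

(* Dyson's transform: [A, B] is replaced by [A `&` e B, A + e B], whose products lie in
   [e A B] and whose dimensions have the same sum. *)
Lemma e_transform A B C e a b c : e != 0 -> dim A a -> dim B b -> dim C c ->
    (forall x y, A x -> B y -> C (x * y)) ->
  exists p q, [/\ a = (p + q)%N, dim (A `&` *%R e @` B) p, dim (addS A ( *%R e @` B)) (b + q)%N,
    dim ( *%R e @` C) c & forall x y, (A `&` *%R e @` B) x -> addS A ( *%R e @` B) y ->
      ( *%R e @` C) (x * y)].
Proof.
move=> e0 Aa Bb Cc AB; have sA := dim_ksp Aa; have eB := dim_mul e0 Bb.
have seB := dim_ksp eB; have sC := dim_ksp Cc.
have [p [q [-> Ip Iq]]] := dim_sub (kspI sA seB) (@subIsetl _ A _) Aa.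
exists p, q; split => //.
- exact: rdim_trans eB (second_iso sA seB Iq).
- exact: dim_mul.
- move=> x y [Ax [x' Bx' ex']] [y1 Ay1 [y2 By2 ey2]].
  rewrite -(subrK y1 y) -ey2 mulrDr; exists (x * y2 + y1 * x').
    by apply: kspD => //; apply: AB.
  by rewrite -ex'; kfold K; ring.
Qed.

Lemma hopf A B C a b c : dim A a.+1 -> dim B b.+1 -> dim C c ->
  (forall x y, A x -> B y -> C (x * y)) -> (a + b < c)%N.
Proof.
elim/ltn_ind: a A B C b c => a IH A B C b c Aa Bb Cc AB.
have [a0 Aa0 a0n] := dim_neq0 Aa.
have sC := dim_ksp Cc; have sA := dim_ksp Aa.
have [an0|apos] := posnP a.
  subst a; rewrite add0n; apply: (dim_le (dim_mul a0n Bb) Cc) => _ [y By <-].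
  exact: AB.
have [[b0 [Bb0 b0n nsub]]|all_sub] :=
    pselect (exists b0, [/\ B b0, b0 != 0 & ~ (A `<=` *%R (a0 / b0) @` B)]); last first.
  have Aline : A `<=` addl [set 0] a0.
    move=> x Ax; apply/line_mem.
    have [y0 By0 y00] := dim_neq0 Bb.
    have [cc xc] : exists cc, x / a0 = iota cc.
      apply: (stab_const Bb By0 y00) => y By.
      have [->|yn0] := eqVneq y 0; first by rewrite mulr0; exact: ksp0 (dim_ksp Bb).
      have [y' By' xy'] : ( *%R (a0 / y) @` B) x.
        by apply: contrapT => nx; apply: all_sub; exists y; split=> // /(_ x Ax).
      suff -> : x / a0 * y = y' by [].
      by rewrite -xy'; kfold K; field; split; exact/eqP.
    by exists cc; rewrite -xc divfK.
  by have := dim_le Aa (dim_line a0n) Aline; rewrite ltnS leqNgt apos.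
have e0 : a0 / b0 != 0 by rewrite mulf_neq0 // invr_eq0.
have [p [q [apq A1 B1 C1 AB1]]] := e_transform e0 Aa Bb Cc AB.
case: p apq A1 => [|p] apq A1.
  have : (A `&` *%R (a0 / b0) @` B) a0 by split => //; exists b0 => //; rewrite divfK.
  by rewrite (rdim0E A1) => /eqP; rewrite (negPf a0n).
case: q apq B1 => [|q] apq B1.
  by case: nsub; move: A1; rewrite -[p.+1]addn0 -apq => /dim_eq /(_ Aa) <- // x [].
rewrite addSn addnS in apq; move: apq => [apq].
have pa : (p < a)%N by rewrite apq ltnS leq_addr.
have h : (p + (b + q.+1) < c)%N := IH p pa _ _ _ _ _ A1 B1 C1 AB1.
lia.
Qed.

Definition progression c x n := [set c * peval p x | p in [set p : {poly k} | (size p <= n)%N]].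

Definition is_progression A n := exists c x,
  [/\ c != 0, ~ range iota x & A = progression c x n].

Lemma progressionE c x n : progression c x n = spn iota (X := K^o) [set 0] (fun i => c * x ^+ i) n.
Proof.
rewrite predeqE => z; split.
  move=> [p pn <-]; apply/(spn_memP _ _ _ ksp00); exists p => //=.
  by rewrite lc_pow subrr.
move=> /(spn_memP _ _ _ ksp00) [p pn /eqP]; rewrite lc_pow subr_eq0 => /eqP ->.
by exists p.
Qed.

Lemma progression_pow c x n i : (i < n)%N -> progression c x n (c * x ^+ i).
Proof. by move=> ni; exists 'X^i; rewrite /= ?size_polyXn // pevalXn. Qed.

Lemma peval_inj p x : ~ range iota x -> peval p x = 0 -> p = 0.
Proof.
move=> nx px; apply/eqP; apply: contrapT => /negP /peval_eq0 /(_ px) [c xc].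
by apply: nx; exists c.
Qed.

Lemma dim_progression c x n : c != 0 -> ~ range iota x -> dim (progression c x n) n.
Proof.
move=> c0 nx; rewrite progressionE; apply: rdim_spn => i _.
move=> /(spn_memP _ _ _ ksp00) [p pn /eqP].
rewrite lc_pow -mulrBr mulf_eq0 (negPf c0) /= -pevalXn -pevalB => /eqP /(peval_inj nx) /eqP.
rewrite subr_eq0 => /eqP e; move: pn; rewrite -e size_polyXn ltnn //.
Qed.

Lemma is_progression_mul e A n : e != 0 -> is_progression ( *%R e @` A) n -> is_progression A n.
Proof.
move=> e0 [c [x [c0 nx eA]]]; exists (c / e), x; split => //.
  by rewrite mulf_neq0 // invr_eq0.
rewrite predeqE => z; split.
  move=> Az; have : ( *%R e @` A) (e * z) by exists z.
  rewrite eA => -[p pn pz]; exists p => //.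
  by rewrite mulrAC pz mulrC mulKf.
move=> [p pn <-]; have : progression c x n (c * peval p x) by exists p.
rewrite -eA => -[a Aa eac]; rewrite mulrAC -eac mulrC mulKf //.
Qed.

Lemma dim2_progression A B C b : dim A 2 -> dim B b.+1 -> dim C b.+2 ->
  (forall x y, A x -> B y -> C (x * y)) -> is_progression C b.+2.
Proof.
move=> A2 Bb Cb AB; have sB := dim_ksp Bb; have sC := dim_ksp Cb.
have [A1 [a2 [A1d na2 eA]]] := rdimS_inv A2.
have [A0 [a1 [/rdim0E -> na1 eA1]]] := rdimS_inv A1d.
have Aa1 : A a1 by rewrite eA eA1; apply: addl_sub; apply: addl_mem.
have Aa2 : A a2 by rewrite eA; apply: addl_mem; rewrite eA1; apply: ksp_addl.
have a10 : a1 != 0 by apply/eqP.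
pose x := a2 / a1.
have xa : a2 = a1 * x by rewrite mulrC divfK.
have nx : ~ range iota x.
  move=> [c _ cx]; apply: na2; rewrite eA1; apply/line_mem; exists c.
  by rewrite cx xa mulrC.
pose F := addS B ( *%R x @` B).
have sF : ksp F by apply: ksp_addS => //; exact: ksp_mul.
have FC : *%R a1 @` F `<=` C.
  move=> _ [w [y By [y' By' e]] <-]; rewrite -(subrK y w) -e mulrDr.
  apply: kspD => //; last exact: AB.
  by rewrite mulrA -xa; exact: AB.
have [m BF mle] : exists2 m, rdim B F m & (m <= 1)%N.
  have [p [q [epq Fp _]]] := dim_sub (ksp_mul a1 sF) FC Cb.
  have a1V : a1^-1 != 0 by rewrite invr_eq0.
  have := dim_mul a1V Fp; rewrite im_mulK // => Fp'.
  have [p1 [m [ep1 Bp1 BFm]]] := dim_sub sB (addS_subl (ksp_mul x sB)) Fp'.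
  exists m => //; move: epq; rewrite ep1 -(rdim_uniq ksp00 Bb Bp1) => /eqP.
  by rewrite -addnA -[b.+2]addn1 eqn_add2l => /eqP ->; rewrite leq_addr.
pose Bj j := [set y : K | forall i, (i <= j)%N -> B (x ^+ i * y)].
have BjE j : Bj j.+1 = Bj j `&` *%R (x ^+ j.+1) @^-1` B.
  rewrite predeqE => y; split=> [h|[h1 h2] i].
    by split=> [i ij|]; apply: h => //; exact: leqW.
  by rewrite leq_eqVlt => /orP [/eqP -> //|]; exact: h1.
have sBj j : ksp (Bj j).
  elim: j => [|j IH]; last by rewrite BjE; apply: kspI => //; exact: ksp_mul_preim.
  suff -> : Bj 0%N = B by [].
  rewrite predeqE => y; split=> [/(_ 0%N isT)|By i]; first by rewrite expr0 mul1r.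
  by rewrite leqn0 => /eqP ->; rewrite expr0 mul1r.
have BjB j : exists2 m, rdim (Bj j) B m & (m <= j)%N.
  elim: j => [|j [n jn nj]].
    exists 0%N => //; suff -> : Bj 0%N = B by exact: rdim0.
    rewrite predeqE => y; split=> [/(_ 0%N isT)|By i]; first by rewrite expr0 mul1r.
    by rewrite leqn0 => /eqP ->; rewrite expr0 mul1r.
  have [n' H n'm] := rdim_preim (klin_mul (x ^+ j.+1)) (sBj j) sB BF.
  exists (n' + n)%N; last by rewrite -[j.+1]add1n leq_add // (leq_trans n'm).
  have e : Bj j `&` *%R (x ^+ j.+1) @^-1` F = Bj j.
    rewrite predeqE => y; split=> [[]//|yj]; split=> //.
    exists 0; first exact: ksp0.
    by rewrite subr0 exprS -mulrA; exists (x ^+ j * y) => //; exact: yj.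
  by rewrite BjE; rewrite e in H; apply: rdim_trans H jn.
have [be Bbe be0] : exists2 y : K, Bj b y & y != 0.
  have [n jn nb] := BjB b.
  apply: contrapT => no.
  have B0 : Bj b = [set 0].
    rewrite predeqE => y; split=> [yb|->]; last exact: ksp0.
    by apply/eqP; apply: contrapT => /negP yn; apply: no; exists y.
  rewrite B0 in jn; have := rdim_uniq ksp00 Bb jn => en.
  by move: nb; rewrite -en ltnn.
exists (a1 * be), x; split=> //; first by rewrite mulf_neq0.
symmetry; apply: dim_eq Cb _; first by apply: dim_progression => //; rewrite mulf_neq0.
rewrite progressionE; apply: spn_min => // [_ ->|i]; first exact: ksp0.
rewrite ltnS leq_eqVlt => /orP [/eqP ->|ib] /=.
  have H := AB _ _ Aa2 (Bbe b (leqnn b)); suff -> : a1 * be * x ^+ b.+1 = a2 * (x ^+ b * be) by exact: H.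
  by rewrite xa exprS; kfold K; ring.
have H := AB _ _ Aa1 (Bbe i ib); suff -> : a1 * be * x ^+ i = a1 * (x ^+ i * be) by exact: H.
by kfold K; ring.
Qed.

Lemma vosper A B C a b : dim A a.+2 -> dim B b.+2 -> dim C (a + b).+3 ->
  (forall x y, A x -> B y -> C (x * y)) -> is_progression C (a + b).+3.
Proof.
wlog ab : a b A B / (a <= b)%N.
  move=> W Aa Bb Cc AB; have [ab|/ltnW ba] := leqP a b; first exact: (W _ _ A B).
  rewrite addnC; apply: (W b a B A) => //; first by rewrite addnC.
  by move=> x y Bx Ay; rewrite mulrC; exact: AB.
elim/ltn_ind: a A B C b ab => a IH A B C b ab Aa Bb Cc AB.
have sA := dim_ksp Aa; have sB := dim_ksp Bb; have sC := dim_ksp Cc.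
have [a0|apos] := posnP a.
  by subst a; rewrite add0n in Cc *; exact: (dim2_progression Aa Bb Cc AB).
have [[e [p [e0 Ip pa]]]|no] := pselect (exists e p,
    [/\ e != 0, dim (A `&` *%R e @` B) p.+2 & (p < a)%N]).
  have [p' [q [apq A1 B1 C1 AB1]]] := e_transform e0 Aa Bb Cc AB.
  have pp := rdim_uniq ksp00 Ip A1; rewrite -pp in apq A1.
  rewrite !addSn in apq; move: apq => [apq].
  rewrite !addSn in B1.
  have ebq : (a + b = p + (b + q))%N by rewrite apq addnAC addnA.
  rewrite ebq in C1 Cc *; apply: (is_progression_mul e0).
  apply: (IH p pa _ _ _ (b + q)%N _ A1 B1 C1 AB1).
  by rewrite (leq_trans (ltnW pa)) // (leq_trans ab) // leq_addr.
exfalso.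
have dag e u v : e != 0 -> A u -> A v -> u != 0 -> ~ addl [set 0] u v ->
    ( *%R e @` B) u -> ( *%R e @` B) v -> A `<=` *%R e @` B.
  move=> e0 Au Av u0 nv eBu eBv.
  have [p [q [epq Ip Iq]]] := dim_sub (kspI sA (ksp_mul e sB)) (@subIsetl _ A _) Aa.
  have uv : dim (addl (addl [set 0] u) v) 2 by apply: rdimS (dim_line u0) nv _.
  have p2 : (2 <= p)%N.
    apply: dim_le uv Ip _; apply: addl_min => //.
      by apply: kspI => //; exact: ksp_mul.
    apply: addl_min => //; first by apply: kspI => //; exact: ksp_mul.
    by move=> _ ->; apply: ksp0; apply: kspI => //; exact: ksp_mul.
  case: p p2 epq Ip => [|[|p]] // _ epq Ip.
  have [pa|ap] := ltnP p a; first by case: no; exists e, p.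
  have : p.+2 = a.+2.
    by apply/eqP; rewrite eqn_leq !ltnS ap andbT -ltnS -ltnS epq leq_addr.
  by move=> e2; rewrite e2 in Ip; rewrite -(dim_eq Ip Aa (@subIsetl _ A _)) => z [].
have Adec : exists a1 a2 a3, [/\ A a1, A a2, A a3, a1 != 0 &
     ~ addl (addl [set 0] a1) a2 a3 /\ ~ addl [set 0] a1 a2].
  have [a1 Aa1 a10] := dim_neq0 Aa.
  have sub D n : ksp D -> dim D n -> (n < a.+2)%N -> exists2 z, A z & ~ D z.
    move=> sD Dn na; apply: contrapT => no'.
    have : A `<=` D by move=> z Az; apply: contrapT => nz; apply: no'; exists z.
    by move/(dim_le Aa Dn); rewrite leqNgt na.
  have d1 := dim_line a10.
  have [a2 Aa2 na2] := sub _ _ (dim_ksp d1) d1 isT.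
  have d2 : dim (addl (addl [set 0] a1) a2) 2 by apply: rdimS d1 na2 _.
  have [a3 Aa3 na3] := sub _ _ (dim_ksp d2) d2 apos.
  by exists a1, a2, a3.
have [a1 [a2 [a3 [Aa1 Aa2 Aa3 a10 [na3 na2]]]]] := Adec.
pose Y := [set y : K | forall z, A z -> B (y * z)].
have sY : ksp Y.
  split; first by move=> z _; rewrite mul0r; exact: ksp0.
  move=> c y y' Yy Yy' z Az; rewrite mulrDl; apply: kspD => //; last exact: Yy'.
  by rewrite [_ *: _]/(_ * _) -mulrA; apply: kspZ => //; exact: Yy.
have ker u y : A u -> ~ addl [set 0] a1 u -> B y -> ( *%R a1 @` B) (u * y) -> ( *%R a1 @` Y) y.
  move=> Au nu By [y' By' ey'].
  have [->|y0] := eqVneq y 0; first by exists 0; [exact: ksp0|rewrite mulr0].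
  exists (y / a1); last by rewrite mulrC divfK.
  have e0 : a1 / y != 0 by rewrite mulf_neq0 // invr_eq0.
  have sub : A `<=` *%R (a1 / y) @` B.
    apply: (dag _ _ _ e0 Aa1 Au a10 nu); first by exists y => //; rewrite divfK.
    exists y' => //; apply: (mulIf y0); rewrite -ey'; kfold K; field; exact/eqP.
  move=> z Az; have [y'' By'' e''] := sub z Az.
  suff -> : y / a1 * z = y'' by [].
  by rewrite -e''; kfold K; field; split; exact/eqP.
have YB : *%R a1 @` Y `<=` B by move=> _ [y Yy <-]; rewrite mulrC; exact: Yy.
have [y [n [eyn Yy Yn]]] := dim_sub (ksp_mul a1 sY) YB Bb.
have aBC : *%R a1 @` B `<=` C by move=> _ [z Bz <-]; exact: AB.
have aB := dim_mul a10 Bb.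
have [p [q [epq aB' Cq]]] := dim_sub (ksp_mul a1 sB) aBC Cc.
have {aB' epq} eq : q = a.+1.
  by rewrite -(rdim_uniq ksp00 aB aB') in epq; lia.
rewrite {q}eq in Cq.
have saB := ksp_mul a1 sB; have saY := ksp_mul a1 sY.
have Ypush u : A u -> forall z, ( *%R a1 @` Y) z -> ( *%R a1 @` B) (u * z).
  by move=> Au _ [w Yw <-]; exists (w * u); [exact: Yw|kfold K; ring].
have nle : (n <= a.+1)%N.
  have H := rdim_push (klin_mul a2) saY saB (Ypush _ Aa2) (fun z Bz => ker _ _ Aa2 na2 Bz) Yn.
  have sub : addS ( *%R a2 @` B) ( *%R a1 @` B) `<=` C.
    move=> z [_ [w Bw <-] aBz]; rewrite -(subrK (a2 * w) z).
    by apply: kspD => //; [exact: aBC|exact: AB].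
  have [p1 [q1 [-> H1 _]]] := rdim_mid saB (ksp_addS (ksp_mul a2 sB) saB) (rdim_sub H) sub Cq.
  by rewrite (rdim_uniq saB H H1) leq_addr.
have nge : (a.+1 <= n)%N.
  case: y eyn Yy => [|y] eyn Yy; first by rewrite add0n in eyn; rewrite -eyn ltnS (leq_trans ab).
  have Y0 : dim Y y.+1.
    have a1V : a1^-1 != 0 by rewrite invr_eq0.
    by have := dim_mul a1V Yy; rewrite im_mulK.
  have h : (y + a.+1 < b.+2)%N := hopf Y0 Aa Bb (fun u v Yu => Yu v).
  lia.
have en : n = a.+1 by apply/eqP; rewrite eqn_leq nle nge.
rewrite en in Yn.
have [l [m [z [lm Bz nz Dz]]]] := pencil (klin_mul a2) (klin_mul a3) saY saB
  (fun z Bz => AB _ _ Aa2 Bz) (fun z Bz => AB _ _ Aa3 Bz) (Ypush _ Aa2) (Ypush _ Aa3) Yn Cq.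
apply: nz; apply: (ker (iota l * a2 + iota m * a3)) => //.
- by apply: kspD => //; apply: kspZ.
- move=> /line_mem [c ec].
  have [m0|m0] := eqVneq m 0.
    rewrite m0 eqxx orbF in lm; apply: na2; apply/line_mem; exists (c / l).
    rewrite rmorphM fmorphV mulrAC -ec m0 rmorph0 mul0r addr0 mulrAC divff ?mul1r //.
    by rewrite fmorph_eq0.
  have im0 : iota m <> 0 by apply/eqP; rewrite fmorph_eq0.
  have ea3 : a3 = (iota c * a1 - iota l * a2) / iota m by rewrite -ec; kfold K; field.
  apply: na3; exists (- l / m); apply/line_mem; exists (c / m).
  have -> : iota (- l / m) = - iota l / iota m by rewrite rmorphM fmorphV rmorphN.
  have -> : iota (c / m) = iota c / iota m by rewrite rmorphM fmorphV.
  by rewrite ea3; kfold K; field.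
- by rewrite mulrDl -!mulrA.
Qed.

End ProductsOfSubspaces.

(** * Algebraic dependence, valuation rings and points *)

Section AlgebraicDependence.
Variables (k : closedFieldType) (K : fieldType) (iota : {rmorphism k -> K}).
Implicit Types (x y z : K) (A B : set K).
Local Notation peval := (peval iota).

Lemma subringP A : subring A <->
  [/\ A 1, forall x y, A x -> A y -> A (x - y) & forall x y, A x -> A y -> A (x * y)].
Proof.
split=> [[A1 AB AM]|[A1 AB AM]]; split.
- by move: A1; rewrite in_setE.
- by move=> x y Ax Ay; have := AB x y; rewrite !in_setE; apply.
- by move=> x y Ax Ay; have := AM x y; rewrite !in_setE; apply.
- by rewrite in_setE.
- by move=> x y; rewrite !in_setE; exact: AB.
- by move=> x y; rewrite !in_setE; exact: AM.
Qed.

Lemma subring1 A : subring A -> A 1. Proof. by case/subringP. Qed.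
Lemma subringB A x y : subring A -> A x -> A y -> A (x - y).
Proof. by case/subringP=> _ h _; apply: h. Qed.
Lemma subringM A x y : subring A -> A x -> A y -> A (x * y).
Proof. by case/subringP=> _ _; apply. Qed.
Lemma subring0 A : subring A -> A 0.
Proof. by move=> sA; rewrite -(subrr 1); apply: subringB (subring1 sA) _ => //; exact: subring1. Qed.
Lemma subringN A x : subring A -> A x -> A (- x).
Proof. by move=> sA Ax; rewrite -sub0r; apply: subringB => //; exact: subring0. Qed.
Lemma subringD A x y : subring A -> A x -> A y -> A (x + y).
Proof. by move=> sA Ax Ay; rewrite -[y]opprK; apply: subringB => //; exact: subringN. Qed.
Lemma subringX A x n : subring A -> A x -> A (x ^+ n).
Proof.
move=> sA Ax; elim: n => [|n IH]; first by rewrite expr0; exact: subring1.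
by rewrite exprS; exact: subringM.
Qed.
Lemma subring_sum A (I : Type) (r : seq I) (P : pred I) (F : I -> K) :
  subring A -> (forall i, P i -> A (F i)) -> A (\sum_(i <- r | P i) F i).
Proof.
move=> sA AF; elim/big_ind: _ => //; first exact: subring0.
by move=> x y; apply: subringD.
Qed.

Definition ksubring A := subring A /\ range iota `<=` A.

Lemma ksubringC A c : ksubring A -> A (iota c).
Proof. by move=> [_]; apply; exists c. Qed.

Lemma ksubring_ksp A : ksubring A -> @ksp _ _ iota K^o A.
Proof.
move=> kA; have sA := kA.1; split; first exact: subring0.
move=> c x y Ax Ay; apply: subringD => //; apply: subringM => //; exact: ksubringC.
Qed.

Lemma ksubring_peval A p x : ksubring A -> A x -> A (peval p x).
Proof.
move=> kA Ax; have sA := kA.1; rewrite pevalE; apply: subring_sum => // i _.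
by apply: subringM => //; [exact: ksubringC|exact: subringX].
Qed.

Lemma notconst_transc x : ~ range iota x <-> ~ algebraicOver iota x.
Proof.
split=> nx; first by move=> [p p0 /rootP px]; have [c ec] := peval_eq0 p0 px; apply: nx; exists c.
by move=> [c _ cx]; apply: nx; rewrite -cx; exact: algebraic_id.
Qed.

Definition evk x : {rmorphism {poly k} -> K} := horner_eval x \o map_poly iota.

Lemma evkE x p : evk x p = peval p x. Proof. by []. Qed.

Definition fnum (q : {fraction {poly k}}) : {poly k} := (frac (generic_quotient.repr q)).1.
Definition fden (q : {fraction {poly k}}) : {poly k} := (frac (generic_quotient.repr q)).2.

Lemma fden_neq0 q : fden q != 0. Proof. exact: denom_ratioP. Qed.

Section Fraction.
Variables (x : K) (nx : ~ range iota x).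

Lemma evk_inj : injective (evk x).
Proof.
move=> p q; rewrite !evkE => /eqP; rewrite -subr_eq0 -pevalB => /eqP h.
by apply/eqP; rewrite -subr_eq0; apply/eqP; exact: peval_inj nx h.
Qed.

Lemma evk_eq0 p : (evk x p == 0) = (p == 0).
Proof. by rewrite -(rmorph0 (evk x)) (inj_eq evk_inj). Qed.

Lemma fracE (q : {fraction {poly k}}) :
  q = tofrac (fnum q) / tofrac (fden q).
Proof.
have d0 : tofrac (fden q) != 0 by rewrite tofrac_eq0 fden_neq0.
apply: (mulIf d0); rewrite divfK // -{1}[q]generic_quotient.reprK; unlock tofrac; rewrite -[LHS]FracField.pi_mul.
apply/generic_quotient.eqmodP; rewrite /= FracField.equivfE /FracField.mulf /=.
by rewrite !numden_Ratio ?mulr1 ?mul1r ?oner_neq0 ?denom_ratioP //; rewrite mulrC.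
Qed.

Definition fev (q : {fraction {poly k}}) : K := evk x (fnum q) / evk x (fden q).

Lemma fevE n d : d != 0 -> fev (tofrac n / tofrac d) = evk x n / evk x d.
Proof.
move=> d0; set q := tofrac n / tofrac d.
have /eqP := fracE q; have dq0 := fden_neq0 q.
rewrite {1}/q eqr_div ?tofrac_eq0 // -!tofracM tofrac_eq => /eqP e.
apply/eqP; rewrite /fev eqr_div ?evk_eq0 // -!rmorphM e.
by rewrite mulrC.
Qed.

Lemma fev_tofrac n : fev (tofrac n) = evk x n.
Proof.
by rewrite -[tofrac n]divr1 -(rmorph1 (@tofrac {poly k})) fevE ?oner_neq0 // rmorph1 divr1.
Qed.

Lemma fev_is_zmod_morphism : zmod_morphism fev.
Proof.
move=> p q; rewrite {1}(fracE p) {1}(fracE q).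
set n1 := (fnum p); set d1 := (fden p); set n2 := (fnum q); set d2 := (fden q).
have d10 : d1 != 0 by exact: fden_neq0.
have d20 : d2 != 0 by exact: fden_neq0.
rewrite -mulNr -rmorphN addf_div ?tofrac_eq0 // -!tofracM -tofracD fevE ?mulf_neq0 //.
rewrite /fev -/n1 -/d1 -/n2 -/d2 rmorphD !rmorphM rmorphN -mulNr addf_div ?evk_eq0 //.
Qed.

Lemma fev_is_monoid_morphism : monoid_morphism fev.
Proof.
split; first by rewrite -(rmorph1 (@tofrac {poly k})) fev_tofrac rmorph1.
move=> p q; rewrite {1}(fracE p) {1}(fracE q) mulf_div -!tofracM.
by rewrite fevE ?mulf_neq0 ?fden_neq0 // !rmorphM -mulf_div.
Qed.

HB.instance Definition _ := GRing.isZmodMorphism.Build _ _ fev fev_is_zmod_morphism.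
HB.instance Definition _ := GRing.isMonoidMorphism.Build _ _ fev fev_is_monoid_morphism.

Definition fev_morph : {rmorphism {fraction {poly k}} -> K} := fev.

Lemma fev_morphE n d : d != 0 -> fev_morph (tofrac n / tofrac d) = peval n x / peval d x.
Proof. exact: fevE. Qed.

Lemma fev_morph_tofrac n : fev_morph (tofrac n) = peval n x.
Proof. exact: fev_tofrac. Qed.

Lemma clear_denominators (p : {poly {fraction {poly k}}}) : exists d (F : {poly {poly k}}),
  d != 0 /\ tofrac d *: p = map_poly (@tofrac {poly k}) F.
Proof.
elim/poly_ind: p => [|p c [d [F [d0 e]]]].
  by exists 1, 0; rewrite oner_neq0 scaler0 rmorph0.
pose n := (fnum c); pose e' := (fden c).
have e0 : e' != 0 by exact: fden_neq0.
exists (d * e'), (e' *: F * 'X + (d * n)%:P); split; first by rewrite mulf_neq0.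
rewrite rmorphD [X in _ = X + _]rmorphM /= map_polyX map_polyZ /= -e map_polyC /= !tofracM.
rewrite scalerDr scalerA -scalerAl [_ * tofrac d]mulrC; congr (_ + _).
rewrite [in LHS](fracE c) -/n -/e' -!mul_polyC -polyCM; congr (_%:P).
by rewrite -mulrA [_ * (_ / _)]mulrC divfK // tofrac_eq0.
Qed.

End Fraction.

Definition bieval (F : {poly {poly k}}) x y := (map_poly (evk x) F).[y].

Lemma bieval_swap F x y : bieval (swapXY F) x y = bieval F y x.
Proof.
have E G a b : bieval G a b = (map_poly (map_poly iota) G).[b, a].
  by rewrite -horner2_swapXY horner_swapXY -map_poly_comp.
by rewrite !E -swapXY_map horner2_swapXY.
Qed.

Lemma bieval_cons F c x y : bieval (F * 'X + c%:P) x y = bieval F x y * y + peval c x.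
Proof. by rewrite /bieval rmorphD rmorphM /= map_polyX map_polyC !hornerE. Qed.

Lemma ksubring_bieval A F x y : ksubring A -> A x -> A y -> A (bieval F x y).
Proof.
move=> kA Ax Ay; have sA := kA.1; elim/poly_ind: F => [|F c IH].
  by rewrite /bieval rmorph0 horner0; exact: subring0.
by rewrite bieval_cons; apply: subringD => //; [exact: subringM|exact: ksubring_peval].
Qed.

Lemma bieval_dep x y : trdeg1 iota -> exists2 F, F != 0 & bieval F x y = 0.
Proof.
move=> [t /notconst_transc nt alg].
have [[c _ xc]|nx] := pselect (range iota x).
  exists ('X - c%:P)%:P; first by rewrite polyC_eq0 polyXsubC_eq0.
  have -> : bieval ('X - c%:P)%:P x y = peval ('X - c%:P) x by rewrite /bieval map_polyC hornerC.
  by rewrite pevalB pevalX pevalC xc subrr.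
have t_alg : algebraicOver (fev_morph nx) t.
  have [F F0 /rootP Fx] := alg x.
  have {}Fx : bieval (swapXY F) x t = 0 by rewrite bieval_swap.
  exists (map_poly (@tofrac {poly k}) (swapXY F)).
    rewrite map_poly_eq0_id0 ?swapXY_eq0 //.
    by rewrite tofrac_eq0 lead_coef_eq0 swapXY_eq0.
  apply/rootP; rewrite -map_poly_comp -[RHS]Fx /bieval; congr (_.[_]).
  by apply: eq_map_poly => p /=; rewrite fev_tofrac.
have y_alg : algebraicOver (fev_morph nx) y.
  have [F F0 Fy] := alg y.
  apply/integral_algebraic; apply: (@integral_root _ _ _ (map_poly (evk t) F)) => //.
    by rewrite map_poly_eq0_id0 // evk_eq0 // lead_coef_eq0.
  apply/mxpoly.integral_poly => i; apply/integral_algebraic.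
  have -> : (map_poly (evk t) F)`_i = peval F`_i t by rewrite coef_map.
  elim/poly_ind: (F`_i) => [|p c IH].
    by rewrite peval0; exact: algebraic0.
  rewrite pevalD pevalM pevalX pevalC; apply: algebraic_add; first exact: algebraic_mul.
  rewrite -[iota c](pevalC _ c x) -fev_morph_tofrac; exact: algebraic_id.
have [p p0 /rootP py] := y_alg.
have [d [F [d0 e]]] := clear_denominators p.
exists F.
  apply: contra_neq p0 => F0; move: e; rewrite F0 map_poly0 => /eqP.
  by rewrite scaler_eq0 tofrac_eq0 (negPf d0) => /eqP.
rewrite /bieval (_ : map_poly _ F = map_poly (fev_morph nx) (tofrac d *: p)).
  by rewrite map_polyZ hornerZ py mulr0.
rewrite e -map_poly_comp; by apply: eq_map_poly => q /=; rewrite fev_tofrac.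
Qed.

(* Grouping an algebraic relation between [r] and [x] by powers of [r] and dividing by the
   lowest one. *)
Lemma dep_multiple r x : trdeg1 iota -> r != 0 -> exists2 p : {poly k}, p != 0 &
  forall A, ksubring A -> A r -> A x -> exists2 h, A h & peval p x = r * h.
Proof.
move=> tr r0.
pose P n := `[< exists F : {poly {poly k}}, [/\ F != 0, size F = n & bieval F x r = 0] >].
have exP : exists n, P n.
  by have [F F0 FE] := bieval_dep x r tr; exists (size F); apply/asboolP; exists F.
case: (ex_minnP exP) => n /asboolP [F [F0 sF FE]] minn.
elim/poly_ind: F F0 sF FE => [|F c _]; first by rewrite eqxx.
move=> Fc0 sF; rewrite bieval_cons => FE.
have c0 : c != 0.
  apply/eqP => c0; have F0 : F != 0 by apply: contra_neq Fc0 => ->; rewrite c0 mul0r add0r.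
  move: FE; rewrite c0 peval0 addr0 => /eqP; rewrite mulf_eq0 (negPf r0) orbF => /eqP FE.
  have := minn (size F); rewrite -sF c0 addr0 size_mulX // ltnn => H.
  by have : false by apply: H; apply/asboolP; exists F.
exists c => // A kA Ar Ax; exists (- bieval F x r).
  by apply: subringN; [exact: kA.1|exact: ksubring_bieval].
by move: FE => /eqP; rewrite addrC addr_eq0 => /eqP ->; rewrite mulrN mulrC.
Qed.

End AlgebraicDependence.

Section ValuationRings.
Variables (k : closedFieldType) (K : fieldType) (iota : {rmorphism k -> K}).
Add Field Kfield3 : (@kfield_theory K).
Implicit Types (x y z : K) (A B I J M : set K).
Local Notation ksubring := (ksubring iota).

Definition ideal_in A I := [/\ I `<=` A, I 0, forall x y, I x -> I y -> I (x + y)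
  & forall a x, A a -> I x -> I (a * x)].

Definition idl I A : set K := [set z | forall G : set K, G 0 ->
  (forall x y, G x -> G y -> G (x + y)) -> (forall i a, I i -> A a -> G (a * i)) -> G z].

Lemma idl_ideal I A : subring A -> I `<=` A -> ideal_in A (idl I A).
Proof.
move=> sA IA; split.
- move=> z; apply; first exact: subring0.
    by move=> x y; apply: subringD.
  by move=> i a /IA; move=> Ai Aa; apply: subringM.
- by move=> G G0.
- by move=> x y xI yI G G0 GD GM; apply: (GD); [exact: xI|exact: yI].
- move=> a x Aa xI G G0 GD GM.
  have := xI [set z | G (a * z)]; apply; first by rewrite /= mulr0.
    by move=> u v /= Gu Gv; rewrite mulrDr; exact: GD.
  by move=> i b Ii Ab /=; rewrite mulrA; apply: GM => //; exact: subringM.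
Qed.

Lemma idl_gen I A i : subring A -> I i -> idl I A i.
Proof. by move=> sA Ii G G0 GD GM; rewrite -[i]mul1r; apply: GM => //; exact: subring1. Qed.

Definition unit_sum J n x := exists p : nat -> K,
  (forall i, J (p i)) /\ \sum_(i < n) p i * x ^+ i = 1.

Lemma unit_sum_decr A J n m x : subring A -> ideal_in A J -> ~ J 1 -> x != 0 ->
  unit_sum J n.+1 x -> unit_sum J m.+1 x^-1 -> (m <= n)%N -> unit_sum J n x.
Proof.
move=> sA [JA J0 JD JM] nJ1 x0 [p [Jp px]] [q0 [Jq0 qx0]] mn.
pose q i := if (i <= m)%N then q0 i else 0.
have Jq i : J (q i) by rewrite /q; case: ifP.
have qx : \sum_(i < n.+1) q i * x^-1 ^+ i = 1.
  rewrite -qx0 [RHS](big_ord_widen n.+1 (fun i => q0 i * x^-1 ^+ i)) ?ltnS // [RHS]big_mkcond /=.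
  by apply: eq_bigr => i _; rewrite /q ltnS; case: ifP; rewrite ?mul0r.
case: n px qx mn => [|n] px qx mn.
  by move: px; rewrite big_ord1 expr0 mulr1 => p01; case: nJ1; rewrite -p01.
pose d i := if i == 0%N then q 0%N else 0.
exists (fun i => ((1 - q 0%N) * p i + d i) + p n.+1 * q (n.+1 - i)%N); split.
  move=> i; apply: (JD); last by apply: (JM) => //; exact: JA.
  apply: (JD); last by rewrite /d; case: ifP.
  by apply: JM => //; apply: subringB => //; [exact: subring1|exact: JA].
rewrite (eq_bigr (fun i : 'I_n.+1 => ((1 - q 0%N) * (p i * x ^+ i) + d i * x ^+ i) +
    p n.+1 * x ^+ n.+1 * (q (n.+1 - i)%N * x^-1 ^+ (n.+1 - i)))); last first.
  move=> i _; rewrite !mulrDl -!mulrA; congr (_ + (_ * _)).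
  rewrite mulrCA; congr (_ * _); rewrite exprVn -exprB ?leq_subr ?unitfE //.
  by rewrite subKn // ltnW.
rewrite !big_split /= -!mulr_sumr.
have -> : \sum_(i < n.+1) d i * x ^+ i = q 0%N.
  rewrite big_ord_recl /= big1 ?addr0 /d /= ?expr0 ?mulr1 // => i _; exact: mul0r.
have -> : \sum_(i < n.+1) q (n.+1 - i)%N * x^-1 ^+ (n.+1 - i) = 1 - q 0%N.
  move: qx; rewrite big_ord_recl expr0 mulr1 => /esym/eqP; rewrite addrC -subr_eq => /eqP ->.
  rewrite (reindex_inj rev_ord_inj) /=; apply: eq_bigr => i _.
  by have -> : (n.+1 - (n.+1 - i.+1) = bump 0 i)%N by rewrite /bump leq0n add1n subKn // ltn_ord.
have -> : \sum_(i < n.+1) p i * x ^+ i = 1 - p n.+1 * x ^+ n.+1.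
  by rewrite -px [X in _ = X - _]big_ord_recr /= addrK.
by kfold K; ring.
Qed.

Lemma unit_sum_absurd A J x : subring A -> ideal_in A J -> ~ J 1 -> x != 0 ->
  forall n m, unit_sum J n x -> unit_sum J m x^-1 -> False.
Proof.
move=> sA iJ nJ1 x0 n m.
have absurd0 y : ~ unit_sum J 0 y.
  by move=> [p [_]]; rewrite big_ord0 => /esym/eqP; rewrite oner_eq0.
have [N] := ubnP (n + m); elim: N n m => // N IH [|n] [|m] //; try by move=> _ /absurd0.
  by move=> _ _ /absurd0.
move=> lt xn xm; have [mn|/ltnW nm] := leqP m n.
  by apply: (IH n m.+1 _ _ xm); [lia|exact: (unit_sum_decr sA iJ nJ1 x0 xn xm)].
apply: (IH n.+1 m _ xn); first lia.
apply: (unit_sum_decr sA iJ nJ1 _ xm _ nm); first by rewrite invr_eq0.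
by rewrite invrK.
Qed.

Definition adjoin A x : set K := [set y | exists p : {poly K}, (forall i, A p`_i) /\ y = p.[x]].

Lemma adjoin_sub A x : subring A -> A `<=` adjoin A x.
Proof.
move=> sA a Aa; exists a%:P; split; last by rewrite hornerC.
by move=> i; rewrite coefC; case: ifP => // _; exact: subring0.
Qed.

Lemma adjoin_gen A x : subring A -> adjoin A x x.
Proof.
move=> sA; exists 'X; split; last by rewrite hornerX.
by move=> i; rewrite coefX; case: (_ == _); [exact: subring1|exact: subring0].
Qed.

Lemma subring_adjoin A x : subring A -> subring (adjoin A x).
Proof.
move=> sA; apply/subringP; split.
- by apply: adjoin_sub => //; exact: subring1.
- move=> _ _ [p [Ap ->]] [q [Aq ->]]; exists (p - q); split; last by rewrite !hornerE.
  by move=> i; rewrite coefB; exact: subringB.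
- move=> _ _ [p [Ap ->]] [q [Aq ->]]; exists (p * q); split; last by rewrite hornerM.
  by move=> i; rewrite coefM; apply: subring_sum => // j _; exact: subringM.
Qed.

Lemma ksubring_adjoin A x : ksubring A -> ksubring (adjoin A x).
Proof.
move=> [sA kA]; split; first exact: subring_adjoin.
by move=> c /kA; exact: adjoin_sub.
Qed.

Lemma idl_adjoin I A x : subring A -> I `<=` A -> idl I (adjoin A x) 1 ->
  exists n, unit_sum (idl I A) n x.
Proof.
move=> sA IA; have [JA J0 JD JM] := idl_ideal sA IA => h.
have [p [Jp e]] : [set z | exists p : {poly K}, (forall i, idl I A p`_i) /\ z = p.[x]] 1.
  apply: h; first by exists 0; split; [move=> i; rewrite coef0|rewrite horner0].
    move=> _ _ [p [Ap ->]] [q [Aq ->]]; exists (p + q); split; last by rewrite hornerD.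
    by move=> i; rewrite coefD; exact: JD.
  move=> i _ Ii [p [Ap ->]]; exists (p * i%:P); split; last by rewrite hornerM hornerC.
  by move=> j; rewrite coefMC; apply: JM => //; exact: idl_gen.
by exists (size p), (fun i => p`_i); split=> //; rewrite e horner_coef.
Qed.

Lemma valuation_extension A I : ksubring A -> ideal_in A I -> ~ I 1 ->
  exists V, [/\ valuation_ring iota V, A `<=` V & forall x, I x -> x != 0 -> ~ V x^-1].
Proof.
move=> kA [IA I0 ID IM] nI1.
pose Q R := [/\ ksubring R, A `<=` R & ~ idl I R 1].
have QA : Q A.
  by split => // h; apply: nI1; apply: h => // i a Ii Aa; exact: IM.
have [M [[M0|[kM AM nM1]] maxM]] : exists M : set K, (M = set0 \/ Q M) /\
    forall R, (M `<` R) -> ~ (R = set0 \/ Q R).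
- apply: Zorn_bigcup => F FP tot.
  have [[R [FR QR]]|noQ] := pselect (exists R, F R /\ Q R); last first.
    left; rewrite -subset0 => z [R FR Rz]; have [R0|QR] := FP _ FR; first by rewrite -R0.
    by case: noQ; exists R.
  have inQ R' u : F R' -> R' u -> Q R'.
    by move=> F' Ru; have [R0|//] := FP _ F'; move: Ru; rewrite R0.
  have [kR AR nR1] := QR.
  have two x y : (\bigcup_(X in F) X) x -> (\bigcup_(X in F) X) y ->
      exists X, [/\ F X, Q X, X x & X y].
    move=> [X1 F1 x1] [X2 F2 y2]; have [s|s] := tot _ _ F1 F2.
      by exists X2; split => //; [exact: inQ y2|exact: s].
    by exists X1; split => //; [exact: inQ x1|exact: s].
  right; split.
  + split; last by move=> c /kR.2 Rc; exists R.
    apply/subringP; split; first by exists R => //; exact: subring1 kR.1.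
      move=> x y /two h /h [X [FX [kX _ _] Xx Xy]]; exists X => //.
      by apply: subringB => //; exact: kX.1.
    move=> x y /two h /h [X [FX [kX _ _] Xx Xy]]; exists X => //.
    by apply: subringM => //; exact: kX.1.
  + by move=> a /AR Ra; exists R.
  + move=> h.
    have [X FX] : [set z | exists2 X, F X & Q X /\ idl I X z] 1.
      apply: h.
      * by exists R => //; split=> // G.
      * move=> x y [X1 F1 [Q1 x1]] [X2 F2 [Q2 y2]].
        have mono X X' z : X `<=` X' -> idl I X z -> idl I X' z.
          by move=> s h G G0 GD GM; apply: h => // i a Ii /s; exact: GM.
        have [s|s] := tot _ _ F1 F2.
          exists X2 => //; split=> // G G0 GD GM; apply: (GD); last exact: y2.
          exact: (mono _ _ _ s x1).
        exists X1 => //; split=> // G G0 GD GM; apply: (GD); first exact: x1.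
        exact: (mono _ _ _ s y2).
      * move=> i a Ii [X FX Xa]; exists X => //; split; first exact: inQ Xa.
        by move=> G G0 GD; apply.
    by case=> [[_ _ nX]].
- case: (maxM A); last by right.
  by rewrite M0; split=> // /(_ 0); apply; exact: (IA _ I0).
have sM := kM.1; have IM' : I `<=` M by move=> i /IA /AM.
have iJ := idl_ideal sM IM'.
exists M; split => //.
  split=> //; first exact: kM.2.
  move=> x; apply: contrapT => /not_orP [nMx nMx'].
  have x0 : x != 0 by apply: contra_not_neq nMx => ->; exact: subring0.
  have grow y : ~ M y -> exists n, unit_sum (idl I M) n y.
    move=> nMy; apply: idl_adjoin => //; apply: contrapT => n1.
    case: (maxM (adjoin M y)).
      by split=> [|/(_ y) h]; [exact: adjoin_sub|apply/nMy/h; exact: adjoin_gen].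
    right; split=> //; first exact: ksubring_adjoin.
    by move=> a /AM; exact: adjoin_sub.
  have [n xn] := grow _ nMx; have [m xm] := grow _ nMx'.
  exact: (unit_sum_absurd sM iJ nM1 x0 xn xm).
move=> x Ix x0 Mx; apply: nM1 => G G0 GD GM.
by rewrite -(mulVf x0); exact: GM.
Qed.

End ValuationRings.

Section Span.
Variables (k : closedFieldType) (K : fieldType) (iota : {rmorphism k -> K}).
Local Notation ksp := (ksp iota).
Local Notation addl := (addl iota).
Local Notation rdim := (rdim iota).
Variable X : lmodType K.
Implicit Types (A B D : set X) (gs : seq X).

Definition spanl A gs := foldr (fun g B => addl B g) A gs.

Lemma ksp_spanl A gs : ksp A -> ksp (spanl A gs).
Proof. by move=> sA; elim: gs => //= g gs; exact: ksp_addl. Qed.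

Lemma spanl_sub A gs : A `<=` spanl A gs.
Proof. by elim: gs => //= g gs IH x /IH; exact: addl_sub. Qed.

Lemma spanl_gen A gs g : ksp A -> g \in gs -> spanl A gs g.
Proof.
move=> sA; elim: gs => //= h gs IH; rewrite inE => /orP [/eqP ->|/IH H].
  by apply: addl_mem; exact: ksp_spanl.
exact: addl_sub.
Qed.

Lemma spanl_min A B gs : ksp B -> A `<=` B -> (forall g, g \in gs -> B g) -> spanl A gs `<=` B.
Proof.
move=> sB AB; elim: gs => //= g gs IH h; apply: addl_min => //.
  by apply: IH => x xg; apply: h; rewrite inE xg orbT.
by apply: h; rewrite inE eqxx.
Qed.

Definition findim A B := exists n, rdim A B n.

Lemma findim_addl A B x : ksp A -> findim A B -> findim A (addl B x).
Proof.
move=> sA [n AB]; have sB := rdim_ksp sA AB.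
have [Bx|nBx] := pselect (B x); last by exists n.+1; apply: rdimS AB nBx _.
exists n; suff -> : addl B x = B by [].
by rewrite eqEsubset; split; [exact: addl_min|exact: addl_sub].
Qed.

Lemma findim_spanl A gs : ksp A -> findim A (spanl A gs).
Proof.
move=> sA; elim: gs => [|g gs IH] /=; first by exists 0%N; exact: rdim0.
exact: findim_addl.
Qed.

Lemma findim_basis A B : findim A B -> exists gs, B = spanl A gs.
Proof.
move=> [n]; elim=> [|{}B C x {}n _ [gs ->] _ ->]; first by exists [::].
by exists (x :: gs).
Qed.

Lemma findim_trans A D B : findim A D -> findim D B -> findim A B.
Proof. by move=> [n AD] [m DB]; exists (n + m)%N; exact: rdim_trans AD DB. Qed.

End Span.

Lemma findim_push (k : closedFieldType) (K : fieldType) (iota : {rmorphism k -> K})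
    (X Y : lmodType K) (f : X -> Y) (A B : set X) (D : set Y) :
    klin iota f -> ksp iota A -> ksp iota D -> (forall a, A a -> D (f a)) ->
  findim iota A B -> findim iota D (addS (f @` B) D).
Proof.
move=> lf sA sD AD [n AB].
have [gs eB] := findim_basis (ex_intro _ n AB : findim iota A B).
have sB := rdim_ksp sA AB.
have H := findim_spanl (map f gs) sD.
suff -> : addS (f @` B) D = spanl iota D (map f gs) by [].
rewrite eqEsubset; split.
  move=> z [_ [b Bb <-] Dz]; rewrite -(subrK (f b) z).
  apply: (kspD (iota := iota)); [exact: ksp_spanl|exact: spanl_sub|].
  suff sub : B `<=` f @^-1` (spanl iota D (map f gs)) by exact: sub.
  rewrite eB; apply: spanl_min.
  - by apply: ksp_preim => //; exact: ksp_spanl.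
  - by move=> a /AD; exact: spanl_sub.
  - by move=> g gin; apply: spanl_gen => //; exact: map_f.
apply: spanl_min => //.
- by apply: ksp_addS => //; exact: ksp_im.
- by apply: (addS_subr (iota := iota)); exact: ksp_im.
- move=> _ /mapP [g gin ->]; apply: (addS_subl (iota := iota)) => //; exists g => //.
  by rewrite eB; exact: spanl_gen.
Qed.

Section Points.
Variables (k : closedFieldType) (C : curve k).
Local Notation K := (funfield C).
Local Notation iota := (const C).
Add Field Kfield4 : (@kfield_theory K).
Local Ltac kf := kfold (funfield C).
Local Notation ksubring := (ksubring iota).
Local Notation peval := (peval iota).
Local Notation ksp := (@ksp _ _ iota K^o).
Implicit Types (x y z r : K) (P Q A : set K).
Let kspB := @kspB _ _ iota K^o.
Let spanl_sub := @spanl_sub _ _ iota K^o.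
Let spanl_gen := @spanl_gen _ _ iota K^o.
Let spanl_min := @spanl_min _ _ iota K^o.
Let ksp_sum := @ksp_sum _ _ iota K^o.

Lemma ksubring_gen s : ksubring (subalgebra_gen iota s).
Proof.
split; last by move=> x cx B [_ h _]; exact: h.
apply/subringP; split.
- by move=> B [sB _ _]; exact: subring1.
- by move=> x y hx hy B hB; apply: subringB; [case: hB|exact: hx|exact: hy].
- by move=> x y hx hy B hB; apply: subringM; [case: hB|exact: hx|exact: hy].
Qed.

Lemma mem_gen s x : x \in s -> subalgebra_gen iota s x.
Proof. by move=> xs B [_ _ h]; exact: h. Qed.

Lemma gen_min s B : ksubring B -> (forall x, x \in s -> B x) -> subalgebra_gen iota s `<=` B.
Proof. by move=> [sB kB] sub x; apply; split. Qed.

Section Localization.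
Variables (A p : set K) (kA : ksubring A) (pp : prime_ideal A p).

Lemma prime_nmul s t : A s -> A t -> ~ p s -> ~ p t -> ~ p (s * t).
Proof. by case: pp => _ _ _ _ h As At ns nt /(h _ _ As At) []. Qed.

Lemma prime_neq0 s : ~ p s -> s != 0.
Proof. by case: pp => _ [p0 _] _ _ _; apply: contra_notN => /eqP ->. Qed.

Lemma ksubring_localization : ksubring (localization A p).
Proof.
have [pA [p0 np1] pD pM _] := pp; have sA := kA.1.
split; last first.
  move=> c Ac; exists c, 1; split=> //; [exact: kA.2|exact: subring1|by rewrite divr1].
apply/subringP; split.
- by exists 1, 1; split; rewrite ?divr1 //; exact: subring1.
- move=> _ _ [a [s [Aa As ns ->]]] [b [t [Ab At nt ->]]].
  exists (a * t - b * s), (s * t); split.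
  + by apply: subringB => //; exact: subringM.
  + exact: subringM.
  + exact: prime_nmul.
  + by kf; field; split; apply/eqP; exact: prime_neq0.
- move=> _ _ [a [s [Aa As ns ->]]] [b [t [Ab At nt ->]]].
  exists (a * b), (s * t); split; try exact: subringM; first exact: prime_nmul.
  by rewrite mulf_div.
Qed.

Lemma localization_sub : A `<=` localization A p.
Proof.
move=> a Aa; exists a, 1; split=> //; [exact: subring1 kA.1|by case: pp => _ []|by rewrite divr1].
Qed.

Definition punit P x := [/\ x != 0, P x & P x^-1].
Definition pmax P x := P x /\ ~ punit P x.

Lemma punit_localization s : A s -> ~ p s -> punit (localization A p) s.
Proof.
move=> As ns; split; [exact: prime_neq0|exact: localization_sub|].
by exists 1, s; split=> //; [exact: subring1 kA.1|rewrite div1r].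
Qed.

Lemma pmax_localization x : pmax (localization A p) x <->
  exists a s, [/\ p a, A s, ~ p s & x = a / s].
Proof.
have [pA [p0 np1] pD pM pP] := pp; have sA := kA.1.
split=> [[[a [s [Aa As ns ->]]] nu]|[a [s [pa As ns ->]]]].
  exists a, s; split=> //; apply: contrapT => npa; apply: nu.
  have a0 := prime_neq0 npa; have s0 := prime_neq0 ns.
  split; [by rewrite mulf_neq0 ?invr_eq0|by exists a, s|].
  by exists s, a; split => //; rewrite invf_div.
split; first by exists a, s; split=> //; exact: pA.
move=> [as0 _ [b [t [Ab At nt e]]]]; have s0 := prime_neq0 ns; have t0 := prime_neq0 nt.
apply: (prime_nmul As At ns nt).
have a0 : a != 0 by apply: contra_neq as0 => ->; rewrite mul0r.
have -> : s * t = b * a.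
  by move/eqP: e; rewrite invf_div eqr_div // => /eqP ->; rewrite mulrC.
exact: pM.
Qed.

Lemma pmax_ideal : ideal_in (localization A p) (pmax (localization A p)).
Proof.
have [pA [p0 np1] pD pM pP] := pp; have sA := kA.1.
split; first by move=> x [].
- by apply/pmax_localization; exists 0, 1; split=> //; [exact: subring1|rewrite mul0r].
- move=> x y /pmax_localization [a [s [pa As ns ->]]] /pmax_localization [b [t [pb At nt ->]]].
  apply/pmax_localization; exists (t * a + s * b), (s * t); split.
  + by apply: pD; apply: pM.
  + exact: subringM.
  + exact: prime_nmul.
  + by kf; field; split; apply/eqP; exact: prime_neq0.
- move=> _ _ [a [s [Aa As ns ->]]] /pmax_localization [b [t [pb At nt ->]]].
  apply/pmax_localization; exists (a * b), (s * t); split; [exact: pM|exact: subringM| |].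
    exact: prime_nmul.
  by rewrite mulf_div.
Qed.

End Localization.

Lemma point_chart P : points C P -> exists s p,
  [/\ forall x, exists a b, [/\ subalgebra_gen iota s a, subalgebra_gen iota s b & x = a / b],
      prime_ideal (subalgebra_gen iota s) p & P = localization (subalgebra_gen iota s) p].
Proof.
have [ss [fr ->]] := finite_typeP C => -[s /= sss [p pp ->]].
by exists s, p; split=> //; exact: fr.
Qed.

Lemma point_ksub P : points C P -> ksubring P.
Proof.
by move=> /point_chart [s [p [_ pp ->]]]; apply: ksubring_localization => //; exact: ksubring_gen.
Qed.

Lemma point_sub P : points C P -> subring P. Proof. by move=> /point_ksub []. Qed.

Lemma point_ksp P : points C P -> ksp P.
Proof. by move=> /point_ksub; exact: ksubring_ksp. Qed.

Lemma point_max P : points C P -> ideal_in P (pmax P).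
Proof.
by move=> /point_chart [s [p [_ pp ->]]]; apply: pmax_ideal => //; exact: ksubring_gen.
Qed.

Lemma pmax1 P : points C P -> ~ pmax P 1.
Proof.
move=> CP [_]; apply; split; rewrite ?oner_neq0 ?invr1 //; exact: subring1 (point_sub CP).
Qed.

Lemma pmax_or_unit P x : points C P -> P x -> pmax P x \/ punit P x.
Proof. by move=> CP Px; have [u|nu] := pselect (punit P x); [right|left; split]. Qed.

Lemma punit_const P c : points C P -> c != 0 -> punit P (iota c).
Proof.
move=> CP c0; have kP := point_ksub CP; split; first by rewrite fmorph_eq0.
  exact: ksubringC.
by rewrite -fmorphV; exact: ksubringC.
Qed.

Lemma punitM P x y : points C P -> punit P x -> punit P y -> punit P (x * y).
Proof.
move=> CP [x0 Px Px'] [y0 Py Py']; have sP := point_sub CP.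
split; [by rewrite mulf_neq0|exact: subringM|rewrite invfM; exact: subringM].
Qed.

Lemma pmax_prime P x y : points C P -> P x -> P y -> pmax P (x * y) -> pmax P x \/ pmax P y.
Proof.
move=> CP Px Py [_ nu].
have [mx|ux] := pmax_or_unit CP Px; first by left.
have [my|uy] := pmax_or_unit CP Py; first by right.
by case: nu; exact: punitM.
Qed.

Lemma pmaxM P a x : points C P -> P a -> pmax P x -> pmax P (a * x).
Proof. by move=> CP; case: (point_max CP) => _ _ _; apply. Qed.

Lemma pmaxD P x y : points C P -> pmax P x -> pmax P y -> pmax P (x + y).
Proof. by move=> CP; case: (point_max CP) => _ _ h _; apply: h. Qed.

Lemma punitD P x y : points C P -> punit P x -> pmax P y -> punit P (x + y).
Proof.
move=> CP ux my; have [_ Px _] := ux.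
have [//|m|u] := @pmax_or_unit P (x + y) CP; last by [].
  by apply: subringD (point_sub CP) _ _ => //; case: my.
have : pmax P x.
  rewrite -(addrK y x); apply: pmaxD => //; rewrite -mulN1r; apply: pmaxM => //.
  by apply: subringN (point_sub CP) _; exact: subring1 (point_sub CP).
by case.
Qed.

Lemma closed_point P : closed_points C P <-> points C P /\ P <> setT.
Proof. by split; case. Qed.

Lemma closed_neq0 P : closed_points C P -> exists2 r, pmax P r & r != 0.
Proof.
move=> /closed_point [CP nT]; have [s [p [fr pp eP]]] := point_chart CP.
have [z nPz] : exists z, ~ P z.
  apply: contrapT => no; apply: nT; rewrite -subTset => z _.
  by apply: contrapT => nz; apply: no; exists z.
have [a [b [Aa Ab ez]]] := fr z; have kA := ksubring_gen s.
have b0 : b != 0.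
  by apply: contra_not_neq nPz => b0; rewrite ez b0 invr0 mulr0; exact: subring0 (point_sub CP).
exists b => //; split; first by rewrite eP; exact: localization_sub.
move=> [_ _ Pb]; apply: nPz; rewrite ez; apply: subringM (point_sub CP) _ _ => //.
by rewrite eP; exact: localization_sub.
Qed.

Lemma poly_val (p : {poly k}) : p != 0 ->
  exists i (p1 : {poly k}), p = 'X^i * p1 /\ p1`_0 != 0.
Proof.
elim/poly_ind: p => [|p c IH p0]; first by rewrite eqxx.
have [c0|c0] := eqVneq c 0; last first.
  by exists 0%N, (p * 'X + c%:P); rewrite mul1r coefD coefMX coefC add0r.
have [|i [p1 [-> p10]]] := IH; first by apply: contra_neq p0 => ->; rewrite c0 mul0r addr0.
by exists i.+1, p1; rewrite c0 addr0 mulrAC -exprSr.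
Qed.

Lemma peval_split (p1 : {poly k}) s : peval p1 s = iota p1`_0 + s * peval (drop_poly 1 p1) s.
Proof.
rewrite -{1}[p1](poly_take_drop 1) expr1 pevalD pevalM pevalX mulrC; congr (_ + _).
rewrite pevalE; have [t0|tn0] := eqVneq (take_poly 1 p1) 0.
  by rewrite -[p1`_0](coef_take_poly 1 p1 0) t0 size_poly0 big_ord0 coef0 rmorph0.
have -> : size (take_poly 1 p1) = 1%N.
  by apply/eqP; rewrite eqn_leq size_take_poly size_poly_gt0.
by rewrite big_ord1 coef_take_poly expr0 mulr1.
Qed.

Lemma punit_peval P (p1 : {poly k}) s : points C P -> pmax P s -> p1`_0 != 0 -> punit P (peval p1 s).
Proof.
move=> CP ms p10; have [Ps _] := ms.
rewrite peval_split; apply: punitD => //; first exact: punit_const.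
rewrite mulrC; apply: pmaxM => //; exact: ksubring_peval (point_ksub CP) _.
Qed.

Lemma pmax_pow P s b : points C P -> pmax P s -> P b -> b != 0 ->
  exists n h, P h /\ s ^+ n = b * h.
Proof.
move=> CP ms Pb b0; have [Ps _] := ms; have sP := point_sub CP.
have [p p0 pP] := dep_multiple s (dim1P C) b0.
have [h Ph e] := pP P (point_ksub CP) Pb Ps.
have [i [p1 [ep p10]]] := poly_val p0.
have [u0 Pu Pu'] := punit_peval CP ms p10.
exists i, (h / peval p1 s); split; first exact: subringM.
by rewrite mulrA -e ep pevalM pevalXn mulfK.
Qed.

Lemma residue P z : closed_points C P -> P z -> exists c, pmax P (z - iota c).
Proof.
move=> clP Pz; have /closed_point [CP _] := clP; have [r mr r0] := closed_neq0 clP.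
have [p p0 pP] := dep_multiple z (dim1P C) r0; have [Pr _] := mr.
have [h Ph e] := pP P (point_ksub CP) Pr Pz.
have : pmax P (peval p z) by rewrite e mulrC; exact: pmaxM.
have kP := point_ksub CP; have sP := kP.1.
rewrite peval_factor => m1.
have {m1} : pmax P (\prod_(c <- sval (closed_field_poly_normal p)) (z - iota c)).
  have := @pmaxM P (iota (lead_coef p)^-1) _ CP (ksubringC _ kP) m1.
  by rewrite mulrA -rmorphM mulVf ?lead_coef_eq0 // rmorph1 mul1r.
elim: (sval _) => [|c l IH]; first by rewrite big_nil => /(pmax1 CP).
have Pd d : P (z - iota d) by apply: subringB => //; exact: ksubringC.
have Pl : P (\prod_(d <- l) (z - iota d)).
  elim: (l) => [|d l' IH']; first by rewrite big_nil; exact: subring1.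
  by rewrite big_cons; apply: subringM.
by rewrite big_cons => /(pmax_prime CP (Pd c) Pl) [m|/IH //]; exists c.
Qed.

Lemma findim_chart (A : set K) s r : A = subalgebra_gen iota s -> A r -> r != 0 ->
  findim iota ( *%R r @` A : set K^o) A.
Proof.
move=> eA Ar r0; have kA : ksubring A by rewrite eA; exact: ksubring_gen.
have sA := kA.1; have ksA := ksubring_ksp kA.
have krA : ksp ( *%R r @` A) by exact: ksp_mul.
have rAA : *%R r @` A `<=` A by move=> _ [a Aa <-]; exact: subringM.
suff [gs [gA g1 gM]] : exists gs : seq K^o, [/\ forall g, g \in gs -> A g,
    spanl iota ( *%R r @` A : set K^o) gs 1 &
    forall x, x \in s -> forall y, spanl iota ( *%R r @` A : set K^o) gs y ->
      spanl iota ( *%R r @` A : set K^o) gs (x * y)].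
  have e : A = spanl iota ( *%R r @` A : set K^o) gs :> set K^o.
    rewrite eqEsubset; split; last exact: spanl_min.
    set N := spanl _ _ _ in g1 gM *.
    have kN : ksp N := ksp_spanl gs krA.
    have sub : A `<=` [set z | forall y, N y -> N (z * y)].
      rewrite eA; apply: gen_min; last by [].
      split; last first.
        by move=> _ [c _ <-] y Ny; exact: kspZ.
      apply/subringP; split.
      - by move=> y; rewrite mul1r.
      - by move=> u v hu hv y Ny; rewrite mulrBl; apply: kspB => //; [exact: hu|exact: hv].
      - by move=> u v hu hv y Ny; rewrite -mulrA; apply: hu; exact: hv.
    by move=> a /sub h; have := h 1 g1; rewrite mulr1.
  by rewrite [X in findim _ _ X]e; exact: findim_spanl.
have : forall x, x \in s -> A x by rewrite eA; exact: mem_gen.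
elim: {eA} s => [_|x s IH sub].
  exists [:: 1 : K^o]; split=> //.
  - by move=> g; rewrite inE => /eqP ->; exact: subring1.
  - by apply: spanl_gen => //; rewrite inE.
have [gs [gA g1 gM]] : exists gs : seq K^o, [/\ forall g, g \in gs -> A g,
    spanl iota ( *%R r @` A : set K^o) gs 1 &
    forall x, x \in s -> forall y, spanl iota ( *%R r @` A : set K^o) gs y ->
      spanl iota ( *%R r @` A : set K^o) gs (x * y)].
  by apply: IH => y ys; apply: sub; rewrite inE ys orbT.
have Ax : A x by apply: sub; rewrite inE eqxx.
have [p p0 /(_ A kA Ar Ax) [h Ah ph]] := dep_multiple x (dim1P C) r0.
pose d := (size p).-1; have sp : size p = d.+1 by rewrite prednK // size_poly_gt0.
set D := *%R r @` A in gM g1 krA rAA *.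
have DA y a : D y -> A a -> D (a * y).
  by move=> [b Ab <-] Aa; exists (a * b); [exact: subringM|rewrite mulrCA].
pose hs : seq K^o := [seq x ^+ i * g | i <- seq.iota 0 d, g <- gs].
have kN : ksp (spanl iota (D : set K^o) hs) by exact: ksp_spanl.
have DN : D `<=` spanl iota (D : set K^o) hs by exact: spanl_sub.
have low i y : (i < d)%N -> spanl iota (D : set K^o) gs y -> spanl iota (D : set K^o) hs (x ^+ i * y).
  move=> id; move: y.
  suff sub1 : spanl iota (D : set K^o) gs `<=` *%R (x ^+ i) @^-1` spanl iota (D : set K^o) hs by exact: sub1.
  apply: spanl_min.
  - exact: ksp_mul_preim.
  - by move=> y Dy; apply: DN; apply: DA => //; exact: subringX.
  - move=> g gin; apply: spanl_gen => //.
    by apply/allpairsP; exists (i, g); split=> //=; rewrite mem_iota add0n.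
have sp0 : lead_coef p != 0 by rewrite lead_coef_eq0.
have top y : spanl iota (D : set K^o) gs y -> A y -> spanl iota (D : set K^o) hs (x ^+ d * y).
  move=> Ny Ay; apply: (kspZV (c := lead_coef p) kN sp0).
  have -> : iota (lead_coef p) *: (x ^+ d * y : K^o) =
      r * (h * y) - \sum_(i < d) iota p`_i * (x ^+ i * y).
    rewrite mulrA -ph pevalE sp big_ord_recr /= mulrDl mulr_suml.
    rewrite (eq_bigr (fun i : 'I_d => iota p`_i * (x ^+ i * y))); last by move=> i _; rewrite mulrA.
    by rewrite addrAC subrr add0r /lead_coef sp -mulrA.
  apply: kspB => //; first by apply: DN; exists (h * y) => //; exact: subringM.
  by apply: ksp_sum => // i _; apply: kspZ => //; exact: low.
have gsA : spanl iota (D : set K^o) gs `<=` A by exact: spanl_min.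
have all_pow i y : (i <= d)%N -> spanl iota (D : set K^o) gs y -> spanl iota (D : set K^o) hs (x ^+ i * y).
  rewrite leq_eqVlt => /orP [/eqP ->|] Ny; last exact: low.
  exact: top (gsA _ _).
exists hs; split.
- by move=> _ /allpairsP [[i g] [/= _ gin ->]]; apply: subringM (subringX _ _ _) (gA _ gin).
- by have := all_pow 0%N 1 isT g1; rewrite expr0 mul1r.
- move=> y yin z; move: z.
  suff sub1 : spanl iota (D : set K^o) hs `<=` *%R y @^-1` spanl iota (D : set K^o) hs by exact: sub1.
  have Ay : A y by exact: sub.
  apply: spanl_min; [exact: ksp_mul_preim|by move=> z Dz; apply: DN; exact: DA|].
  move=> _ /allpairsP [[i g] [/= ii gin ->]]; move: ii; rewrite mem_iota add0n => /= id.
  rewrite /preimage /=; move: yin; rewrite inE => /orP [/eqP ->|yin].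
    by rewrite mulrA -exprS; apply: all_pow => //; exact: spanl_gen.
  by rewrite mulrCA; apply: low => //; apply: gM => //; exact: spanl_gen.
Qed.

Lemma findim_point P r : points C P -> P r -> r != 0 -> findim iota ( *%R r @` P : set K^o) P.
Proof.
move=> CP Pr r0; have sP := point_sub CP.
have [s [p [fr pp eP]]] := point_chart CP; have kA := ksubring_gen s.
move: fr pp eP kA (@findim_chart _ s ^~ (erefl _)).
move: (subalgebra_gen iota s) => A fr pp eP kA findimA; have sA := kA.1.
have AP : A `<=` P by rewrite eP; exact: localization_sub.
have [a [t [Aa At npt er]]] : localization A p r by rewrite -eP.
have tu : punit P t by rewrite eP; exact: punit_localization.
have [t0 Pt Pt'] := tu.
have a0 : a != 0 by apply: contra_neq r0 => a0; rewrite er a0 mul0r.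
have -> : *%R r @` P = *%R a @` P.
  rewrite eqEsubset; split=> _ [z Pz <-].
    by exists (z / t); [exact: subringM|rewrite er mulrA mulrAC].
  by exists (t * z); [exact: subringM|rewrite er mulrA divfK].
have kaA : ksp ( *%R a @` A) by apply: ksp_mul; exact: ksubring_ksp.
have kaP : ksp ( *%R a @` P) by apply: ksp_mul; exact: point_ksp.
have := @findim_push _ _ iota K^o K^o id ( *%R a @` A) A ( *%R a @` P).
rewrite image_id.
suff -> : addS (A : set K^o) ( *%R a @` P : set K^o) = P.
  apply=> //; last exact: findimA Aa a0.
  by move=> _ [z Az <-]; exists z => //; exact: AP.
rewrite eqEsubset; split.
  move=> z [b Ab [y Py e]]; rewrite -(subrK b z) -e; apply: subringD => //; last exact: AP.
  by apply: subringM => //; exact: AP.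
move=> z; rewrite {1}eP => -[b [t1 [Ab At1 npt1 ->]]].
have [t10 _ Pt1'] : punit P t1 by rewrite eP; exact: punit_localization.
have [q q0 /(_ A kA Aa At1) [h Ah eh]] := dep_multiple t1 (dim1P C) a0.
have [i [q1 [eq q10]]] := poly_val q0.
have e1 : peval q1 t1 = a * (h * t1^-1 ^+ i).
  apply: (mulfI (expf_neq0 i t10)); rewrite -(pevalXn iota) -pevalM -eq eh mulrCA pevalXn.
  by congr (_ * _); rewrite exprVn mulrCA divff ?mulr1 // expf_neq0.
have ph : P (h * t1^-1 ^+ i) by apply: subringM => //; [exact: AP|exact: subringX].
have Pb : P b by exact: AP.
have bA : A (- (b * iota (q1`_0)^-1 * peval (drop_poly 1 q1) t1)).
  apply: (subringN sA); apply: (subringM sA); last exact: ksubring_peval.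
  by apply: (subringM sA) => //; exact: ksubringC.
have bP : P (b * iota (q1`_0)^-1 * (h * t1^-1 ^+ i) * t1^-1).
  apply: (subringM sP) => //; apply: (subringM sP) => //; apply: (subringM sP) => //.
  exact: ksubringC (point_ksub CP).
exists (- (b * iota (q1`_0)^-1 * peval (drop_poly 1 q1) t1)) => //.
exists (b * iota (q1`_0)^-1 * (h * t1^-1 ^+ i) * t1^-1) => //.
have c0 : iota q1`_0 != 0 by rewrite fmorph_eq0.
rewrite fmorphV; move: e1; rewrite peval_split.
set w := h * _; set u := iota _ in c0 *; set v := peval _ _ => e1.
have -> : a * (b * u^-1 * w * t1^-1) = b * u^-1 * (a * w) * t1^-1 by kf; ring.
by rewrite -e1; kf; field; split; exact/eqP.
Qed.

Lemma prime_root A p q x : ksubring A -> prime_ideal A p -> A x -> q != 0 -> p (peval q x) ->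
  exists2 c, c \in sval (closed_field_poly_normal q) & p (x - iota c).
Proof.
move=> kA [pA [p0 np1] pD pM pP] Ax q0; rewrite peval_factor => h.
have sA := kA.1; have Ad d : A (x - iota d) by apply: subringB => //; exact: ksubringC.
have {h} : p (\prod_(c <- sval (closed_field_poly_normal q)) (x - iota c)).
  have := pM _ _ (ksubringC (lead_coef q)^-1 kA) h.
  by rewrite mulrA -rmorphM mulVf ?lead_coef_eq0 // rmorph1 mul1r.
elim: (sval _) => [|c l IH]; first by rewrite big_nil => /np1.
have Al : A (\prod_(d <- l) (x - iota d)).
  elim: (l) => [|d l' IH']; first by rewrite big_nil; exact: subring1.
  by rewrite big_cons; apply: subringM.
rewrite big_cons => /(pP _ _ (Ad c) Al) [m|/IH [d dl pd]].
  by exists c => //; rewrite inE eqxx.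
by exists d => //; rewrite inE dl orbT.
Qed.

Lemma finite_primes s b : subalgebra_gen iota s b -> b != 0 ->
  finite_set [set Q | exists p, [/\ prime_ideal (subalgebra_gen iota s) p, p b
     & Q = localization (subalgebra_gen iota s) p]].
Proof.
move: (ksubring_gen s) (@mem_gen s) (@gen_min s).
move: (subalgebra_gen iota s) => A kA genA minA Ab b0.
have /choice [R RP] : forall x, exists l : seq k, forall p, A x -> prime_ideal A p -> p b ->
    exists2 c, c \in l & p (x - iota c).
  move=> x; have [q q0 qP] := dep_multiple x (dim1P C) b0.
  exists (sval (closed_field_poly_normal q)) => p Ax pp pb; apply: (prime_root kA) => //.
  have [h Ah ->] := qP A kA Ab Ax; have [_ _ _ pM _] := pp.
  by rewrite mulrC; exact: pM.
pose rs := flatten [seq R x | x <- s].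
pose rel (t : {ffun 'I_(size s) -> 'I_(size rs)}) Q := exists p, [/\ prime_ideal A p, p b,
  Q = localization A p & forall i : 'I_(size s), p (s`_i - iota rs`_(t i))].
have relU t Q Q' : rel t Q -> rel t Q' -> Q = Q'.
  move=> [p [pp pb -> pt]] [p' [pp' pb' -> pt']].
  suff sub p1 p2 : prime_ideal A p1 -> prime_ideal A p2 ->
      (forall i : 'I_(size s), p1 (s`_i - iota rs`_(t i))) ->
      (forall i : 'I_(size s), p2 (s`_i - iota rs`_(t i))) -> p1 `<=` p2.
    by congr (localization A _); rewrite eqEsubset; split; exact: sub.
  move=> [p1A [p10 np11] p1D p1M _] [p2A [p20 np21] p2D p2M _] h1 h2 x p1x.
  have pN q y : q = p1 \/ q = p2 -> q y -> q (- y).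
    rewrite -mulN1r => -[->|->]; [apply: p1M|apply: p2M]; apply: (subringN kA.1); exact: subring1 kA.1.
  have Asub : A `<=` [set y | exists c, p1 (y - iota c) /\ p2 (y - iota c)].
    apply: minA; last first.
      by move=> y /(nthP 0) [i si <-]; exists rs`_(t (Ordinal si)); split; [exact: (h1 (Ordinal si))|exact: (h2 (Ordinal si))].
    split; last by move=> _ [c _ <-]; exists c; rewrite subrr.
    apply/subringP; split.
    - by exists 1; rewrite rmorph1 subrr.
    - move=> y z [c [c1 c2]] [d [d1 d2]]; exists (c - d); rewrite rmorphB.
      have -> : y - z - (iota c - iota d) = (y - iota c) + - (z - iota d) by kf; ring.
      by split; [apply: p1D => //; apply: pN; [left|]|apply: p2D => //; apply: pN; [right|]].
    - move=> y z [c [c1 c2]] [d [d1 d2]]; exists (c * d); rewrite rmorphM.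
      have -> : y * z - iota c * iota d = (z - iota d + iota d) * (y - iota c) + iota c * (z - iota d).
        by kf; ring.
      split; [apply: p1D|apply: p2D].
      + by apply: p1M => //; apply: subringD kA.1 _ _; [exact: p1A|exact: ksubringC].
      + by apply: p1M => //; exact: ksubringC.
      + by apply: p2M => //; apply: subringD kA.1 _ _; [exact: p1A|exact: ksubringC].
      + by apply: p2M => //; exact: ksubringC.
  have [c [c1 c2]] := Asub x (p1A _ p1x).
  have [c0|c0] := eqVneq c 0; first by move: c2; rewrite c0 rmorph0 subr0.
  case: np11; have : p1 (iota c).
    rewrite -(subrK x (iota c)) ; apply: p1D => //.
    by rewrite -opprB; apply: pN => //; left.
  move/(p1M _ _ (ksubringC c^-1 kA)).
  by rewrite -rmorphM mulVf // rmorph1.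
pose G t := xget setT [set Q | rel t Q].
apply: (@sub_finite_set _ _ (range G)); last exact/finite_image/finite_finset.
move=> Q [p [pp pb eQ]].
have h (i : 'I_(size s)) : exists j : 'I_(size rs), p (s`_i - iota rs`_j).
  have [|c cin pc] := RP s`_i p _ pp pb; first by apply: genA; exact: mem_nth.
  have : c \in rs by apply/flattenP; exists (R s`_i) => //; apply: map_f; exact: mem_nth.
  by move=> /(nthP 0) [j sj ec]; exists (Ordinal sj); rewrite /= ec.
have [t tP] := fin_all_exists h.
exists [ffun i => t i] => //; rewrite /G.
have relQ : rel [ffun i => t i] Q by exists p; split=> // i; rewrite ffunE.
by case: xgetP => [Q' _ relQ'|/(_ Q)]; [exact: relU relQ' relQ|].
Qed.

Lemma finite_poles z : finite_set [set Q | points C Q /\ ~ Q z].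
Proof.
have [ss [fr ->]] := finite_typeP C.
apply: (@sub_finite_set _ _ (\bigcup_(s in [set` ss])
  [set Q | spec (subalgebra_gen iota s) Q /\ ~ Q z])).
  by move=> Q [[s sin sQ] nz]; exists s.
apply: bigcup_finite; first exact: finite_seq.
move=> s sin; have [a [b [Aa Ab ez]]] := fr s sin z.
have [b0|b0] := eqVneq b 0.
  apply: (@sub_finite_set _ _ set0); last exact: finite_set0.
  move=> Q [[p pp eQ]]; case; rewrite ez b0 invr0 mulr0 eQ.
  exact: subring0 (ksubring_localization (ksubring_gen s) pp).1.
apply: sub_finite_set (finite_primes Ab b0) => Q [[p pp eQ] nQ].
exists p; split=> //; apply: contrapT => npb; apply: nQ; rewrite eQ ez.
by exists a, b.
Qed.

Lemma center V : valuation_ring iota V -> exists P, [/\ points C P, P `<=` V & dominates V P].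
Proof. by move=> /completeP [P [[CP dom] _]]; exists P; split=> //; case: dom. Qed.

Lemma transcendental_ex : exists t, ~ range iota t.
Proof. by have [t nt _] := dim1P C; exists t; exact/notconst_transc. Qed.

Lemma valuation_avoiding h : ~ range iota h -> exists2 V, valuation_ring iota V & ~ V h.
Proof.
move=> nh; have h0 : h != 0.
  by apply: contra_not_neq nh => ->; exists 0; rewrite ?rmorph0.
have nh' : ~ range iota h^-1.
  by move=> [c _ ec]; apply: nh; exists c^-1 => //; rewrite fmorphV ec invrK.
pose B := [set peval p h^-1 | p in setT].
have kB : ksubring B.
  split; last by move=> _ [c _ <-]; exists c%:P => //; rewrite pevalC.
  apply/subringP; split.
  - by exists 1 => //; rewrite -[1]/(1%:P) pevalC rmorph1.
  - by move=> _ _ [p _ <-] [q _ <-]; exists (p - q) => //; rewrite pevalB.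
  - by move=> _ _ [p _ <-] [q _ <-]; exists (p * q) => //; rewrite pevalM.
have iI : ideal_in B ( *%R h^-1 @` B).
  have sB := kB.1; have Bh : B h^-1 by exists 'X => //; rewrite pevalX.
  split.
  - by move=> _ [b Bb <-]; exact: subringM.
  - by exists 0; [exact: subring0|rewrite mulr0].
  - by move=> _ _ [a Ba <-] [b Bb <-]; exists (a + b); [exact: subringD|rewrite mulrDr].
  - by move=> a _ Ba [b Bb <-]; exists (a * b); [exact: subringM|rewrite mulrCA].
have nI1 : ~ ( *%R h^-1 @` B) 1.
  move=> [_ [p _ <-]] /eqP; rewrite -{1}[h^-1](pevalX iota) -pevalM -(rmorph1 iota) -(pevalC _ _ h^-1).
  rewrite -subr_eq0 -pevalB => /eqP /(peval_inj nh') /eqP; rewrite subr_eq0 => /eqP /(congr1 (fun q : {poly k} => q`_0)).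
  by rewrite coefXM coefC /= => /esym/eqP; rewrite oner_eq0.
have [V [vV _ IV]] := valuation_extension kB iI nI1.
exists V => // Vh; apply: (IV h^-1); rewrite ?invr_eq0 ?invrK //.
by exists 1; [exact: subring1 kB.1|rewrite mulr1].
Qed.

Lemma global_const h : (forall P, points C P -> P h) -> range iota h.
Proof.
move=> Ph; apply: contrapT => nh; have [V vV nVh] := valuation_avoiding nh.
have [P [CP PV _]] := center vV; by apply: nVh; apply: PV; exact: Ph.
Qed.

Lemma closed_point_ex : exists P, closed_points C P.
Proof.
have [t nt] := transcendental_ex; have [V vV nVt] := valuation_avoiding nt.
have [P [CP PV _]] := center vV; exists P; apply/closed_point; split=> // PT.
by apply: nVt; apply: PV; rewrite PT.
Qed.

Lemma generic_point : points C setT.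
Proof.
have [P /closed_point [CP _]] := closed_point_ex.
have [ss [fr eC]] := finite_typeP C; rewrite eC in CP *; have [s sin _] := CP.
exists s => //; exists [set 0].
  split=> //.
  - by move=> _ ->; exact: subring0 (ksubring_gen s).1.
  - by split=> // /eqP; rewrite oner_eq0.
  - by move=> x y /= -> ->; rewrite addr0.
  - by move=> a x _ /= ->; rewrite mulr0.
  - by move=> a b _ _ /= /eqP; rewrite mulf_eq0 => /orP [] /eqP; [left|right].
apply/esym; rewrite -subTset => x _ /=; have [a [b [Aa Ab ex]]] := fr s sin x.
have [b0|b0] := eqVneq b 0; last by exists a, b; split=> // /eqP; apply/negP.
have sA := (ksubring_gen s).1; exists 0, 1; split.
- exact: subring0.
- exact: subring1.
- by apply/eqP; exact: oner_neq0.
- by rewrite ex b0 invr0 mulr0 mul0r.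
Qed.

Lemma point_antichain P Q : closed_points C P -> points C Q -> Q `<=` P -> Q = P.
Proof.
move=> clP CQ QP; have /closed_point [CP nT] := clP.
have [V [vV PV mV]] := valuation_extension (point_ksub CP) (point_max CP) (pmax1 CP).
have sQ := point_sub CQ.
have domP : dominates V P.
  split=> // y Py Vy; have [y0|y0] := eqVneq y 0.
    by rewrite y0 invr0; exact: subring0 (point_sub CP).
  have [my|[]//] := pmax_or_unit CP Py.
  by case: (mV _ my y0).
have domQ : dominates V Q.
  split=> [y Qy|y Qy Vy]; first exact/PV/QP.
  have [y0|y0] := eqVneq y 0; first by rewrite y0 invr0; exact: subring0.
  have [my|[]//] := pmax_or_unit CQ Qy.
  case: nT; rewrite -subTset => z _.
  have [s [p [fr pp eQ]]] := point_chart CQ.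
  have [a [b [Aa Ab ez]]] := fr z.
  have Qa : Q a by rewrite eQ; apply: localization_sub => //; exact: ksubring_gen.
  have Qb : Q b by rewrite eQ; apply: localization_sub => //; exact: ksubring_gen.
  have [b0|b0] := eqVneq b 0.
    by rewrite ez b0 invr0 mulr0; exact: subring0 (point_sub CP).
  have [n [h [Qh eyn]]] := pmax_pow CQ my Qb b0.
  have Py' : P y^-1 by case: domP => _; apply=> //; exact: QP.
  have -> : z = a * h * y^-1 ^+ n.
    by rewrite exprVn eyn ez; have : y ^+ n != 0 := expf_neq0 _ y0; rewrite eyn mulf_eq0 negb_or => /andP [_ h0];
      kf; field; split; exact/eqP.
  have sP := point_sub CP.
  apply: subringM => //; [|exact: subringX].
  by apply: subringM => //; exact: QP.
have [P' [_ U]] := completeP vV.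
by rewrite -(U Q) // -(U P).
Qed.

End Points.

(** * Sheaves and duality *)

Section GeneratedSubmodules.
Variables (K : fieldType) (V : lmodType K).
Implicit Types (P : set K) (X N : set V).

Definition submodule P N := [/\ N 0, forall x y, N x -> N y -> N (x + y)
  & forall a x, P a -> N x -> N (a *: x)].

Lemma submodule_sum P N m (a : 'I_m -> K) (x : 'I_m -> V) : submodule P N ->
  (forall i, P (a i)) -> (forall i, N (x i)) -> N (\sum_i a i *: x i).
Proof.
move=> [N0 ND NZ] Pa Nx; elim/big_ind: _ => // i _; exact: NZ.
Qed.

Lemma gen_submod_min P X N : submodule P N -> X `<=` N -> gen_submod P X `<=` N.
Proof.
move=> sN XN _ [m [a [x [Pa Xx ->]]]]; apply: (submodule_sum sN) => // i; exact/XN/Xx.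
Qed.

Lemma gen_submod_submodule P X : subring P -> submodule P (gen_submod P X).
Proof.
move=> sP; split.
- by exists 0%N, (fun=> 0), (fun=> 0); split=> [[]|[]|] //; rewrite big_ord0.
- move=> _ _ [m [a [x [Pa Xx ->]]]] [n [b [y [Pb Yy ->]]]].
  exists (m + n)%N, (fun i : 'I_(m + n) => match fintype.split i with inl j => a j | inr j => b j end),
    (fun i : 'I_(m + n) => match fintype.split i with inl j => x j | inr j => y j end); split.
  + by move=> i; case: split_ordP => j _.
  + by move=> i; case: split_ordP => j _.
  + rewrite big_split_ord; congr (_ + _); apply: eq_bigr => i _.
      by case: split_ordP => j; [move/lshift_inj ->|move/eqP; rewrite eq_lrshift].
    by case: split_ordP => j; [move/eqP; rewrite eq_rlshift|move/rshift_inj ->].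
- move=> c _ Pc [m [a [x [Pa Xx ->]]]]; exists m, (fun i => c * a i), x; split=> //.
    by move=> i; exact: subringM.
  by rewrite scaler_sumr; apply: eq_bigr => i _; rewrite scalerA.
Qed.

Lemma gen_submod_mem P X x : subring P -> X x -> gen_submod P X x.
Proof.
move=> sP Xx; exists 1%N, (fun=> 1), (fun=> x); split=> //; first by move=> _; exact: subring1.
by rewrite big_ord1 scale1r.
Qed.

End GeneratedSubmodules.

Section Sheaves.
Variables (k : closedFieldType) (C : curve k).
Local Notation K := (funfield C).
Local Notation iota := (const C).
Implicit Types (P Q : set K).

Section OneSheaf.
Variable V : vectType K.
Implicit Types (F : tfsheaf V) (S : seq V).

Lemma finite_unmember S S1 : gen_submod [set: K] [set` S1] = [set: V] ->
  finite_set [set P | points C P /\ ~ (forall x, x \in S -> gen_submod P [set` S1] x)].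
Proof.
move=> gS1; elim: S => [|x S IH].
  by apply: (@sub_finite_set _ _ set0); [move=> P [_]; case|exact: finite_set0].
apply: (@sub_finite_set _ _ ([set P | points C P /\ ~ gen_submod P [set` S1] x] `|`
    [set P | points C P /\ ~ (forall x, x \in S -> gen_submod P [set` S1] x)])).
  move=> P [CP nP]; have [hx|] := pselect (gen_submod P [set` S1] x); last by left.
  right; split=> // hS; apply: nP => y; rewrite inE => /orP [/eqP ->//|]; exact: hS.
rewrite finite_setU; split=> // {IH}.
have : gen_submod [set: K] [set` S1] x by rewrite gS1.
move=> [m [a [y [_ Sy ex]]]].
apply: (@sub_finite_set _ _ (\bigcup_(i in [set: 'I_m]) [set P | points C P /\ ~ P (a i)])).
  move=> P [CP nP]; apply: contrapT => no; apply: nP; exists m, a, y; split=> // i.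
  by apply: contrapT => nai; apply: no; exists i.
by apply: bigcup_finite => [|i _]; [exact: finite_finset|exact: finite_poles].
Qed.

Lemma finite_neq S S1 : gen_submod [set: K] [set` S1] = [set: V] ->
    gen_submod [set: K] [set` S] = [set: V] ->
  finite_set [set P | points C P /\ gen_submod P [set` S] <> gen_submod P [set` S1]].
Proof.
move=> g1 g; apply: (@sub_finite_set _ _
  ([set P | points C P /\ ~ (forall x, x \in S -> gen_submod P [set` S1] x)] `|`
   [set P | points C P /\ ~ (forall x, x \in S1 -> gen_submod P [set` S] x)])); last first.
  by rewrite finite_setU; split; exact: finite_unmember.
move=> P [CP ne]; apply: contrapT => /not_orP [h1 h2]; apply: ne.
have sP := point_sub CP.
have {}h1 : forall x, x \in S -> gen_submod P [set` S1] x.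
  by apply: contrapT => h; apply: h1.
have {}h2 : forall x, x \in S1 -> gen_submod P [set` S] x.
  by apply: contrapT => h; apply: h2.
by rewrite eqEsubset; split; apply: gen_submod_min => //; exact: gen_submod_submodule.
Qed.

(* Coherence only has to be checked stalk by stalk, up to finitely many points: these are
   closed, and a neighbourhood of another point avoiding them exists because distinct
   closed points are incomparable as local rings. *)
Lemma tfsheaf_of (G : set K -> set V) S1 :
    G setT = setT -> gen_submod [set: K] [set` S1] = [set: V] ->
    finite_set [set P | points C P /\ G P <> gen_submod P [set` S1]] ->
    (forall P, points C P -> exists S, G P = gen_submod P [set` S] /\
       gen_submod [set: K] [set` S] = [set: V]) ->
  exists F : tfsheaf V, forall P, F P = G P.
Proof.
move=> GT gS1 finG stG.
suff coh : forall P, points C P -> exists (s : seq K) (S : seq V), [set` s] `<=` P /\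
    forall Q, points C Q -> [set` s] `<=` Q -> G Q = gen_submod Q [set` S].
  by exists (TFSheaf GT coh).
move=> P CP; have [S [eG gS]] := stG P CP.
have : finite_set [set Q | points C Q /\ G Q <> gen_submod Q [set` S]].
  apply: (@sub_finite_set _ _ ([set Q | points C Q /\ G Q <> gen_submod Q [set` S1]] `|`
     [set Q | points C Q /\ gen_submod Q [set` S] <> gen_submod Q [set` S1]])).
    move=> Q [CQ ne]; apply: contrapT => /not_orP [h1 h2]; apply: ne.
    have e1 : G Q = gen_submod Q [set` S1] by apply: contrapT => h; apply: h1.
    by rewrite e1; apply: contrapT => h; apply: h2; split=> // e; apply: h.
  by rewrite finite_setU; split=> //; exact: finite_neq.
move=> /finite_seqP [B eB].
have /choice [z zP] : forall Q, exists z, Q \in B -> P z /\ ~ Q z.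
  move=> Q; have [QB|nQB] := boolP (Q \in B); last by exists 0.
  have [CQ ne] : [set Q | points C Q /\ G Q <> gen_submod Q [set` S]] Q by rewrite eB.
  have clQ : closed_points C Q.
    by apply/closed_point; split=> // QT; apply: ne; rewrite QT GT gS.
  apply: contrapT => no; have PQ : P `<=` Q.
    by move=> z Pz; apply: contrapT => nz; apply: no; exists z.
  by apply: ne; rewrite -(point_antichain clQ CP PQ).
exists (map z B), S; split; first by move=> _ /mapP [Q QB ->]; exact: (zP Q QB).1.
move=> Q CQ sub; apply: contrapT => ne.
have QB : Q \in B by suff : [set` B] Q by []; rewrite -eB.
by have := (zP Q QB).2; apply; apply: sub; exact: map_f.
Qed.

Lemma sheaf_gen F P : points C P -> exists S, F P = gen_submod P [set` S] /\
  gen_submod [set: K] [set` S] = [set: V].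
Proof.
move=> CP; have [s [S [sP h]]] := coherentP F CP; exists S; split; first exact: h.
by rewrite -(h _ (generic_point C)) ?generic_stalk.
Qed.

Lemma sheaf_submodule F P : points C P -> submodule P (F P).
Proof.
by move=> CP; have [S [-> _]] := sheaf_gen F CP; apply: gen_submod_submodule; exact: point_sub.
Qed.

Lemma sheaf_generic F : exists S1, gen_submod [set: K] [set` S1] = [set: V] /\
  finite_set [set P | points C P /\ F P <> gen_submod P [set` S1]].
Proof.
have [s [S [_ h]]] := coherentP F (generic_point C).
exists S; split; first by rewrite -(h _ (generic_point C)) ?generic_stalk.
apply: (@sub_finite_set _ _ (\bigcup_(x in [set` s]) [set P | points C P /\ ~ P x])).
  move=> P [CP ne]; apply: contrapT => no; apply: ne; apply: h => // x xs.
  by apply: contrapT => nx; apply: no; exists x.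
by apply: bigcup_finite => [|i _]; [exact: finite_seq|exact: finite_poles].
Qed.

Lemma finite_bad F v : finite_set [set P | points C P /\ ~ F P v].
Proof.
have [S1 [g1 fin]] := sheaf_generic F.
apply: (@sub_finite_set _ _ ([set P | points C P /\ F P <> gen_submod P [set` S1]] `|`
  [set P | points C P /\ ~ (forall x, x \in [:: v] -> gen_submod P [set` S1] x)])).
  move=> P [CP nP]; apply: contrapT => /not_orP [h1 h2]; apply: nP.
  have -> : F P = gen_submod P [set` S1] by apply: contrapT => h; apply: h1.
  by apply: contrapT => h; apply: h2; split=> // /(_ v); rewrite inE eqxx => /(_ isT).
by rewrite finite_setU; split=> //; exact: finite_unmember.
Qed.

Lemma sheaf_ksp F P : points C P -> ksp iota (F P).
Proof.
move=> CP; have [F0 FD FZ] := sheaf_submodule F CP; split=> // c x y Fx Fy.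
by apply: FD => //; apply: FZ => //; exact: ksubringC (point_ksub CP).
Qed.

Definition finsupp (R : zmodType) (rho : set K -> R) := finite_set [set P | rho P != 0].

Lemma closed_sumE (f : set K -> k) (s : seq (set K)) : uniq s ->
    (forall P, P \in s -> closed_points C P) ->
    (forall P, closed_points C P -> P \notin s -> f P = 0) ->
  \sum_(P \in closed_points C) f P = \sum_(P <- s) f P.
Proof.
move=> us clS f0; rewrite [RHS]fsbig_seq //; symmetry; apply: fsbig_widen; first exact: clS.
by move=> P [clP /= /negP]; exact: f0.
Qed.

Lemma finsupp_seq (A : set (set K)) : finite_set A ->
  exists s : seq (set K), [/\ uniq s, forall P, P \in s -> closed_points C P
    & forall P, closed_points C P -> A P -> P \in s].
Proof.
move=> /(@sub_finite_set _ (A `&` closed_points C) A (@subIsetl _ _ _)) /finite_seqP [s es].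
exists (undup s); split; first exact: undup_uniq.
  by move=> P; rewrite mem_undup => Ps; have : [set` s] P by []; rewrite -es; case.
by move=> P clP AP; rewrite mem_undup; suff : [set` s] P by []; rewrite -es.
Qed.

Definition delta P (v : V) : set K -> V := fun Q => if Q == P then v else 0.

Lemma sum_delta s (g : set K -> V) Q : uniq s ->
  (\sum_(P <- s) delta P (g P)) Q = if Q \in s then g Q else 0.
Proof.
elim: s => [|P s IH] /=; first by rewrite big_nil.
move=> /andP [nP us]; rewrite big_cons in_cons.
have -> : (delta P (g P) + \sum_(j <- s) delta j (g j)) Q =
  delta P (g P) Q + (\sum_(j <- s) delta j (g j)) Q by [].
rewrite IH // /delta; case: eqVneq => [->|]; first by rewrite (negPf nP) addr0.
by rewrite add0r.
Qed.

Lemma repartition_functional F (G : set K -> set V) (rho : set K -> V) :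
    (forall P, closed_points C P -> ksp iota (G P)) ->
    (forall P, points C P -> F P `<=` G P) -> finsupp rho ->
    ~ (exists h, forall P, closed_points C P -> G P (rho P - h)) ->
  exists lam, [/\ H1_functional F lam, forall P v, closed_points C P -> G P v -> lam P v = 0
    & \sum_(P \in closed_points C) lam P (rho P) != 0].
Proof.
move=> kG FG frho nrho; pose A : set (set K -> V) :=
  [set g | exists h, forall P, closed_points C P -> G P (g P - h)].
have kA : ksp iota A.
  split.
    exists 0 => P clP; rewrite subr0; exact: ksp0 (kG P clP).
  move=> c x y [h hP] [h' hP']; exists (iota c *: h + h') => P clP.
  rewrite (_ : _ - _ = iota c *: (x P - h) + (y P - h')).
    exact: kspL (kG P clP) (hP P clP) (hP' P clP).
  by rewrite scalerBr opprD addrACA.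
have [Lam [LamL LamA Lam1]] := functional_sep kA nrho.
have Lam0 : Lam 0 = 0 by apply: LamA; exact: ksp0 kA.
have LamD x y : Lam (x + y) = Lam x + Lam y.
  by have := LamL 1 x y; rewrite rmorph1 scale1r mul1r.
have Lamsum s (g : set K -> V) : Lam (\sum_(P <- s) delta P (g P)) = \sum_(P <- s) Lam (delta P (g P)).
  by elim: s => [|P s IH]; rewrite ?big_nil // !big_cons LamD IH.
pose lam P v := Lam (delta P v).
have lam0 P v : closed_points C P -> G P v -> lam P v = 0.
  move=> clP Fv; apply: LamA; exists 0 => Q clQ; rewrite subr0 /delta.
  by case: eqVneq => [->//|_]; exact: ksp0 (kG Q clQ).
exists lam; split=> //.
  split=> //.
    move=> P clP c u v; rewrite /lam -LamL; congr (Lam _); apply/funext => Q.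
    have -> : (iota c *: delta P u + delta P v) Q = iota c *: delta P u Q + delta P v Q by [].
    by rewrite /delta; case: eqVneq; rewrite // scaler0 addr0.
    by move=> P clP v Fv; apply: lam0 => //; apply: FG => //; case/closed_point: clP.
  move=> v; have [s [us sC sB]] := finsupp_seq (finite_bad F v).
  rewrite (@closed_sumE _ s) //; last first.
    move=> P clP nP; apply: lam0 => //; apply: contrapT => nG.
    have /closed_point [CP _] := clP.
    by case/negP: nP; apply: sB => //; split=> // /(FG P CP).
  rewrite /lam -(Lamsum s (fun=> v)); apply: LamA; exists v => P clP.
  rewrite (sum_delta (fun=> v) P us); case: ifPn => [_|nP]; first by rewrite subrr; exact: ksp0 (kG P clP).
  rewrite sub0r; apply: kspN (kG P clP) _; apply: contrapT => nG.
  have /closed_point [CP _] := clP.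
  by case/negP: nP; apply: sB => //; split=> // /(FG P CP).
have [s [us sC sB]] := finsupp_seq frho.
rewrite (@closed_sumE _ s) //; last first.
  move=> P clP nP; have [->|r0] := eqVneq (rho P) 0; first exact: lam0 (ksp0 (kG P clP)).
  by case/negP: nP; exact: sB.
rewrite /lam -Lamsum; suff -> : Lam (\sum_(P <- s) delta P (rho P)) = Lam rho.
  by rewrite Lam1 oner_neq0.
apply/eqP; rewrite -subr_eq0; apply/eqP.
have LamN x : Lam (- x) = - Lam x.
  by apply/eqP; rewrite -addr_eq0 -LamD addNr Lam0.
rewrite -LamN -LamD; apply: LamA; exists 0 => P clP; rewrite subr0.
have -> : (\sum_(Q <- s) delta Q (rho Q) - rho) P = (\sum_(Q <- s) delta Q (rho Q)) P - rho P by [].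
rewrite (sum_delta rho P us); case: ifPn => [_|nP]; first by rewrite subrr; exact: ksp0 (kG P clP).
rewrite sub0r; have [->|r0] := eqVneq (rho P) 0; first by rewrite oppr0; exact: ksp0 (kG P clP).
by case/negP: nP; exact: sB.
Qed.

End OneSheaf.
End Sheaves.

Lemma scaleKE (K : fieldType) (a b : K) : a *: (b : K^o) = a * b. Proof. by []. Qed.

Import VectorInternalTheory.

Section Duality.
Variables (k : closedFieldType) (C : curve k).
Local Notation K := (funfield C).
Local Notation iota := (const C).
Add Field Kfield6 : (@kfield_theory K).
Local Ltac kf := kfold (funfield C).
Implicit Types (P Q : set K).

Lemma point_denominator P z : points C P -> exists d, [/\ d != 0, P d & P (d * z)].
Proof.
move=> CP; have [s [p [fr pp eP]]] := point_chart CP; have [a [b [Aa Ab ->]]] := fr z.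
have [AP sP] : subalgebra_gen iota s `<=` P /\ subring P.
  by split; [rewrite eP; apply: localization_sub => //; exact: ksubring_gen|exact: point_sub].
have [->|b0] := eqVneq b 0.
  by exists 1; rewrite oner_neq0 invr0 mulr0 mul1r; split=> //; [exact: subring1|exact: subring0].
by exists b; rewrite mulrCA divff // mulr1; split=> //; exact: AP.
Qed.

Lemma common_denominator P (l : seq K) : points C P ->
  exists d, [/\ d != 0, P d & forall z, z \in l -> P (d * z)].
Proof.
move=> CP; have sP := point_sub CP; elim: l => [|z l [d [d0 Pd IH]]].
  by exists 1; rewrite oner_neq0; split=> //; exact: subring1.
have [d' [d'0 Pd' Pz]] := point_denominator z CP.
exists (d * d'); rewrite mulf_neq0 //; split=> //; first exact: subringM.
move=> y; rewrite inE => /orP [/eqP ->|/IH Py].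
  by rewrite -mulrA; exact: subringM.
by rewrite mulrAC; exact: subringM.
Qed.

Lemma findim_global (b : set K -> K) : finite_set [set P | points C P /\ b P != 1] ->
    (forall P, points C P -> P (b P) /\ b P != 0) ->
  findim iota ([set 0] : set K^o) [set h | forall P, points C P -> P (b P * h)].
Proof.
move=> /finite_seqP [T eT].
have bT P : points C P -> P \notin T -> b P = 1.
  move=> CP nT; apply/eqP; apply: contraT => b1.
  by case/negP: nT; suff : [set` T] P by []; rewrite -eT.
elim: T b bT {eT} => [|P0 T IH] b bT bP.
  suff -> : [set h : K^o | forall P, points C P -> P (b P * h)] = addl iota ([set 0] : set K^o) 1.
    by apply: findim_addl; [exact: ksp_0|exists 0%N; exact: rdim0].
  rewrite predeqE => h; split.
    move=> hP; have [|c _ ec] := @global_const _ C h.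
      by move=> P CP; have := hP P CP; rewrite bT // mul1r.
    by exists c; rewrite -ec scaleKE mulr1 subrr.
  move=> [c /= /eqP]; rewrite subr_eq0 => /eqP -> P CP.
  rewrite bT // mul1r scaleKE mulr1; exact: ksubringC (point_ksub CP).
pose b' P := if P == P0 then 1 else b P.
have {IH}fin' := IH b' _ _.
have [CP0|nP0] := pselect (points C P0); last first.
  suff -> : [set h : K^o | forall P, points C P -> P (b P * h)] =
            [set h | forall P, points C P -> P (b' P * h)].
    apply: fin' => P CP; rewrite /b'; case: eqVneq => [eP|nP].
    - by move=> _; rewrite eP in CP.
    - by move=> nT; apply: bT => //; rewrite in_cons negb_or nP.
    - by rewrite eP in CP.
    - exact: bP.
  rewrite predeqE => h; split=> hP P CP; have := hP P CP; rewrite /b';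
    by case: eqVneq => // eP; rewrite eP in CP.
have {}fin' : findim iota ([set 0] : set K^o) [set h | forall P, points C P -> P (b' P * h)].
  apply: fin' => P CP; rewrite /b'; case: eqVneq => // nP.
  - by move=> nT; apply: bT => //; rewrite in_cons negb_or nP.
  - by rewrite oner_neq0; split=> //; exact: subring1 (point_sub CP).
  - exact: bP.
apply: findim_trans fin' _; have [Pb0 b0] := bP _ CP0.
set b0' := b P0 in Pb0 b0.
have [n Hn] := findim_point CP0 Pb0 b0.
have sH : @ksp _ _ iota K^o [set h | forall P, points C P -> P (b P * h)].
  split; first by move=> P CP; rewrite mulr0; exact: subring0 (point_sub CP).
  move=> c x y hx hy P CP; rewrite mulrDr; apply: subringD (point_sub CP) _ (hy P CP).
  rewrite scaleKE mulrCA; apply: subringM (point_sub CP) _ (hx P CP).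
  exact: ksubringC (point_ksub CP).
have [m Hm _] := rdim_preim (klin_mul iota b0') sH (ksp_mul b0' (point_ksp CP0)) Hn.
exists m; move: Hm.
have -> : [set h : K | forall P, points C P -> P (b P * h)] `&` *%R b0' @^-1` P0 =
          [set h | forall P, points C P -> P (b P * h)].
  by rewrite predeqE => h; split=> [[]//|hP]; split=> //; exact: hP.
suff -> : [set h : K | forall P, points C P -> P (b P * h)] `&` *%R b0' @^-1` ( *%R b0' @` P0) =
          [set h | forall P, points C P -> P (b' P * h)] by [].
rewrite predeqE => h; split.
  move=> [hP [x Px /(mulfI b0) ex]] P CP; rewrite /b'; case: eqVneq => [->|_]; last exact: hP.
  by rewrite mul1r -ex.
move=> hP; have h0 : P0 h by have := hP P0 CP0; rewrite /b' eqxx mul1r.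
split; last by exists h.
move=> P CP; have := hP P CP; rewrite /b'; case: eqVneq => [->|//] _.
exact: subringM (point_sub CP0) _ _.
Qed.

Lemma findim_inj (X : lmodType K) (n : nat) (f : 'I_n -> X -> K^o) (U : set X) (B : 'I_n -> set K^o) :
    (forall i, klin iota (f i)) -> ksp iota U ->
    (forall i, findim iota [set 0] (B i)) -> (forall i u, U u -> B i (f i u)) ->
    (forall u, U u -> (forall i, f i u = 0) -> u = 0) ->
  findim iota [set 0] U.
Proof.
move=> lf sU finB UB inj.
pose Uj j := U `&` [set u | forall i : 'I_n, (i < j)%N -> f i u = 0].
have kU j : ksp iota (Uj j).
  apply: kspI => //; split; first by move=> i _; exact: klin0 (lf i).
  by move=> c x y hx hy i ij; rewrite lf hx // hy // scaler0 addr0.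
have fin j : (j <= n)%N -> findim iota (Uj j) U.
  elim: j => [|j IH] jn.
    exists 0%N; suff -> : Uj 0%N = U by exact: rdim0.
    by rewrite predeqE => u; split=> [[]|].
  apply: findim_trans (IH (ltnW jn)).
  have [m Hm] := finB (Ordinal jn).
  have [m' Hm' _] := rdim_preim (lf (Ordinal jn)) (kU j) (ksp_0 iota _) Hm.
  exists m'; move: Hm'.
  have -> : Uj j `&` f (Ordinal jn) @^-1` B (Ordinal jn) = Uj j.
    by rewrite predeqE => u; split=> [[]//|[Uu hu]]; split=> //; exact: UB.
  suff -> : Uj j `&` f (Ordinal jn) @^-1` [set 0] = Uj j.+1 by [].
  rewrite predeqE => u; split=> [[[Uu hu] /= hj]|[Uu hu]].
    split=> // i; rewrite ltnS leq_eqVlt => /orP [/eqP ij|]; last exact: hu.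
    by rewrite (_ : i = Ordinal jn) //; exact: val_inj.
  split; last exact: hu.
  by split=> // i ij; apply: hu; exact: leqW.
suff -> : [set 0] = Uj n by exact: fin.
rewrite eqEsubset; split=> [_ ->|u [Uu hu]]; first exact: ksp0.
by apply: inj => // i; exact: hu.
Qed.

Section OneSheaf.
Variable V : vectType K.
Implicit Types (F : tfsheaf V).

Lemma sheaf_bounded F : exists b : set K -> K,
  finite_set [set P | points C P /\ b P != 1] /\
  forall P, points C P -> [/\ P (b P), b P != 0 &
    forall v i, F P v -> P (b P * v2r v 0 i)].
Proof.
pose good P := forall v i, F P v -> P (v2r v 0 i).
have lin P d S : points C P -> (forall z, z \in [seq v2r x 0 i | x <- S, i <- enum 'I_(dim V)] -> P (d * z)) ->
    forall v i, gen_submod P [set` S] v -> P (d * v2r v 0 i).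
  move=> CP hd; have sP := point_sub CP.
  suff : gen_submod P [set` S] `<=` [set v | forall i, P (d * v2r v 0 i)] by move=> h v i /h.
  apply: gen_submod_min.
    split.
    - by move=> i; rewrite linear0 mxE mulr0; exact: subring0.
    - by move=> x y hx hy i; rewrite linearD mxE mulrDr; exact: subringD.
    - by move=> a x Pa hx i; rewrite linearZ mxE mulrCA; exact: subringM.
  move=> x xS i; apply: hd; apply/allpairsP; exists (x, i); split=> //=.
  by rewrite mem_enum.
have fin : finite_set [set P | points C P /\ ~ good P].
  have [S1 [g1 finS]] := sheaf_generic F.
  pose l := [seq v2r x 0 i | x <- S1, i <- enum 'I_(dim V)].
  apply: (@sub_finite_set _ _ ([set P | points C P /\ F P <> gen_submod P [set` S1]] `|`
    \bigcup_(z in [set` l]) [set P | points C P /\ ~ P z])).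
    move=> P [CP nP]; apply: contrapT => /not_orP [h1 h2]; apply: nP => v i.
    have -> : F P = gen_submod P [set` S1] by apply: contrapT => h; apply: h1.
    rewrite -[v2r v 0 i]mul1r; apply: lin => // z zl; rewrite mul1r.
    by apply: contrapT => nz; apply: h2; exists z.
  rewrite finite_setU; split=> //.
  by apply: bigcup_finite => [|i _]; [exact: finite_seq|exact: finite_poles].
have /choice [b bP] : forall P, exists d, points C P -> [/\ P d, d != 0,
    (forall v i, F P v -> P (d * v2r v 0 i)) & good P -> d = 1].
  move=> P; have [CP|nCP] := pselect (points C P); last by exists 0.
  have [gP|nP] := pselect (good P).
    exists 1 => _; rewrite oner_neq0; split=> //; first exact: subring1 (point_sub CP).
    by move=> v i Fv; rewrite mul1r; exact: gP.
  have [S [eF _]] := sheaf_gen F CP.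
  have [d [d0 Pd hd]] := common_denominator [seq v2r x 0 i | x <- S, i <- enum 'I_(dim V)] CP.
  exists d => _; split=> // v i; rewrite eF; exact: lin.
exists b; split.
  apply: sub_finite_set fin => P [CP b1]; split=> // gP.
  by have [_ _ _ /(_ gP)] := bP P CP; move/eqP: b1.
by move=> P CP; have [Pb b0 h _] := bP P CP.
Qed.

Lemma findim_sections F (c : set K -> K) : finite_set [set P | points C P /\ c P != 1] ->
    (forall P, points C P -> c P != 0) ->
  findim iota [set 0] [set v : V | forall P, points C P -> F P (c P *: v)].
Proof.
move=> finc c0; have [b [finb bP]] := sheaf_bounded F.
have /choice [d dP] : forall P, exists d, points C P ->
    [/\ d != 0, P d, P (d * c P) & c P = 1 -> d = 1].
  move=> P; have [CP|nCP] := pselect (points C P); last by exists 0.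
  have [c1|c1] := eqVneq (c P) 1.
    by exists 1; rewrite c1 mulr1 oner_neq0; split=> //; exact: subring1 (point_sub CP).
  have [d [d0 Pd Pdc]] := point_denominator (c P) CP.
  by exists d => _; split=> // cc; rewrite cc eqxx in c1.
pose B : set K^o := [set h | forall P, points C P -> P ((d P * c P * b P) * h)].
have finB : findim iota [set 0] B.
  apply: findim_global.
    apply: (@sub_finite_set _ _ ([set P | points C P /\ c P != 1] `|` [set P | points C P /\ b P != 1])).
      move=> P [CP ne]; apply: contrapT => /not_orP [h1 h2]; case/eqP: ne.
      have c1 : c P = 1 by apply/eqP; apply: contraT => h; case: h1.
      have b1 : b P = 1 by apply/eqP; apply: contraT => h; case: h2.
      by have [_ _ _ /(_ c1) ->] := dP P CP; rewrite c1 b1 !mulr1.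
    by rewrite finite_setU.
  move=> P CP; have [Pb b0 _] := bP P CP; have [d0 Pd Pdc _] := dP P CP.
  by split; [exact: subringM (point_sub CP) _ _|rewrite !mulf_neq0 // c0].
apply: (@findim_inj V (dim V) (fun i v => v2r v 0 i) _ (fun=> B)) => //.
- by move=> i a x y; rewrite linearP !mxE.
- split; first by move=> P CP; rewrite scaler0; exact: ksp0 (sheaf_ksp F CP).
  move=> a x y hx hy P CP; rewrite scalerDr scalerA mulrC -scalerA.
  by apply: kspL (sheaf_ksp F CP) _ _; [exact: hx|exact: hy].
- move=> i v hv P CP; have [_ _ /(_ _ i (hv P CP))] := bP P CP.
  rewrite linearZ mxE => h; have [_ Pd _ _] := dP P CP.
  have -> : d P * c P * b P * v2r v 0 i = d P * (b P * (c P * v2r v 0 i)) by kf; ring.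
  exact: subringM (point_sub CP) _ _.
- move=> v _ h0; apply: (can_inj v2rK); apply/rowP => i; rewrite linear0 mxE; exact: h0.
Qed.

Lemma sheaf_denominator F v : exists c : set K -> K,
  finite_set [set P | points C P /\ c P != 1] /\
  forall P, points C P -> [/\ c P != 0, P (c P) & F P (c P *: v)].
Proof.
have /choice [c cP] : forall P, exists d, points C P -> [/\ d != 0, P d, F P (d *: v) & F P v -> d = 1].
  move=> P; have [CP|nCP] := pselect (points C P); last by exists 0.
  have [Fv|nFv] := pselect (F P v).
    by exists 1; rewrite oner_neq0 scale1r; split=> //; exact: subring1 (point_sub CP).
  have [S [eF gS]] := sheaf_gen F CP.
  have : gen_submod [set: K] [set` S] v by rewrite gS.
  move=> [m [a [x [_ Sx ev]]]].
  have [d [d0 Pd hd]] := common_denominator (codom a) CP.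
  exists d => _; split=> //; rewrite eF ev; exists m, (fun i => d * a i), x; split=> //.
    by move=> i; apply: hd; exact: codom_f.
  by rewrite scaler_sumr; apply: eq_bigr => i _; rewrite scalerA.
exists c; split.
  apply: sub_finite_set (finite_bad F v) => P [CP c1]; split=> // Fv.
  by have [_ _ _ /(_ Fv)] := cP P CP; move/eqP: c1.
by move=> P CP; have [c0 Pc Fc _] := cP P CP.
Qed.

End OneSheaf.

Lemma gen_submod1 (V : lmodType K) P (x : V) : subring P ->
  gen_submod P [set` [:: x]] = [set a *: x | a in P].
Proof.
move=> sP; rewrite eqEsubset; split.
  apply: gen_submod_min; last first.
    by move=> y /=; rewrite inE => /eqP ->; exists 1; rewrite ?scale1r //; exact: subring1.
  split; first by exists 0; rewrite ?scale0r //; exact: subring0.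
    move=> _ _ [a Pa <-] [b Pb <-]; exists (a + b); [exact: subringD|exact: scalerDl].
  by move=> c _ Pc [a Pa <-]; exists (c * a); [exact: subringM|rewrite scalerA].
move=> _ [a Pa <-]; exists 1%N, (fun=> a), (fun=> x); split=> //; last by rewrite big_ord1.
by move=> i /=; rewrite inE.
Qed.

Lemma invertible_sheaf (b : set K -> K) : finite_set [set P | points C P /\ b P != 1] ->
    (forall P, points C P -> b P != 0) ->
  exists F : tfsheaf (K^o : vectType K), forall P, points C P -> F P = *%R (b P) @` P.
Proof.
move=> finb b0.
have gen P (x : K) : points C P -> gen_submod P [set` [:: (x : K^o)]] = *%R x @` P.
  move=> CP; rewrite gen_submod1; last exact: point_sub.
  by rewrite eqEsubset; split=> _ [a Pa <-]; exists a => //; rewrite mulrC.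
have genT (x : K) : x != 0 -> gen_submod setT [set` [:: (x : K^o)]] = setT.
  move=> x0; rewrite gen ?generic_point //; last exact: (generic_point C).
  by rewrite -subTset => y _; exists (y / x) => //; rewrite mulrC divfK.
have CT := generic_point C.
suff [F FE] : exists F : tfsheaf (K^o : vectType K), forall P, F P = *%R (b P) @` P.
  by exists F => P _; exact: FE.
apply: (@tfsheaf_of _ C (K^o : vectType K) _ [:: 1]).
- by rewrite -(gen setT) // genT // b0.
- by rewrite genT // oner_neq0.
- apply: sub_finite_set finb => P [CP ne]; split=> //; apply: contra_not_neq ne => ->.
  by rewrite gen.
- by move=> P CP; exists [:: b P]; rewrite gen // genT // b0.
Qed.

End Duality.

Section Codimension.
Variables (k : closedFieldType) (K : fieldType) (iota : {rmorphism k -> K}) (X : lmodType K).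
Local Notation ksp := (ksp iota).
Local Notation rdim := (rdim iota).

Lemma rdim_basis (A B : set X) n : rdim A B n -> exists gs, size gs = n /\ B = spanl iota A gs.
Proof.
elim=> [|{}B D x {}n _ [gs [sg ->]] _ ->]; first by exists [::].
by exists (x :: gs); rewrite /= sg.
Qed.

Lemma codim_annihilator (U : set X) (phi : nat -> X -> k) n : ksp U ->
    (forall i c x y, phi i (iota c *: x + y) = c * phi i x + phi i y) ->
  exists2 m, rdim (U `&` [set x | forall i, (i < n)%N -> phi i x = 0]) U m & (m <= n)%N.
Proof.
move=> sU lphi.
have phi0 i : phi i 0 = 0.
  by have := lphi i (-1) 0 0; rewrite scaler0 addr0 mulN1r addNr.
have sK j : ksp (U `&` [set x | forall i, (i < j)%N -> phi i x = 0]).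
  apply: kspI => //; split; first by move=> i _.
  by move=> c x y hx hy i ij; rewrite lphi hx // hy // mulr0 addr0.
elim: n => [|n [m Hm mn]].
  exists 0%N => //; suff -> : U `&` [set x | forall i, (i < 0)%N -> phi i x = 0] = U by exact: rdim0.
  by rewrite predeqE => x; split=> [[]|].
pose f (x : X) : K^o := iota (phi n x).
have lf : klin iota f by move=> c x y; rewrite /f lphi rmorphD rmorphM.
have H1 := @rdim1 _ _ iota K^o [set 0] 1 (elimN eqP (oner_neq0 K)).
have [m' Hm' m'1] := rdim_preim lf (sK n) (ksp_0 iota _) H1.
exists (m' + m)%N; last by rewrite -add1n leq_add.
apply: rdim_trans _ Hm; move: Hm'.
set A0 := U `&` _; have -> : A0 `&` f @^-1` addl iota [set 0] 1 = A0.
  rewrite predeqE => x; split=> [[]//|Ax]; split=> //; exists (phi n x).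
  by rewrite /f scaleKE mulr1 subrr.
suff -> : A0 `&` f @^-1` [set 0] = U `&` [set x | forall i, (i < n.+1)%N -> phi i x = 0] by [].
rewrite predeqE => x; split=> [[[Ux hx] /= /eqP fx]|[Ux hx]].
  split=> // i; rewrite ltnS leq_eqVlt => /orP [/eqP ->|]; last exact: hx.
  by apply/eqP; rewrite -(fmorph_eq0 iota).
split; first by split=> // i ij; apply: hx; exact: leqW.
by rewrite /= /f hx // rmorph0.
Qed.

End Codimension.

Section Dualizing.
Variables (k : closedFieldType) (C : curve k).
Local Notation K := (funfield C).
Local Notation iota := (const C).
Add Field Kfield7 : (@kfield_theory K).
Local Ltac kf := kfold (funfield C).
Implicit Types (P Q : set K).
Variables (W : vectType K) (omega : tfsheaf W) (tr : set K -> W -> k).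
Hypothesis trH : H1_functional omega tr.
Hypothesis trU : forall (V : vectType K) (F : tfsheaf V) lam, H1_functional F lam ->
      exists! f : 'Hom(V, W), sheaf_hom F omega f /\
        forall P, closed_points C P -> forall v, lam P v = tr P (f v).

Lemma trL P c u v : closed_points C P -> tr P (iota c *: u + v) = c * tr P u + tr P v.
Proof. by case: trH => h _ _ clP; exact: h. Qed.

Lemma tr0 P : closed_points C P -> tr P 0 = 0.
Proof. by move=> clP; have := trL (-1) 0 0 clP; rewrite scaler0 addr0 mulN1r addNr. Qed.

Lemma trD P u v : closed_points C P -> tr P (u + v) = tr P u + tr P v.
Proof. by move=> clP; have := trL 1 u v clP; rewrite rmorph1 scale1r mul1r. Qed.

Lemma tr_omega P v : closed_points C P -> omega P v -> tr P v = 0.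
Proof. by case: trH => _ h _ clP; exact: h. Qed.

(* [omega P] is the largest submodule killed by the trace at [P]: enlarge [omega] by such a
   submodule at the single point [P] and compare the homomorphisms representing [tr]. *)
Lemma local_duality P u : closed_points C P -> (forall r, P r -> tr P (r *: u) = 0) -> omega P u.
Proof.
move=> clP Pu; have /closed_point [CP PT] := clP; have sP := point_sub CP.
pose G Q := if Q == P then [set z | exists2 r, P r & omega P (z - r *: u)] else omega Q.
have [o0 oD oZ] := sheaf_submodule omega CP.
have GP : submodule P (G P).
  rewrite /G eqxx; split; first by exists 0; [exact: subring0|rewrite scale0r subr0].
    move=> x y [a Pa ox] [b Pb oy]; exists (a + b); first exact: subringD.
    by rewrite scalerDl opprD addrACA; exact: oD.
  move=> c x Pc [a Pa ox]; exists (c * a); first exact: subringM.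
  by rewrite -scalerA -scalerBr; exact: oZ.
have [F FG] : exists F : tfsheaf W, forall Q, F Q = G Q.
  have [S1 [gS1 fin]] := sheaf_generic omega.
  apply: (tfsheaf_of (S1 := S1)) => //.
  - by rewrite /G; case: eqVneq => [e|_]; [case: PT|exact: generic_stalk].
  - apply: (@sub_finite_set _ _ ([set Q | points C Q /\ omega Q <> gen_submod Q [set` S1]] `|` [set P])).
      move=> Q [CQ]; rewrite /G; case: eqVneq => [->|_ ne]; first by right.
      by left.
    by rewrite finite_setU; split.
  - move=> Q CQ; have [S [eS gS]] := sheaf_gen omega CQ.
    rewrite /G; case: eqVneq => [eQ|nQ]; last by exists S.
    subst Q; exists (u :: S); split.
      have sg := gen_submod_submodule [set` u :: S] sP.
      rewrite eqEsubset; split.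
        move=> z [r Pr oz]; rewrite -(subrK (r *: u) z).
        have [_ gD gZ] := sg; apply: gD; last first.
          by apply: gZ => //; apply: gen_submod_mem => //=; rewrite inE eqxx.
        rewrite eS in oz; move: oz; apply: gen_submod_min => // x xS.
        by apply: gen_submod_mem => //=; rewrite inE; apply/orP; right.
      move: GP; rewrite /G eqxx => GP; apply: gen_submod_min => //.
      move=> x /=; rewrite inE => /orP [/eqP ->|xS].
        by exists 1; [exact: subring1|rewrite scale1r subrr].
      by exists 0; [exact: subring0|rewrite scale0r subr0 eS; exact: gen_submod_mem].
    rewrite -subTset -gS; apply: gen_submod_min.
      by apply: gen_submod_submodule; exact: point_sub (generic_point C).
    move=> x xS; apply: gen_submod_mem; first exact: point_sub (generic_point C).
    by rewrite /= inE; apply/orP; right.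
have subF Q v : omega Q v -> F Q v.
  rewrite FG /G; case: eqVneq => [->|//] ov.
  by exists 0; [exact: subring0|rewrite scale0r subr0].
have HF : H1_functional F tr.
  split; [by case: trH| |by case: trH].
  move=> Q clQ v; rewrite FG /G; case: eqVneq => [eQ|_]; last exact: tr_omega.
  subst Q => -[r Pr ov]; rewrite -(subrK (r *: u) v) trD // Pu // addr0.
  exact: tr_omega.
have [f [[hf ef] _]] := trU HF.
have [g [_ Ug]] := trU trH.
have e1 : g = \1%VF.
  by apply: Ug; split=> [Q CQ v ov|Q clQ v]; rewrite id_lfunE.
have e2 : g = f by apply: Ug; split=> // Q CQ v /subF Fv; exact: hf.
have Fu : F P u by rewrite FG /G eqxx; exists 1; [exact: subring1|rewrite scale1r subrr].
by have := hf P CP _ Fu; rewrite -e2 e1 id_lfunE.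
Qed.

Lemma repartition_pairing (F : tfsheaf (K^o : vectType K)) (G : set K -> set K) (rho : set K -> K) :
    (forall P, points C P -> @submodule K K^o P (G P)) ->
    (forall P, points C P -> F P `<=` G P) -> finsupp rho ->
    ~ (exists h, forall P, closed_points C P -> G P (rho P - h)) ->
  exists w : W, (forall P x, points C P -> G P x -> omega P (x *: w)) /\
    \sum_(P \in closed_points C) tr P (rho P *: w) != 0.
Proof.
move=> sG FG frho nrho.
have kG P : closed_points C P -> @ksp _ _ iota K^o (G P).
  move=> /closed_point [CP _]; have [G0 GD GZ] := sG P CP; split=> // c x y Gx Gy.
  by apply: GD => //; apply: GZ => //; exact: ksubringC (point_ksub CP).
have [lam [Hlam lamG nz]] := @repartition_functional _ C (K^o : vectType K) F G rho kG FG frho nrho.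
have [f [[hf ef] _]] := trU Hlam.
have fE (x : K^o) : f x = x *: f 1 by rewrite -linearZ scaleKE mulr1.
exists (f 1); split=> [P x CP Gx|].
  have [->|PT] := pselect (P = setT); first by rewrite generic_stalk.
  have clP : closed_points C P by apply/closed_point.
  apply: local_duality => // r Pr; rewrite scalerA -fE -ef //.
  by have [_ _ GZ] := sG P CP; apply: lamG => //; exact: GZ.
rewrite (eq_fsbigr (fun P => lam P (rho P))) // => P /[!inE] clP.
by rewrite -fE -ef.
Qed.

Lemma structure_sheaf : exists F : tfsheaf (K^o : vectType K), forall P, points C P -> F P = P.
Proof.
have fin1 : finite_set [set P | points C P /\ (1 : K) != 1].
  by apply: (@sub_finite_set _ _ set0); [move=> P [_]; rewrite eqxx|exact: finite_set0].
have [F FE] := invertible_sheaf fin1 (fun _ _ => oner_neq0 _).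
exists F => P CP; rewrite FE //.
by rewrite eqEsubset; split=> [_ [x Px <-]|x Px]; [rewrite mul1r|exists x; rewrite ?mul1r].
Qed.

Local Notation ksp := (@ksp _ _ iota K^o).

Lemma dualizing_dim1 (w1 w2 : W) : w1 != 0 -> exists x, w2 = x *: w1.
Proof.
move=> w10; apply: contrapT => no.
have indep x y : x *: w1 + y *: w2 = 0 -> x = 0 /\ y = 0.
  have [->|y0] := eqVneq y 0.
    by rewrite scale0r addr0 => /eqP; rewrite scaler_eq0 (negPf w10) orbF => /eqP.
  move=> /eqP; rewrite addrC addr_eq0 => /eqP e; case: no; exists (- y^-1 * x).
  apply: (scalerI y0); rewrite e scalerA mulrA mulrN divff // mulN1r scaleNr //.
have w20 : w2 != 0 by apply: contra_not_neq no => ->; exists 0; rewrite scale0r.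
have fin1 : finite_set [set P | points C P /\ (1 : K) != 1].
  by apply: (@sub_finite_set _ _ set0); [move=> P [_]; rewrite eqxx|exact: finite_set0].
pose V0 := [set v | forall P, points C P -> omega P v].
have finV : findim iota [set 0] V0.
  have := findim_sections omega fin1 (fun _ _ => oner_neq0 _).
  suff -> : [set v | forall P, points C P -> omega P (1 *: v)] = V0 by [].
  by rewrite predeqE => v; split=> h P CP; have := h P CP; rewrite scale1r.
have [g0 HV] := finV; have [gs [gsz eV]] := rdim_basis HV.
have [c1 [fc1 c1P]] := sheaf_denominator omega w1.
have [c2 [fc2 c2P]] := sheaf_denominator omega w2.
pose b P := c1 P * c2 P.
have bP P : points C P -> [/\ b P != 0, P (b P), omega P (b P *: w1) & omega P (b P *: w2)].
  move=> CP; have [c10 Pc1 o1] := c1P P CP; have [c20 Pc2 o2] := c2P P CP.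
  have [_ _ oZ] := sheaf_submodule omega CP.
  split; [by rewrite mulf_neq0|exact: subringM (point_sub CP) _ _| |].
    by rewrite /b mulrC -scalerA; exact: oZ.
  by rewrite /b -scalerA; exact: oZ.
have finb : finite_set [set P | points C P /\ b P != 1].
  apply: (@sub_finite_set _ _ ([set P | points C P /\ c1 P != 1] `|` [set P | points C P /\ c2 P != 1])).
    move=> P [CP ne]; apply: contrapT => /not_orP [h1 h2]; case/eqP: ne.
    have e1 : c1 P = 1 by apply/eqP; apply: contraT => h; case: h1.
    have e2 : c2 P = 1 by apply/eqP; apply: contraT => h; case: h2.
    by rewrite /b e1 e2 mulr1.
  by rewrite finite_setU.
have b0 P : points C P -> b P != 0 by move=> CP; have [] := bP P CP.
have [z0 HZ] := findim_sections omega finb b0.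
set Z0 := [set v : W | _] in HZ.
have [P clP] := closed_point_ex C; have /closed_point [CP PT] := clP.
have sP := point_sub CP; have kP := point_ksp CP.
have [r mr r0] := closed_neq0 clP; have [Pr nur] := mr.
have [n1 H1] := findim_point CP Pr r0.
have n1pos : (0 < n1)%N.
  case: n1 H1 => // /rdim0E eP.
  have [x Px ex] : ( *%R r @` P) 1 by rewrite -eP; exact: subring1.
  case: nur; split=> //; suff -> : r^-1 = x by [].
  by apply: (mulfI r0); rewrite divff.
have Hpow m : rdim iota ( *%R (r ^+ m) @` P : set K^o) P (m * n1).
  elim: m => [|m IH].
    rewrite mul0n expr0 (_ : *%R 1 @` P = P); first exact: rdim0.
    by rewrite eqEsubset; split=> [_ [x Px <-]|x Px]; [rewrite mul1r|exists x; rewrite ?mul1r].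
  rewrite mulSn; apply: rdim_trans _ IH.
  have := rdim_mul (expf_neq0 m r0) (ksp_mul r kP) H1.
  suff -> : *%R (r ^+ m) @` ( *%R r @` P) = *%R (r ^+ m.+1) @` P by [].
  rewrite eqEsubset; split=> [_ [_ [x Px <-] <-]|_ [x Px <-]].
    by exists x; rewrite // exprSr mulrA.
  by exists (r * x); [exists x|rewrite exprSr mulrA].
pose m := (g0 + g0 + z0).+1; pose N := (m * n1)%N.
have rm0 : r ^+ m != 0 by rewrite expf_neq0.
have HN := Hpow m; rewrite -/N in HN.
pose Xm := *%R (r ^+ m)^-1 @` P.
have HX : rdim iota (P : set K^o) Xm N.
  have rmV : (r ^+ m)^-1 != 0 by rewrite invr_eq0.
  by have := rdim_mul rmV (ksp_mul _ kP) HN; rewrite im_mulK.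
have sX : ksp Xm by exact: ksp_mul.
have PX : P `<=` Xm := rdim_sub HX.
pose phi i (u : K^o) := tr P (u *: gs`_i).
have lphi i c x y : phi i (iota c *: x + y) = c * phi i x + phi i y.
  by rewrite /phi scalerDl scaleKE -scalerA trL.
have [m1 Hm1 m1g] := codim_annihilator g0 sX lphi.
set K1 := Xm `&` _ in Hm1.
have K1V u v : K1 u -> V0 v -> tr P (u *: v) = 0.
  move=> [_ hu]; suff : V0 `<=` [set v | tr P (u *: v) = 0] by move=> h /h.
  rewrite eV; apply: spanl_min.
  - split; first by rewrite /= scaler0 tr0.
    move=> c x y /= hx hy; rewrite scalerDr scalerA mulrC -scalerA trL // hx hy.
    by rewrite mulr0 addr0.
  - by move=> _ ->; rewrite /= scaler0 tr0.
  - by move=> g /(nthP 0) [i ig <-]; apply: hu; rewrite -gsz.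
have sK1 : ksp K1.
  apply: kspI => //; split=> [i _|c x y hx hy i ij]; first by rewrite /phi scale0r tr0.
  by rewrite lphi hx // hy // mulr0 addr0.
have gsV g : g \in gs -> V0 g by move=> gin; rewrite eV; apply: spanl_gen => //; exact: ksp_0.
have PK1 : P `<=` K1.
  move=> u Pu; split; first exact: PX.
  move=> i ig; apply: tr_omega => //; have [_ _ oZ] := sheaf_submodule omega CP.
  by apply: oZ => //; apply: (gsV) => //; apply: mem_nth; rewrite gsz.
have [n2 [m1' [eN Hn2 Hm1']]] := rdim_mid kP sK1 PK1 (rdim_sub Hm1) HX.
rewrite (rdim_uniq sK1 Hm1' Hm1) in eN.
pose H := [set h : K | (forall Q, closed_points C Q -> Q <> P -> Q h) /\ P (r ^+ m * h)].
have sH : ksp H.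
  split.
    split=> [Q /closed_point [CQ _] _|]; first exact: subring0 (point_sub CQ).
    by rewrite mulr0; exact: subring0.
  move=> c x y [hx hx'] [hy hy']; split.
    move=> Q clQ nQ; have /closed_point [CQ _] := clQ.
    by apply: kspL (point_ksp CQ) _ _; [exact: hx|exact: hy].
  rewrite mulrDr scaleKE mulrCA; exact: (kspL c kP hx' hy').
have [O OE] := structure_sheaf.
have subP Q : points C Q -> @submodule K K^o Q Q.
  move=> /point_sub sQ; split; [exact: subring0|by move=> x y; exact: subringD|].
  by move=> a x; exact: subringM.
have OP Q : points C Q -> O Q `<=` Q by move=> CQ; rewrite OE.
have K1H : K1 `<=` addS (H : set K^o) P.
  move=> u K1u; have [Xu _] := K1u; apply: contrapT => nu.
  pose rho Q := if Q == P then u else 0.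
  have frho : finsupp rho.
    apply: (@sub_finite_set _ _ [set P]); last exact: finite_set1.
    by move=> Q /=; rewrite /rho; have [->//|_] := eqVneq Q P; rewrite eqxx.
  have [|w [ow]] := repartition_pairing (G := id) (F := O) subP OP frho.
    move=> [h hP]; apply: nu; have := hP P clP; rewrite /rho eqxx => uh.
    exists h => //; split.
      move=> Q clQ nQ; have /closed_point [CQ _] := clQ.
      have := hP Q clQ; rewrite /rho; case: eqVneq => // _; rewrite sub0r.
      by move/(subringN (point_sub CQ)); rewrite opprK.
    have rP : P (r ^+ m) by exact: subringX.
    rewrite (_ : r ^+ m * h = r ^+ m * u - r ^+ m * (u - h)); last by kf; ring.
    apply: subringB => //; last exact: subringM.
    by have [x Px <-] := Xu; rewrite mulrA divff // mul1r.
  apply/negP; rewrite negbK; apply/eqP.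
  rewrite (@closed_sumE _ C _ [:: P]) //.
  - rewrite big_seq1 /rho eqxx; apply: K1V => // Q CQ.
    by rewrite -[w]scale1r; apply: ow => //; exact: subring1 (point_sub CQ).
  - by move=> Q; rewrite inE => /eqP ->.
  - by move=> Q clQ; rewrite inE /rho => /negPf ->; rewrite scale0r tr0.
pose H1' := K1 `&` H.
have [p1 [q1 [en2 Hp1 Hq1]]] := rdim_mod kP sH Hn2.
have p10 : p1 = 0%N.
  have e : addS (K1 : set K^o) H = addS (P : set K^o) H.
    rewrite eqEsubset; split=> x; last by case=> y Py Hy; exists y => //; exact: PK1.
    move=> [y /K1H [h Hh Ph] Hx]; exists (y - h) => //.
    by rewrite opprB addrA addrAC; apply: (kspD (iota := iota) sH).
  by rewrite e in Hp1; exact: rdim_uniq (ksp_addS kP sH) Hp1 (rdim0 _ _).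
rewrite p10 add0n in en2; rewrite -{q1}en2 in Hq1.
have [n0 Hn0] : findim iota [set 0] (P `&` H : set K^o).
  have fin := @findim_global _ C (fun=> 1) fin1.
  have {}fin := fin (fun Q CQ => conj (subring1 (point_sub CQ)) (oner_neq0 _)).
  suff -> : P `&` H = [set h : K | forall Q, points C Q -> Q (1 * h)] by [].
  rewrite predeqE => h; split.
    move=> [Ph [Hh _]] Q CQ; rewrite mul1r.
    have [->//|nP] := pselect (Q = P); have [->//|nT] := pselect (Q = setT).
    exact: Hh.
  move=> hQ; have Ph : P h by have := hQ P CP; rewrite mul1r.
  split=> //; split; last by apply: subringM => //; exact: subringX.
  by move=> Q /closed_point [CQ _] _; have := hQ Q CQ; rewrite mul1r.
have HH := rdim_trans Hn0 Hq1; rewrite -/H1' in HH.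
have sH1 : ksp H1' by exact: kspI.
have imdim (w : W) : w != 0 -> rdim iota [set 0] (( *:%R^~ w) @` (H1' : set K^o)) (n0 + n2)
    /\ ksubspace iota (( *:%R^~ w) @` (H1' : set K^o)).
  move=> wn0; have lw : klin iota (fun x : K^o => x *: w).
    by move=> c x y; rewrite scalerDl scaleKE scalerA.
  split; last exact: ksp_im.
  have := rdim_im lw (ksp_0 iota _) _ HH.
  rewrite image_set1 scale0r; apply=> x _ /eqP.
  by rewrite scaler_eq0 (negPf wn0) orbF => /eqP.
have [Hw1 sA1] := imdim _ w10; have [Hw2 sA2] := imdim _ w20.
set A1 := _ @` _ in Hw1 sA1; set A2 := _ @` _ in Hw2 sA2.
have [p [q [epq Hp Hq]]] := rdim_mod (ksp_0 iota W) sA2 Hw1.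
have A12 : A1 `&` A2 = [set 0] `&` A2.
  rewrite eqEsubset; split=> x [].
    move=> [x1 _ <-] [x2 Hx2 e]; have : x1 *: w1 + (- x2) *: w2 = 0.
      by rewrite scaleNr e subrr.
    by move/indep=> [-> _]; rewrite scale0r; split=> //; exact: ksp0 sA2.
  by move=> -> A20; split=> //; exact: ksp0 sA1.
have q0 : q = 0%N.
  by rewrite A12 in Hq; exact: rdim_uniq (kspI (ksp_0 iota W) sA2) Hq (rdim0 _ _).
rewrite q0 addn0 in epq; rewrite -{p}epq (addS_idl (ksp_0 iota W) sA2) in Hp; last first.
  by move=> _ ->; exact: ksp0 sA2.
set Zs := addS A1 A2 in Hp; have HZs := rdim_trans Hw2 Hp.
have sZs : ksubspace iota Zs by exact: ksp_addS.
have [cs [csz eP]] := rdim_basis HN.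
pose psi i (z : W) := tr P ((b P * cs`_i) *: z).
have lpsi i c x y : psi i (iota c *: x + y) = c * psi i x + psi i y.
  by rewrite /psi scalerDr scalerA [_ * iota c]mulrC -[(iota c * _) *: x]scalerA trL.
have [m2 Hm2 m2N] := codim_annihilator N sZs lpsi.
set Zk := Zs `&` _ in Hm2.
have sZk : ksubspace iota Zk.
  apply: kspI => //; split=> [i _|c x y hx hy i ij]; first by rewrite /psi scaler0 tr0.
  by rewrite lpsi hx // hy // mulr0 addr0.
have csP c : c \in cs -> P c.
  by move=> cin; rewrite eP; apply: spanl_gen => //; exact: ksp_mul.
have ZkZ0 : Zk `<=` Z0.
  move=> z [[_ [h1 [_ [H1a H1b]] <-] [h2 [_ [H2a H2b]] ez]] hz] Q CQ.
  have [_ oQD oQZ] := sheaf_submodule omega CQ.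
  have [bQ0 PbQ ob1 ob2] := bP Q CQ.
  have ezz : z = h1 *: w1 + h2 *: w2 by rewrite ez addrC subrK.
  have [QT|QT] := pselect (Q = setT); first by rewrite QT generic_stalk.
  have [eQ|nQ] := pselect (Q = P); last first.
    have clQ : closed_points C Q by apply/closed_point.
    have -> : b Q *: z = h1 *: (b Q *: w1) + h2 *: (b Q *: w2).
      by rewrite ezz scalerDr !scalerA [h1 * _]mulrC [h2 * _]mulrC.
    by apply: oQD; [exact: (oQZ _ _ (H1a Q clQ nQ) ob1)|exact: (oQZ _ _ (H2a Q clQ nQ) ob2)].
  subst Q; apply: local_duality => // c Pc; rewrite scalerA mulrC.
  suff sub : P `<=` [set c : K | tr P ((b P * c) *: z) = 0] by exact: sub.
  rewrite [X in X `<=` _]eP; apply: (@spanl_min _ _ iota K^o).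
  - split; first by rewrite /= mulr0 scale0r tr0.
    move=> d x y /= hx hy; rewrite mulrDr scaleKE mulrCA scalerDl -[(iota d * _) *: z]scalerA trL // hx hy.
    by rewrite mulr0 addr0.
  - move=> _ [x Px <-] /=; apply: tr_omega => //.
    have -> : (b P * (r ^+ m * x)) *: z =
        (x * (r ^+ m * h1)) *: (b P *: w1) + (x * (r ^+ m * h2)) *: (b P *: w2).
      rewrite ezz scalerDr !scalerA; congr (_ *: _ + _ *: _); kf; ring.
    by apply: oQD; apply: oQZ => //; exact: subringM.
  - by move=> d /(nthP 0) [i ii <-]; apply: hz; rewrite -csz.
have [y [m2' [e2 Hy Hm2']]] := rdim_mid (ksp_0 iota W) sZk
  (fun x (h : x = 0) => eq_ind_r Zk (ksp0 sZk) h) (rdim_sub Hm2) HZs.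
rewrite (rdim_uniq sZk Hm2' Hm2) in e2.
have sZ0 := rdim_ksp (ksp_0 iota W) HZ.
have [y' [y'' [e3 Hy' _]]] := rdim_mid (ksp_0 iota W) sZk
  (fun x (h : x = 0) => eq_ind_r Zk (ksp0 sZk) h) ZkZ0 HZ.
rewrite (rdim_uniq (ksp_0 iota W) Hy' Hy) in e3.
have mN : (m <= N)%N by rewrite /N leq_pmulr.
by move: mN; rewrite /m; lia.
Qed.

End Dualizing.

(* The dualizing sheaf as a sheaf of fractional ideals [om], with the trace [trc]. *)
Record dual_data (k : closedFieldType) (C : curve k) := DualData {
  om : set (funfield C) -> set (funfield C);
  trc : set (funfield C) -> funfield C -> k;
  om_submodule : forall P, points C P -> @submodule (funfield C) (funfield C)^o P (om P);
  om_generic : om setT = setT;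
  om_triv : finite_set [set P | points C P /\ om P <> P];
  om_upper : forall P, points C P -> exists2 t, t != 0 & forall x, om P x -> P (t * x);
  om_lower : forall P, points C P -> exists2 s, s != 0 & om P s;
  trcL : forall P c x y, closed_points C P ->
    trc P (const C c * x + y) = c * trc P x + trc P y;
  trc_om : forall P x, closed_points C P -> om P x -> trc P x = 0;
  trc_sum : forall x, \sum_(P \in closed_points C) trc P x = 0;
  om_dual : forall P x, closed_points C P -> (forall r, P r -> trc P (r * x) = 0) -> om P x;
  om_rep : forall (F : tfsheaf ((funfield C)^o : vectType (funfield C)))
      (G : set (funfield C) -> set (funfield C)) (rho : set (funfield C) -> funfield C),
    (forall P, points C P -> @submodule (funfield C) (funfield C)^o P (G P)) ->
    (forall P, points C P -> F P `<=` G P) -> finsupp rho ->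
    ~ (exists h, forall P, closed_points C P -> G P (rho P - h)) ->
    exists w, (forall P x, points C P -> G P x -> om P (x * w)) /\
      \sum_(P \in closed_points C) trc P (rho P * w) != 0;
  trc_neq0 : forall x, x != 0 -> exists P u, closed_points C P /\ trc P (u * x) != 0;
  om_findim : findim (const C) ([set 0] : set (funfield C)^o) [set x | forall P, points C P -> om P x]
}.

Lemma dual_data_of (k : closedFieldType) (C : curve k) (W : vectType (funfield C))
    (omega : tfsheaf W) (w : W) : dualizing omega -> w != 0 ->
  exists (e : W) (D : dual_data C), e != 0 /\ forall P x, om D P x <-> omega P (x *: e).
Proof.
set K := funfield C => -[tr trH trU] w0.
have dim1 := dualizing_dim1 trH trU.
have [S1 [gS1 finS1]] := sheaf_generic omega.
have [e eS e0] : exists2 e, e \in S1 & e != 0.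
  apply: contrapT => no; move/eqP: w0; apply.
  have : gen_submod [set: K] [set` S1] w by rewrite gS1.
  move=> [m [a [x [_ Sx ->]]]]; apply: big1 => i _.
  suff -> : x i = 0 by rewrite scaler0.
  by apply/eqP; apply: contraT => x0; case: no; exists (x i) => //; exact: Sx.
have scI : injective ( *:%R^~ e) by move=> x y /eqP; rewrite -subr_eq0 -scalerBl scaler_eq0 (negPf e0) orbF subr_eq0 => /eqP.
pose om0 (P : set K) := [set x : K | omega P (x *: e)].
have CT := generic_point C.
have gT : gen_submod [set: K] [set` [:: e]] = [set: W].
  rewrite gen_submod1; last exact: point_sub CT.
  by rewrite -subTset => v _; have [x ->] := dim1 e v e0; exists x.
have sub P : points C P -> @submodule K K^o P (om0 P).
  move=> CP; have [o0 oD oZ] := sheaf_submodule omega CP; split.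
  - by rewrite /om0 /= scale0r.
  - by move=> x y ox oy; rewrite /om0 /= scalerDl; exact: oD.
  - by move=> a x Pa ox; rewrite /om0 /= scaleKE -scalerA; exact: oZ.
have gen : om0 setT = setT by rewrite -subTset => x _; rewrite /om0 /= generic_stalk.
have triv : finite_set [set P | points C P /\ om0 P <> P].
  apply: (@sub_finite_set _ _ ([set P | points C P /\ omega P <> gen_submod P [set` S1]] `|`
     [set P | points C P /\ ~ (forall x, x \in S1 -> gen_submod P [set` [:: e]] x)])); last first.
    by rewrite finite_setU; split=> //; exact: finite_unmember.
  move=> P [CP ne]; apply: contrapT => /not_orP [h1 h2]; apply: ne.
  have sP := point_sub CP.
  have eo : omega P = gen_submod P [set` S1] by apply: contrapT => h; apply: h1.
  have h2' : forall x, x \in S1 -> gen_submod P [set` [:: e]] x.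
    by apply: contrapT => h; apply: h2.
  rewrite eqEsubset; split=> x.
    rewrite /om0 /= eo => ox; have : gen_submod P [set` [:: e]] (x *: e).
      by move: ox; apply: gen_submod_min => //; exact: gen_submod_submodule.
    by rewrite gen_submod1 // => -[a Pa /scI <-].
  move=> Px; rewrite /om0 /= eo; have [_ _ gZ] := gen_submod_submodule [set` S1] sP.
  by apply: gZ => //; exact: gen_submod_mem.
have upper P : points C P -> exists2 t, t != 0 & forall x, om0 P x -> P (t * x).
  move=> CP; have [b [_ bP]] := sheaf_bounded omega; have [Pb b0 hb] := bP P CP.
  have [i ei] : exists i, v2r e 0 i != 0.
    apply: contrapT => no; move/eqP: e0; apply; apply: (can_inj v2rK); apply/rowP => i.
    by rewrite linear0 mxE; apply/eqP; apply: contraT => h; case: no; exists i.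
  exists (b P * v2r e 0 i); first by rewrite mulf_neq0.
  move=> x ox; have := hb _ i ox; rewrite linearZ mxE.
  by rewrite [x * _]mulrC mulrA.
have lower P : points C P -> exists2 s, s != 0 & om0 P s.
  by move=> CP; have [c [_ cP]] := sheaf_denominator omega e; have [c0 _ oc] := cP P CP; exists (c P).
have trc0L P c x y : closed_points C P ->
    tr P ((const C c * x + y) *: e) = c * tr P (x *: e) + tr P (y *: e).
  by move=> clP; rewrite scalerDl -scalerA (trL trH).
have dualP P x : closed_points C P -> (forall r, P r -> tr P ((r * x) *: e) = 0) -> om0 P x.
  move=> clP h; apply: (local_duality trH trU clP) => r Pr; rewrite scalerA; exact: h.
have rep (F : tfsheaf (K^o : vectType K)) (G : set K -> set K) (rho : set K -> K) :
    (forall P, points C P -> @submodule K K^o P (G P)) ->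
    (forall P, points C P -> F P `<=` G P) -> finsupp rho ->
    ~ (exists h, forall P, closed_points C P -> G P (rho P - h)) ->
    exists x, (forall P y, points C P -> G P y -> om0 P (y * x)) /\
      \sum_(P \in closed_points C) tr P ((rho P * x) *: e) != 0.
  move=> sG FG fr nr; have [v [hv nz]] := repartition_pairing trH trU sG FG fr nr.
  have [x ev] := dim1 e v e0; exists x; split.
    by move=> P y CP Fy; rewrite /om0 /= -scalerA -ev; exact: hv.
  by under eq_fsbigr do rewrite -scalerA -ev.
have nz x : x != 0 -> exists P u, closed_points C P /\ tr P ((u * x) *: e) != 0.
  move=> x0; apply: contrapT => no.
  have t0 P v : closed_points C P -> tr P v = 0.
    move=> clP; have [y ->] := dim1 e v e0; apply/eqP; apply: contraT => n0; case: no.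
    by exists P, (y / x); rewrite divfK.
  have [g [_ Ug]] := trU _ _ _ trH.
  have e1 : g = \1%VF.
    by apply: Ug; split=> [Q CQ v ov|Q clQ v]; rewrite id_lfunE.
  have e2 : g = 0%VF.
    apply: Ug; split=> [Q CQ v ov|Q clQ v]; rewrite zero_lfunE; last by rewrite !t0.
    by have [] := sheaf_submodule omega CQ.
  by move/eqP: e0; apply; rewrite -(id_lfunE e) -e1 e2 zero_lfunE.
have fin : findim (const C) ([set 0] : set K^o) [set x | forall P, points C P -> om0 P x].
  have fin1 : finite_set [set P | points C P /\ (1 : K) != 1].
    by apply: (@sub_finite_set _ _ set0); [move=> P [_]; rewrite eqxx|exact: finite_set0].
  have finV := findim_sections omega fin1 (fun _ _ => oner_neq0 _).
  have [n Hn] := finV.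
  have lf : klin (const C) (fun x : K^o => x *: e) by move=> c x y; rewrite scalerDl scaleKE scalerA.
  have sT : ksp (const C) [set: K^o] by [].
  have [m Hm _] := rdim_preim lf sT (ksp_0 (const C) W) Hn.
  exists m; move: Hm; rewrite !setTI.
  have -> : (fun x : K^o => x *: e) @^-1` [set 0] = [set 0].
    rewrite predeqE => x; split=> [/eqP|->]; last by rewrite /preimage /= scale0r.
    by rewrite scaler_eq0 (negPf e0) orbF => /eqP.
  suff -> : (fun x : K^o => x *: e) @^-1` [set v | forall P, points C P -> omega P (1 *: v)] =
      [set x | forall P, points C P -> om0 P x] by [].
  by rewrite predeqE => x; split=> h P CP; have := h P CP; rewrite scale1r.
have trom P x : closed_points C P -> om0 P x -> tr P (x *: e) = 0.
  by move=> clP ox; apply: (tr_omega trH).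
have trsum x : \sum_(P \in closed_points C) tr P (x *: e) = 0 by case: trH.
by exists e, (DualData sub gen triv upper lower trc0L trom trsum dualP rep nz fin).
Qed.

(** * Powers of the dualizing sheaf *)

Section CanonicalPowers.
Variables (k : closedFieldType) (C : curve k) (D : dual_data C).
Local Notation K := (funfield C).
Local Notation iota := (const C).
Local Notation om := (om D).
Local Notation trc := (trc D).
Implicit Types (P Q : set K) (x y z : K).
Local Notation ksp := (@ksp _ _ iota K^o).
Local Notation submod := (@submodule K K^o).
Let ksp0 := @ksp0 _ _ iota K^o.
Let spanl_min := @spanl_min _ _ iota K^o.

Lemma submodule_ksp P (N : set K) : points C P -> submod P N -> ksp N.
Proof.
move=> CP [N0 ND NZ]; split=> // c x y Nx Ny; apply: ND => //; apply: NZ => //.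
exact: ksubringC (point_ksub CP).
Qed.

Lemma submoduleM P (N : set K) a x : submod P N -> P a -> N x -> N (a * x).
Proof. by case=> _ _ NZ Pa Nx; exact: NZ. Qed.

Lemma submoduleN P (N : set K) x : points C P -> submod P N -> N x -> N (- x).
Proof.
move=> CP sN Nx; rewrite -mulN1r; apply: submoduleM sN _ Nx.
by apply: subringN (point_sub CP) _; exact: subring1 (point_sub CP).
Qed.

Lemma submoduleD P (N : set K) x y : submod P N -> N x -> N y -> N (x + y).
Proof. by case=> _ ND _; exact: ND. Qed.

Lemma om_ksp P : points C P -> ksp (om P).
Proof. by move=> CP; exact: submodule_ksp (om_submodule D CP). Qed.

Lemma trc0 P : closed_points C P -> trc P 0 = 0.
Proof. by move=> clP; have := trcL D (-1) 0 0 clP; rewrite mulr0 addr0 mulN1r addNr. Qed.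

Lemma trcZ P c x : closed_points C P -> trc P (iota c * x) = c * trc P x.
Proof. by move=> clP; have := trcL D c x 0 clP; rewrite addr0 trc0 // addr0. Qed.

Definition canonical_sections := [set x | forall P, points C P -> om P x].
Local Notation V := canonical_sections.

Lemma ksp_sections : ksp V.
Proof.
split=> [P CP|c x y hx hy P CP]; first exact: ksp0 (om_ksp CP).
by exact: (kspL c (om_ksp CP) (hx P CP) (hy P CP)).
Qed.

Lemma stab_sections v z : V v -> v != 0 -> (forall x, V x -> V (z * x)) -> range iota z.
Proof.
move=> Vv v0 zV; have [n Vn] := om_findim D.
by have [c ->] := stab_const Vn Vv v0 zV; exists c.
Qed.

Definition delta1 P x : set K -> K := fun Q => if Q == P then x else 0.

Lemma finsupp_delta1 P x : finsupp (delta1 P x).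
Proof.
apply: (@sub_finite_set _ _ [set P]); last exact: finite_set1.
by move=> Q /=; rewrite /delta1; have [->//|_] := eqVneq Q P; rewrite eqxx.
Qed.

Definition pairing (h : K) (rho : set K -> K) : k :=
  \sum_(P \in closed_points C) trc P (rho P * h).

Lemma pairingE s h rho : uniq s -> (forall P, P \in s -> closed_points C P) ->
    (forall P, closed_points C P -> rho P != 0 -> P \in s) ->
  pairing h rho = \sum_(P <- s) trc P (rho P * h).
Proof.
move=> us sC sB; apply: closed_sumE => // P clP nP.
have [->|r0] := eqVneq (rho P) 0; first by rewrite mul0r trc0.
by rewrite sB in nP.
Qed.

Lemma pairing_delta1 P x h : closed_points C P -> pairing h (delta1 P x) = trc P (x * h).
Proof.
move=> clP; rewrite (@pairingE [:: P]) //.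
- by rewrite big_seq1 /delta1 eqxx.
- by move=> Q; rewrite inE => /eqP ->.
- by move=> Q _; rewrite inE /delta1; have [|_] := eqVneq Q P; rewrite ?eqxx.
Qed.

Lemma pairingL h c h' rho : finsupp rho ->
  pairing (iota c * h + h') rho = c * pairing h rho + pairing h' rho.
Proof.
move=> /(finsupp_seq (C := C)) [s [us sC sB]]; rewrite !(@pairingE s) //.
rewrite mulr_sumr -big_split; apply: eq_big_seq => P Ps.
by rewrite mulrDr mulrCA trcL //; exact: sC.
Qed.

Lemma pairingR h c rho rho' : finsupp rho -> finsupp rho' ->
  pairing h (fun P => rho P - iota c * rho' P) = pairing h rho - c * pairing h rho'.
Proof.
move=> f1 f2; have f3 : finite_set ([set P | rho P != 0] `|` [set P | rho' P != 0]).
  by rewrite finite_setU.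
have [s [us sC sB]] := finsupp_seq (C := C) f3.
have h1 P : closed_points C P -> rho P != 0 -> P \in s by move=> clP r0; apply: sB => //; left.
have h2 P : closed_points C P -> rho' P != 0 -> P \in s by move=> clP r0; apply: sB => //; right.
have h3 P : closed_points C P -> rho P - iota c * rho' P != 0 -> P \in s.
  move=> clP r0; have [e1|] := eqVneq (rho P) 0; last exact: h1.
  by apply: h2 => //; apply: contra_neq r0 => ->; rewrite e1 mulr0 subr0.
rewrite (pairingE h us sC h1) (pairingE h us sC h2) (@pairingE s h (fun P => rho P - iota c * rho' P) us sC h3).
rewrite mulr_sumr -sumrB; apply: eq_big_seq => P Ps.
rewrite mulrBl -mulrA [rho P * h]lock.
have -> : locked (rho P * h) - iota c * (rho' P * h) = iota (- c) * (rho' P * h) + locked (rho P * h).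
  by rewrite rmorphN mulNr addrC.
by rewrite -lock trcL ?mulNr 1?addrC //; exact: sC.
Qed.

Lemma finsuppB c (rho rho' : set K -> K) : finsupp rho -> finsupp rho' ->
  finsupp (fun P => rho P - iota c * rho' P).
Proof.
move=> f1 f2; apply: (@sub_finite_set _ _ ([set P | rho P != 0] `|` [set P | rho' P != 0])).
  move=> P /= r0; have [e1|] := eqVneq (rho P) 0; last by left.
  by right; apply: contra_neq r0 => ->; rewrite e1 mulr0 subr0.
by rewrite finite_setU.
Qed.

Lemma finsuppM v (rho : set K -> K) : finsupp rho -> finsupp (fun P => rho P * v).
Proof.
apply: sub_finite_set => P /=; apply: contra_neq => ->; exact: mul0r.
Qed.

Lemma pairing_sep (gs : seq K^o) f0 : ~ spanl iota ([set 0] : set K^o) gs f0 ->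
  exists rho, [/\ finsupp rho, forall h, spanl iota ([set 0] : set K^o) gs h -> pairing h rho = 0
    & pairing f0 rho != 0].
Proof.
elim: gs f0 => [|g gs IH] f0 /= nf0.
  have f00 : f0 != 0 by apply/eqP.
  have [P [u [clP tn]]] := trc_neq0 D f00.
  exists (delta1 P u); split; first exact: finsupp_delta1.
    by move=> _ ->; rewrite pairing_delta1 // mulr0 trc0.
  by rewrite pairing_delta1.
set S := spanl iota _ gs in nf0 IH *.
have sS : ksp S by apply: ksp_spanl; exact: ksp_0.
have sub x : addl iota (S : set K^o) g x -> exists c, S (x - iota c * g) by [].
have [Sg|nSg] := pselect (S g).
  have [|rho [fr kr nz]] := IH f0; first by apply: contra_not nf0; exact: addl_sub.
  exists rho; split=> // h [c Sh]; rewrite -(subrK (iota c * g) h) addrC pairingL //.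
  by rewrite kr // mulr0 add0r kr.
have [r1 [fr1 kr1 nz1]] := IH g nSg.
pose c := pairing f0 r1 / pairing g r1.
have [|r2 [fr2 kr2 nz2]] := IH (f0 - iota c * g); first by apply: contra_not nf0 => h; exists c.
pose d := pairing g r2 / pairing g r1.
exists (fun P => r2 P - iota d * r1 P); split; first exact: finsuppB.
  move=> h [a Sh]; have {}Sh : S (h - iota a * g) := Sh.
  rewrite -(subrK (iota a * g) h) addrC pairingL; last exact: finsuppB.
  rewrite !pairingR // (kr1 _ Sh) (kr2 _ Sh) mulr0 subr0 addr0.
  by rewrite /d divfK // subrr mulr0.
rewrite pairingR //; move: nz2; congr (_ != 0).
have -> : f0 - iota c * g = iota (- c) * g + f0 by rewrite rmorphN mulNr addrC.
by rewrite pairingL // addrC mulNr; congr (_ - _); rewrite /c /d mulrAC [RHS]mulrAC [pairing f0 r1 * _]mulrC.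
Qed.

Lemma sections_basis : exists gs : seq K^o, V = spanl iota ([set 0] : set K^o) gs /\
  forall g, g \in gs -> V g.
Proof.
have [n /rdim_basis [gs [_ e]]] := om_findim D; exists gs; split; first exact: e.
by move=> g gin; rewrite /V e; apply: spanl_gen => //; exact: ksp_0.
Qed.

(* If [V] generated a proper subsheaf of [om], some functional on its first cohomology would
   not extend to [om]; by duality it is multiplication by some [w] with [w V <= V], so that
   [w] is constant and the functional is a multiple of the trace. *)
Lemma sections_generate v P N : V v -> v != 0 -> points C P -> submod P N -> V `<=` N -> om P `<=` N.
Proof.
move=> Vv v0 CP sN VN; have [gs [eV gV]] := sections_basis.
have gsP Q : points C Q -> V `<=` gen_submod (V := K^o) Q [set` gs].
  move=> CQ; rewrite eV; apply: spanl_min.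
  - exact: submodule_ksp CQ (gen_submod_submodule _ (point_sub CQ)).
  - by move=> _ ->; case: (gen_submod_submodule (V := K^o) [set` gs] (point_sub CQ)).
  - by move=> g gin; apply: gen_submod_mem => //; exact: point_sub.
have gsom Q : points C Q -> gen_submod (V := K^o) Q [set` gs] `<=` om Q.
  move=> CQ; apply: gen_submod_min; first exact: om_submodule.
  by move=> g /= /gV Vg; exact: Vg.
have CT := generic_point C.
have gT : gen_submod (V := K^o) [set: K] [set` gs] = [set: K^o].
  rewrite -subTset => x _; have [_ _ gZ] := gen_submod_submodule (V := K^o) [set` gs] (point_sub CT).
  have := gZ (x / v) v I (gsP _ CT v Vv).
  by rewrite scaleKE divfK.
have [F FE] : exists F : tfsheaf (K^o : vectType K), forall Q, F Q = gen_submod (V := K^o) Q [set` gs].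
  apply: (tfsheaf_of (S1 := gs)) => //.
    by apply: (@sub_finite_set _ _ set0); [move=> Q [_]|exact: finite_set0].
  by move=> Q CQ; exists gs.
suff : om P `<=` F P.
  move=> h x /h; rewrite FE; apply: gen_submod_min => // g /= /gV; exact: VN.
move=> u ou; apply: contrapT => nFu.
have PT : P <> setT by move=> e; apply: nFu; rewrite FE e gT.
have clP : closed_points C P by apply/closed_point.
have sF Q : points C Q -> submod Q (F Q).
  by move=> CQ; rewrite FE; apply: gen_submod_submodule; exact: point_sub.
have [|w [hw nz]] := om_rep D sF (fun Q _ => @subset_refl _ (F Q)) (finsupp_delta1 P u).
  move=> [h hP]; apply: nFu.
  have hP' := hP P clP; rewrite /delta1 eqxx in hP'.
  suff Vh : V h.
    rewrite -(subrK h u); apply: submoduleD (sF P CP) hP' _.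
    by rewrite FE; exact: gsP.
  move=> Q CQ; have [->|QT] := pselect (Q = setT); first by rewrite om_generic.
  have clQ : closed_points C Q by apply/closed_point.
  have := hP Q clQ; rewrite /delta1; case: eqVneq => [->|_].
    rewrite FE => /(gsom P CP) oh; rewrite -(subKr u h).
    by apply: kspB (om_ksp CP) ou _.
  rewrite sub0r FE => /(gsom Q CQ) /(submoduleN CQ (om_submodule D CQ)).
  by rewrite opprK.
have [c _ ec] : range iota w.
  apply: (stab_sections Vv v0) => x Vx Q CQ; rewrite mulrC; apply: hw => //.
  by rewrite FE; exact: gsP.
move/negP: nz; apply; apply/eqP.
have := pairing_delta1 u w clP; rewrite /pairing => ->.
by rewrite -ec mulrC trcZ // (trc_om clP ou) mulr0.
Qed.

Definition colon n P := [set t : K | forall w : 'I_n -> K, (forall i, om P (w i)) ->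
  om P (t * \prod_i w i)].

Definition bidual n P := [set f : K | forall t, colon n P t -> om P (t * f)].

Fixpoint powS (A : set K) n : set K := if n is m.+1 then
  [set z | forall B : set K, ksp B -> (forall x y, A x -> powS A m y -> B (x * y)) -> B z]
  else range iota.

Lemma ksp_powS A n : ksp (powS A n).
Proof.
case: n => [|n].
  split; first by exists 0; rewrite ?rmorph0.
  by move=> c _ _ [a _ <-] [b _ <-]; exists (c * a + b) => //; rewrite rmorphD rmorphM.
split=> [B sB _|c x y hx hy B sB hB]; first exact: ksp0.
exact: (kspL c sB (hx B sB hB) (hy B sB hB)).
Qed.

Lemma powSM A n x y : A x -> powS A n y -> powS A n.+1 (x * y).
Proof. by move=> Ax Ay B _; apply. Qed.

Lemma powS1 A x : A x -> powS A 1 x.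
Proof.
by move=> Ax; rewrite -[x]mulr1; apply: powSM => //; exists 1; rewrite ?rmorph1.
Qed.

Lemma powS_prod A n (w : 'I_n -> K) : (forall i, A (w i)) -> powS A n (\prod_i w i).
Proof.
elim: n w => [|n IH] w Aw; first by rewrite big_ord0; exists 1; rewrite ?rmorph1.
by rewrite big_ord_recl; apply: powSM => //; exact: IH.
Qed.

Lemma powS_spanl (gs : seq K^o) n : exists hs : seq K^o,
  powS (spanl iota ([set 0] : set K^o) gs) n = spanl iota ([set 0] : set K^o) hs.
Proof.
have k0 := ksp_0 iota K^o.
elim: n => [|n [hs e]].
  exists [:: 1]; rewrite predeqE => x /=; split=> [[c _ <-]|[c /eqP]].
    by exists c; rewrite /= scaleKE mulr1 subrr.
  by rewrite scaleKE mulr1 subr_eq0 => /eqP ->; exists c.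
pose ps : seq K^o := [seq x * y | x <- gs, y <- hs].
exists ps; rewrite eqEsubset; split.
  move=> z; apply; first exact: ksp_spanl.
  move=> x y gx hy; have {hy} : spanl iota ([set 0] : set K^o) hs y by rewrite -e.
  move: y.
  suff sub : spanl iota ([set 0] : set K^o) hs `<=` *%R x @^-1` spanl iota ([set 0] : set K^o) ps by exact: sub.
  apply: spanl_min; first by apply: ksp_mul_preim; exact: ksp_spanl.
    by move=> _ ->; rewrite /preimage /= mulr0; apply: ksp0; exact: ksp_spanl.
  move=> y yh; move: x gx.
  suff sub : spanl iota ([set 0] : set K^o) gs `<=` *%R y @^-1` spanl iota ([set 0] : set K^o) ps.
    by move=> x /sub; rewrite /preimage /= mulrC.
  apply: spanl_min; first by apply: ksp_mul_preim; exact: ksp_spanl.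
    by move=> _ ->; rewrite /preimage /= mulr0; apply: ksp0; exact: ksp_spanl.
  move=> x xg; apply: spanl_gen => //.
  by apply/allpairsP; exists (x, y); split=> //=; rewrite mulrC.
apply: spanl_min; first exact: ksp_powS.
  by move=> _ ->; apply: ksp0; exact: ksp_powS.
move=> _ /allpairsP [[x y] [/= xg yh ->]]; apply: powSM; first exact: spanl_gen.
suff : spanl iota ([set 0] : set K^o) hs y by rewrite -e.
exact: spanl_gen.
Qed.

Lemma colon_submodule n P : points C P -> submod P (colon n P).
Proof.
move=> CP; have so := om_submodule D CP; split.
- by move=> w _; rewrite mul0r; case: so.
- by move=> x y hx hy w ow; rewrite mulrDl; apply: submoduleD so _ _; [exact: hx|exact: hy].
- by move=> a x Pa hx w ow; rewrite scaleKE -mulrA; apply: submoduleM so Pa _; exact: hx.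
Qed.

Lemma colon_mul m P v t : colon m.+1 P t -> om P v -> colon m P (v * t).
Proof.
move=> ht ov w ow; pose w' (i : 'I_m.+1) := if unlift ord0 i is Some j then w j else v.
have := ht w'; rewrite big_ord_recl /w' unlift_none.
rewrite (eq_bigr w) => [|i _]; last by rewrite liftK.
rewrite mulrA [t * v]mulrC; apply=> i.
by case: unliftP => [j|] _; [exact: ow|].
Qed.

Lemma colon_neq0 n P : points C P -> exists2 t, t != 0 & colon n P t.
Proof.
move=> CP; have [t t0 tP] := om_upper D CP; have [s s0 os] := om_lower D CP.
exists (s * t ^+ n); first by rewrite mulf_neq0 ?expf_neq0.
move=> w ow; rewrite -mulrA mulrC; apply: submoduleM (om_submodule D CP) _ os.
rewrite -[in t ^+ n](card_ord n) -prodr_const -big_split /=.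
elim/big_ind: _ => [|x y|i _]; [exact: subring1 (point_sub CP)|exact: subringM (point_sub CP)|exact: tP].
Qed.

Lemma colon_invertible n : exists F : tfsheaf (K^o : vectType K),
  forall P, points C P -> F P `<=` colon n P.
Proof.
have /choice [b bP] : forall P, exists b, points C P -> [/\ b != 0, colon n P b & om P = P -> b = 1].
  move=> P; have [CP|nCP] := pselect (points C P); last by exists 0.
  have [oP|nP] := pselect (om P = P); last first.
    by have [t t0 ht] := colon_neq0 n CP; exists t.
  exists 1 => _; rewrite oner_neq0; split=> // w ow; rewrite mul1r oP.
  have sP := point_sub CP.
  elim/big_ind: _ => [|x y|i _]; [exact: subring1|exact: subringM|by rewrite -oP; exact: ow].
have finb : finite_set [set P | points C P /\ b P != 1].
  apply: sub_finite_set (om_triv D) => P [CP b1]; split=> // oP.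
  by have [_ _ /(_ oP) e] := bP P CP; rewrite e eqxx in b1.
have [|F FE] := invertible_sheaf finb; first by move=> P CP; have [] := bP P CP.
exists F => P CP; rewrite FE // => _ [a Pa <-]; rewrite mulrC.
by apply: submoduleM (colon_submodule n CP) Pa _; have [] := bP P CP.
Qed.

(* The dual of the first cohomology of [colon n] is the space of sections of [bidual n]. *)
Lemma colon_repartition n rho : finsupp rho ->
    (forall w, (forall P, points C P -> bidual n P w) -> pairing w rho = 0) ->
  exists h, forall P, closed_points C P -> colon n P (rho P - h).
Proof.
move=> fr h0; apply: contrapT => nh; have [F Fcolon] := colon_invertible n.
have [w [hw nz]] := om_rep D (fun P => @colon_submodule n P) Fcolon fr nh.
by move/eqP: nz; apply; apply: h0 => P CP t ct; exact: hw.
Qed.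

Lemma bidual1 f : (forall P, points C P -> bidual 1 P f) -> V f.
Proof.
move=> hf P CP; rewrite -[f]mul1r; apply: hf => // w ow.
by rewrite big_ord1 mul1r; exact: ow.
Qed.
End CanonicalPowers.

Section Determinants.
Variables (k : closedFieldType) (K : fieldType) (iota : {rmorphism k -> K}).
Add Field Kfield9 : (@kfield_theory K).
Local Notation kspp := (@ksubspace _ _ iota (K^o * K^o)%type).
Local Notation dim := (@rdim _ _ iota K^o [set 0]).
Local Notation is_progression := (is_progression iota).
Implicit Types (V : set K) (U : set (K^o * K^o)%type) (s u : (K^o * K^o)%type) (x y z : K).

Let kppD := @kspD _ _ iota (K^o * K^o)%type.
Let kppB := @kspB _ _ iota (K^o * K^o)%type.
Let kppZ := @kspZ _ _ iota (K^o * K^o)%type.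

Definition det2 s u : K := s.1 * u.2 - u.1 * s.2.

Lemma klin_det2 s : @klin _ _ iota (K^o * K^o)%type K^o (det2 s).
Proof. by move=> c [x1 x2] [y1 y2]; rewrite /det2 /=; kfold K; ring. Qed.

Lemma det2_parallel s u : s != 0 -> det2 s u = 0 -> exists a : K, u = a *: s.
Proof.
case: s u => [s1 s2] [u1 u2] s0 /eqP; rewrite /det2 /= subr_eq0 => /eqP e.
have [s10|s10] := eqVneq s1 0.
  have s20 : s2 != 0 by apply: contra_neq s0 => ->; rewrite s10.
  exists (u2 / s2); congr (_, _); rewrite /= ?scaleKE ?divfK // s10 mulr0.
  by move/eqP: e; rewrite s10 mul0r eq_sym mulf_eq0 (negPf s20) orbF => /eqP.
exists (u1 / s1); congr (_, _); rewrite /= !scaleKE ?divfK //.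
by rewrite mulrAC -e mulrAC divff // mul1r.
Qed.

Lemma det2Zl a s u : det2 (a *: s) u = a * det2 s u.
Proof. by case: s u => [s1 s2] [u1 u2]; rewrite /det2 /=; kfold K; ring. Qed.

Lemma det2C s u : det2 s u = - det2 u s.
Proof. by rewrite /det2 opprB. Qed.

Lemma det2_combl s t u (a b : K) : det2 (a *: s + b *: t) u = a * det2 s u + b * det2 t u.
Proof. by case: s t u => [s1 s2] [t1 t2] [u1 u2]; rewrite /det2 /=; kfold K; ring. Qed.

Lemma det2_comb s t u (a b c d : K) :
  det2 (a *: s + b *: t) (u + (c *: s + d *: t)) =
  (a * det2 s u + b * det2 t u) + (a * d - b * c) * det2 s t.
Proof. by case: s t u => [s1 s2] [t1 t2] [u1 u2]; rewrite /det2 /=; kfold K; ring. Qed.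

Lemma det2_zero V U s : (forall v, V v -> exists f, U (v, f)) -> U s -> s.1 != 0 ->
    (forall u, U u -> det2 s u = 0) ->
  exists y, forall v, V v -> U (v, v * y).
Proof.
move=> UV Us s10 dU; exists (s.2 / s.1) => v Vv; have [f Uf] := UV v Vv.
have /eqP := dU _ Uf; rewrite /det2 /= subr_eq0 => /eqP e.
by rewrite mulrA -e mulrAC divff // mul1r.
Qed.

Lemma dim_ex (V B : set K) n m : dim V n -> dim B m -> (m < n)%N -> exists2 v, V v & ~ B v.
Proof.
move=> Vn Bm mn; apply: contrapT => no; move: mn; rewrite ltnNge; apply/negP/negPn.
by apply: dim_le Vn Bm _ => v Vv; apply: contrapT => nv; apply: no; exists v.
Qed.

Lemma det2_const V U g : dim V g.+3 -> kspp U ->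
    (forall v, V v -> exists f, U (v, f)) ->
    (forall s u, U s -> U u -> range iota (det2 s u)) ->
  exists y, forall v, V v -> U (v, v * y).
Proof.
move=> Vg sU UV dU; have [v0 Vv0 v00] := dim_neq0 Vg.
have d1 := dim_line iota v00; set A1 := addl _ _ _ in d1; have sA1 := dim_ksp d1.
have [//|v1 Vv1 nv1] := dim_ex Vg d1.
have [//|v2 Vv2 nv2] := dim_ex Vg (@rdimS _ _ iota K^o _ _ _ _ _ d1 nv1 erefl).
have [f0 U0] := UV _ Vv0; have [f1 U1] := UV _ Vv1; have [f2 U2] := UV _ Vv2.
have [c1 _ e1] := dU _ _ U0 U1; have [c2 _ e2] := dU _ _ U0 U2.
have [u [Uu du nu]] : exists u, [/\ U u, det2 (v0, f0) u = 0 & ~ A1 u.1].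
  have [c10|c10] := eqVneq c1 0; first by exists (v1, f1); rewrite -e1 c10 rmorph0.
  pose w1 : (K^o * K^o)%type := (v1, f1); pose w2 : (K^o * K^o)%type := (v2, f2).
  exists (iota (- c2) *: w1 + iota c1 *: w2); split.
  - by apply: (@kspL _ _ iota (K^o * K^o)%type) => //; exact: (@kspZ _ _ iota (K^o * K^o)%type).
  - rewrite klin_det2 (klinZ _ _ (klin_det2 _)) -e1 -e2 !scaleKE rmorphN.
    by rewrite mulNr addrC mulrC subrr.
  rewrite /= => h; apply: nv2; exists (c2 / c1).
  apply: (@kspZV _ _ iota K^o _ _ _ sA1 c10).
  move: h; congr (A1 _); rewrite !scaleKE mulrBr mulrA -rmorphM [c1 * _]mulrC divfK //.
  have -> : iota (- c2) = - iota c2 by exact: rmorphN.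
  by rewrite mulNr addrC.
have [x ex] : exists a : K, u = a *: ((v0, f0) : (K^o * K^o)%type).
  by apply: det2_parallel du; apply/eqP => -[v0E]; rewrite v0E eqxx in v00.
have nx : ~ range iota x.
  by move=> [c _ cx]; apply: nu; rewrite ex /= -cx scaleKE; apply/line_mem; exists c.
apply: (det2_zero UV U0) => // s Us.
have [c _ ec] := dU _ _ Uu Us; have [d _ ed] := dU _ _ U0 Us.
move: ec; rewrite ex det2Zl -ed => e; apply: contrapT => /eqP d0; apply: nx.
by exists (c / d) => //; rewrite fmorph_div e mulfK.
Qed.

Lemma det2_pencil V U g : dim V g.+3 -> ~ is_progression V g.+3 -> kspp U ->
    (forall s, U s -> V s.1) -> (forall v, V v -> exists f, U (v, f)) ->
    (forall f, U (0, f) <-> range iota f) ->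
    (forall s u, U s -> U u -> V (det2 s u)) ->
  exists y, forall v, V v -> U (v, v * y).
Proof.
move=> Vg nV sU U1 UV U0 dU; have sV := dim_ksp Vg.
have kfst : @klin _ _ iota (K^o * K^o)%type K^o fst by [].
have k00 : kspp [set 0] := ksp_0 _ _.
pose one2 : (K^o * K^o)%type := (0, 1).
have kerE : U `&` fst @^-1` [set 0] = addl iota [set 0] one2.
  rewrite predeqE => -[a b]; split=> [[Uab a0]|[c [/= e1 e2]]].
    rewrite /preimage /= in a0; rewrite a0 in Uab *; have [c _ <-] := (U0 b).1 Uab.
    by exists c; congr (_, _); rewrite /= scaleKE ?mulr0 ?mulr1 subrr.
  move: e1 e2; rewrite !scaleKE mulr0 mulr1 subr0 => -> /eqP; rewrite subr_eq0 => /eqP ->.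
  by split=> //; apply/U0; exists c.
have d1 : @rdim _ _ iota (K^o * K^o)%type [set 0] (addl iota [set 0] one2) 1.
  by apply: rdim1 => -[/eqP]; rewrite oner_eq0.
have dimU : @rdim _ _ iota (K^o * K^o)%type [set 0] U g.+4.
  have [m] := rdim_preim kfst sU (ksp_0 iota K^o) Vg.
  have -> : U `&` fst @^-1` V = U by apply/setIidPl => s /U1.
  rewrite kerE => h _; have Um := rdim_trans d1 h.
  have [p [q [e]]] := rank_nullity kfst k00 Um.
  have -> : fst @` U = V.
    by rewrite eqEsubset; split=> [_ [s /U1 Vs <-]|v /UV [f Uf]] //; exists (v, f).
  have -> : fst @` [set 0 : (K^o * K^o)%type] = [set 0].
    by rewrite eqEsubset; split=> [_ [s -> <-]|_ ->] //; exists 0.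
  have -> : [set 0] `&` [set x : (K^o * K^o)%type | x.1 = 0] = [set 0].
    by apply/setIidPl => s ->.
  have -> : U `&` [set x : (K^o * K^o)%type | x.1 = 0] = addl iota [set 0] one2 by [].
  move=> hp hq; rewrite (rdim_uniq k00 hq d1) -(rdim_uniq (ksp_0 iota K^o) Vg hp) addn1 in e.
  by rewrite -e.
have [[s1 [s2 [Us1 Us2 d0]]]|no] := pselect (exists s1 s2, [/\ U s1, U s2 & det2 s1 s2 != 0]); last first.
  have [v Vv v0] := dim_neq0 Vg; have [f Uf] := UV _ Vv.
  apply: (det2_zero UV Uf) => // u Uu; apply/eqP; apply: contrapT => /negP d0.
  by apply: no; exists (v, f), u.
pose d := det2 s1 s2.
have det11 s : det2 s s = 0 by rewrite /det2 subrr.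
have s10 : s1 != 0 by apply: contra_neq d0 => ->; rewrite /det2 /= mul0r mulr0 subrr.
have line2 (s u : (K^o * K^o)%type) : addl iota [set 0] s u -> exists c, u = iota c *: s.
  by move=> [c /eqP]; rewrite subr_eq0 => /eqP ->; exists c.
have ns2 : ~ addl iota [set 0] s1 s2.
  move=> /line2 [c e]; move: d0.
  by rewrite e (klinZ _ _ (klin_det2 _)) det11 scaleKE mulr0 eqxx.
pose A0 := addl iota (addl iota [set 0] s1) s2.
have rA0 : @rdim _ _ iota (K^o * K^o)%type [set 0] A0 2.
  by apply: rdimS (rdim1 _ _) ns2 erefl; apply/eqP.
have sA0 := rdim_ksp k00 rA0.
have A0s1 : A0 s1 by apply: addl_sub; exact: addl_mem.
have A0s2 : A0 s2 by apply: addl_mem; exact: ksp_addl.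
have A0U : A0 `<=` U.
  apply: addl_min => //; apply: addl_min => // _ ->; exact: (ksp0 sU).
have rAU : rdim iota A0 U g.+2.
  have [p [q [e hp hq]]] := rdim_mid k00 sA0 (rdim_sub rA0) A0U dimU.
  rewrite (rdim_uniq k00 hp rA0) in e.
  by have -> : g.+2 = q by lia.
have sd := ksp_addl (d : K^o) (ksp_0 iota K^o).
have dline := dim_line iota d0.
have rDV : @rdim _ _ iota K^o (addl iota [set 0] (d : K^o)) V g.+2.
  have [p [q [e hp hq]]] := dim_sub sd (addl_min sV (fun x (e : x = 0) => eq_ind_r V (ksp0 sV) e) (dU _ _ Us1 Us2)) Vg.
  rewrite (rdim_uniq (ksp_0 _ _) hp dline) in e.
  by have -> : g.+2 = q by lia.
have [s [u [Us Uu s0 [x nx ux]]]] : exists s u, [/\ U s, U u, s != 0 & exists2 x, ~ range iota x & u = x *: s].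
  have sdd : addl iota [set 0] (d : K^o) d by apply: addl_mem; exact: ksp_0.
  have A0P t : A0 t -> exists a b, t = iota a *: s1 + iota b *: s2.
    by move=> [b [a /eqP]]; rewrite subr_eq0 subr_eq addrC => /eqP ->; exists a, b; rewrite addrC.
  have [||||l [m [a [lm Ua na hd]]]] := pencil (klin_det2 s1) (klin_det2 s2) sA0 sd _ _ _ _ rAU rDV.
  - by move=> t Ut; exact: dU.
  - by move=> t Ut; exact: dU.
  - move=> _ /A0P [a [b ->]]; apply/line_mem; exists b.
    by rewrite klin_det2 (klinZ _ _ (klin_det2 _)) det11 scaler0 add0r.
  - move=> _ /A0P [a [b ->]]; apply/line_mem; exists (- a).
    rewrite klin_det2 (klinZ _ _ (klin_det2 _)) det11 scaler0 addr0 rmorphN mulNr -mulrN.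
    by rewrite -det2C.
  have [c ec] := (line_mem _ _ _).1 hd.
  have [al [be eab]] : exists al be, l * be - m * al = - c.
    have [l0|l0] := eqVneq l 0.
      exists (c / m), 0; rewrite mulr0 sub0r mulrC divfK //.
      by move: lm; rewrite l0 eqxx.
    by exists 0, (- c / l); rewrite mulr0 subr0 mulrC divfK.
  pose s := iota l *: s1 + iota m *: s2; pose t := iota al *: s1 + iota be *: s2.
  have A0c (b b' : k) : A0 (iota b *: s1 + iota b' *: s2).
    exact: kppD sA0 (kppZ b sA0 A0s1) (kppZ b' sA0 A0s2).
  have ds : det2 s (a + t) = 0.
    rewrite det2_comb -!rmorphM -rmorphB eab.
    have -> : iota l * det2 s1 a + iota m * det2 s2 a = iota c * d by exact: ec.
    by rewrite rmorphN mulNr subrr.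
  have s0 : s != 0.
    apply/eqP => e; have h u' : iota l * det2 s1 u' + iota m * det2 s2 u' = 0.
      by rewrite -det2_combl -/s e /det2 /= mul0r mulr0 subrr.
    move: lm (h s1) (h s2); rewrite !det11 !mulr0 add0r addr0 => /orP [x0|x0] /eqP e1 /eqP.
      by rewrite mulf_eq0 fmorph_eq0 (negPf x0) (negPf d0).
    move: e1; rewrite mulf_eq0 fmorph_eq0 (negPf x0) /= => /eqP e1; case/eqP: d0.
    by rewrite det2C e1 oppr0.
  have Us : U s by apply: A0U; exact: A0c.
  have Ua' : U (a + t) by apply: (kppD sU Ua); apply: A0U; exact: A0c.
  have [x ex] := det2_parallel s0 ds.
  exists s, (a + t); split=> //; exists x => // -[b _ eb]; apply: na.
  rewrite -(addrK t a) ex -eb; apply: (kppB sA0); last exact: A0c.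
  by apply: (kppZ b sA0); exact: A0c.
pose A := [set a : K | U (a *: s)].
pose B := [set det2 s u | u in U].
have AB a b : A a -> B b -> V (a * b).
  by move=> Aa [v Uv <-]; rewrite -det2Zl; exact: dU.
have [p [q [epq Bp Aq]]] : exists p q, [/\ g.+4 = (p + q)%N, dim B p & dim A q].
  have [phi [lphi phis]] : exists phi : (K^o * K^o)%type -> K^o,
      klin iota phi /\ forall a : K, phi (a *: s) = a.
    have [e|e] := eqVneq s.1 0.
      have e2 : s.2 != 0 by move: s0; case: (s) e => a b /= ->; apply: contra_neq => ->.
      exists (fun u => u.2 / s.2); split=> [c u1 u2|a] /=; last by rewrite scaleKE mulfK.
      by rewrite !scaleKE mulrDl -mulrA.
    exists (fun u => u.1 / s.1); split=> [c u1 u2|a] /=; last by rewrite scaleKE mulfK.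
    by rewrite !scaleKE mulrDl -mulrA.
  have [p [q [epq hp hq]]] := rank_nullity (klin_det2 s) k00 dimU.
  exists p, q; split=> //.
    by move: hp; rewrite image_set1 (klin0 (klin_det2 s)).
  have e0 : [set 0] `&` [set x | det2 s x = 0] = [set 0].
    by apply/setIidPl => _ ->; exact: (klin0 (klin_det2 s)).
  rewrite e0 in hq; have hq' : rdim iota (phi @` [set 0]) (phi @` (U `&` [set x | det2 s x = 0])) q.
    apply: rdim_im lphi k00 _ hq => u' [_ /= /(det2_parallel s0) [a ea]].
    by rewrite ea phis => ->; rewrite scale0r.
  move: hq'; rewrite image_set1 (klin0 lphi); congr (rdim _ _ _ _).
  rewrite eqEsubset; split=> [_ [u' [Uu' /= /(det2_parallel s0) [a ea]] <-]|a Ua].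
    by rewrite ea phis /A /= -ea.
  exists (a *: s); last by rewrite phis.
  by split=> //=; rewrite det2C det2Zl det11 mulr0 oppr0.
have q2 : (2 <= q)%N.
  have d1' := @dim_line _ _ iota (1 : K) (oner_neq0 K).
  have nx1 : ~ addl iota [set 0] (1 : K^o) x.
    by move=> /line_mem [c]; rewrite mulr1 => ec; apply: nx; exists c.
  have d2' := @rdimS _ _ iota K^o _ _ _ _ _ d1' nx1 erefl.
  have sA := dim_ksp Aq; apply: dim_le d2' Aq _.
  apply: (@addl_min _ _ iota K^o) => //; last by rewrite /A /= -ux.
  apply: (@addl_min _ _ iota K^o) => // [_ ->|]; first exact: (@ksp0 _ _ iota K^o _ sA).
  by rewrite /A /= scale1r.
case: p epq Bp => [|[|p]] epq Bp.
- have B0 u' : U u' -> exists a : K, u' = a *: s.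
    move=> Uu'; apply: det2_parallel s0 _.
    suff : [set 0] (det2 s u') by [].
    by rewrite -(rdim0E Bp); exists u'.
  have [a1 e1] := B0 _ Us1; have [a2 e2] := B0 _ Us2.
  by case/eqP: d0; rewrite e1 e2 /det2 /=; kfold K; ring.
- have eq : q = g.+3 by lia.
  rewrite eq in Aq; have [sg0|sg0] := eqVneq s.1 0.
    have [c _ ec] : range iota s.2 by apply/U0; rewrite -sg0 -surjective_pairing.
    have [d' _ ed] : range iota u.2.
      by apply/U0; move: Uu; rewrite [u]surjective_pairing ux /= sg0 scaler0.
    have c0 : iota c != 0.
      by rewrite ec; move: s0; case: (s) sg0 => a b /= ->; apply: contra_neq => ->.
    case: nx; exists (d' / c) => //; rewrite fmorph_div ed ux /= -ec scaleKE.
    by rewrite mulfK.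
  exists (s.2 / s.1) => v Vv.
  have eV : *%R s.1 @` A = V.
    apply: (dim_eq (dim_mul (sg0 : (s.1 : K) != 0) Aq) Vg) => _ [a Ua <-].
    by have := U1 _ Ua; rewrite /= scaleKE mulrC.
  move: Vv; rewrite -eV => -[a Ua <-].
  have -> : s.1 * a * (s.2 / s.1) = a * s.2 by rewrite mulrA mulrAC [s.1 * a / _]mulrAC divff ?mul1r.
  by rewrite [s.1 * a]mulrC; move: Ua; rewrite /A /=; case: (s).
case: q epq Aq q2 => [|[|q]] // epq Aq _.
have e : g.+3 = (q + p).+3 by lia.
by case: nV; rewrite e in Vg *; exact: vosper Aq Bp Vg AB.
Qed.
End Determinants.

Section CanonicalInduction.
Variables (k : closedFieldType) (C : curve k) (D : dual_data C).
Local Notation K := (funfield C).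
Local Notation iota := (const C).
Local Notation om := (om D).
Local Notation V := (canonical_sections D).
Local Notation colon := (colon D).
Local Notation bidual := (bidual D).
Local Notation pairing := (pairing D).
Add Field Kfield10 : (@kfield_theory K).
Local Ltac kf := kfold (funfield C).
Implicit Types (P Q : set K) (x y z : K) (eta : set K -> K).
Local Notation dim := (@rdim _ _ iota K^o [set 0]).
Let kspL := @kspL _ _ iota K^o.

Lemma colon_setT n t : colon n setT t.
Proof. by move=> w _; rewrite om_generic. Qed.

Lemma colon_global n t : (forall P, closed_points C P -> colon n P t) ->
  forall P, points C P -> colon n P t.
Proof.
move=> h P CP; have [->|PT] := pselect (P = setT); first exact: colon_setT.
by apply: h; apply/closed_point.
Qed.

Lemma colon0_sections t : (forall P, points C P -> colon 0 P t) -> V t.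
Proof.
move=> h P CP; have := h P CP (fun _ => 0); rewrite big_ord0 mulr1; apply.
by case.
Qed.

Lemma colon_sections m t (v : 'I_m -> K) : (forall P, points C P -> colon m P t) ->
  (forall i, V (v i)) -> V (t * \prod_i v i).
Proof. by move=> h Vv P CP; apply: h => // i; exact: Vv. Qed.

Lemma colon1_const v t : V v -> v != 0 -> (forall P, points C P -> colon 1 P t) -> range iota t.
Proof.
move=> Vv v0 h; apply: (stab_sections Vv v0) => x Vx.
by have := colon_sections h (fun _ => Vx); rewrite big_ord1.
Qed.

Lemma colonSS_eq0 g m t : dim V g.+3 -> (forall P, points C P -> colon m.+2 P t) -> t = 0.
Proof.
move=> Vg h; have [v Vv v0] := dim_neq0 Vg; apply/eqP; apply: contrapT => /negP t0.
pose t' := t * v ^+ m; have t'0 : t' != 0 by rewrite mulf_neq0 ?expf_neq0.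
suff AB x y : V x -> V y -> ( *%R t'^-1 @` V) (x * y).
  by have := hopf Vg Vg (dim_mul (invr_neq0 t'0) Vg) AB; rewrite ltnNge; lia.
move=> Vx Vy; exists (t' * (x * y)); last by rewrite mulKf.
pose w (i : 'I_m.+2) := if i == ord0 then x else if i == lift ord0 ord0 then y else v.
have := @colon_sections _ t w h.
have -> : \prod_i w i = x * (y * v ^+ m).
  rewrite !big_ord_recl /w /= -[in v ^+ m](card_ord m) -prodr_const; congr (_ * (_ * _)).
rewrite /t' => H; have -> : t * v ^+ m * (x * y) = t * (x * (y * v ^+ m)) by kf; ring.
apply: H => i; rewrite /w; case: ifP => // _; by case: ifP.
Qed.

(* The pairs [(v, f)] such that the repartition [eta v] is the principal one [f] modulo [colon n]. *)
Definition lifts n eta : set (K^o * K^o)%type :=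
  [set s | V s.1 /\ forall P, closed_points C P -> colon n P (eta P * s.1 - s.2)].

Lemma ksp_lifts n eta : @ksubspace _ _ iota (K^o * K^o)%type (lifts n eta).
Proof.
have sc P : closed_points C P -> @ksubspace _ _ iota K^o (colon n P).
  by move=> [CP _]; exact: submodule_ksp CP (colon_submodule D n CP).
split=> [|c [x1 x2] [y1 y2] [Vx hx] [Vy hy]].
  split=> [|P clP] /=; first by case: (ksp_sections D).
  by rewrite mulr0 subr0; case: (sc P clP).
split=> [|P clP] /=; first exact: kspL (ksp_sections D) Vx Vy.
have := kspL c (sc P clP) (hx P clP) (hy P clP); rewrite /=; congr (colon n P _).
by kf; ring.
Qed.

Lemma det2_lifts n eta s u : lifts n.+1 eta s -> lifts n.+1 eta u ->
  forall P, points C P -> colon n P (det2 s u).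
Proof.
move=> [Vs hs] [Vu hu]; apply: colon_global => P clP; have [CP _] := clP.
have -> : det2 s u = u.1 * (eta P * s.1 - s.2) - s.1 * (eta P * u.1 - u.2).
  by rewrite /det2; kf; ring.
apply: (@kspB _ _ iota K^o _ _ _ (submodule_ksp CP (colon_submodule D n CP))).
  by apply: colon_mul (Vu P CP); exact: hs.
by apply: colon_mul (Vs P CP); exact: hu.
Qed.

Lemma lifts_linear g n eta : dim V g.+3 -> ~ is_progression iota V g.+3 ->
    (forall v, V v -> exists f, lifts n.+1 eta (v, f)) ->
  exists y, forall v, V v -> lifts n.+1 eta (v, v * y).
Proof.
move=> Vg nV UV; have sU := ksp_lifts n.+1 eta; have [v Vv v0] := dim_neq0 Vg.
case: n UV sU => [|[|n]] UV sU.
- apply: (det2_pencil Vg nV) => // [s []//|f|s u Us Uu]; last first.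
    by apply: colon0_sections; exact: det2_lifts Us Uu.
  split=> [[/= _ h]|[c _ <-]].
    apply: (colon1_const Vv v0); apply: colon_global => P clP.
    have := h P clP; rewrite mulr0 sub0r => /(submoduleN (proj1 clP) (colon_submodule D 1 (proj1 clP))).
    by rewrite opprK.
  split=> [|P [CP _]] /=; first by case: (ksp_sections D).
  rewrite mulr0 sub0r => w ow; rewrite big_ord1 -rmorphN.
  by apply: submoduleM (om_submodule D CP) _ (ow _); exact: ksubringC (point_ksub CP).
- apply: (det2_const Vg) => // s u Us Uu.
  by apply: (colon1_const Vv v0); exact: det2_lifts Us Uu.
- have [f Uf] := UV _ Vv; apply: (det2_zero UV Uf) => // u Uu.
  by apply: (colonSS_eq0 Vg); exact: det2_lifts Uf Uu.
Qed.

Theorem canonical_powers g n f : dim V g.+3 -> ~ is_progression iota V g.+3 ->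
  (forall P, points C P -> bidual n.+1 P f) -> powS V n.+1 f.
Proof.
move=> Vg nV; have [gs [eV gV]] := sections_basis D; have [v0 Vv0 v00] := dim_neq0 Vg.
elim: n f => [|n IH] f0 hf0; first by apply: powS1; exact: bidual1.
have [hs ehs] := powS_spanl gs n.+2; rewrite -eV in ehs.
apply: contrapT => nf; rewrite ehs in nf.
have [eta [fe ke]] := pairing_sep D nf; rewrite -ehs in ke; move/eqP; apply.
have [y hy] : exists y, forall v, V v -> lifts n.+1 eta (v, v * y).
  apply: lifts_linear Vg nV _ => v Vv.
  have [|f hf] := @colon_repartition _ _ D n.+1 (fun P => eta P * v) (finsuppM v fe).
    move=> w /IH hw; rewrite -(ke _ (powSM Vv hw)) /pairing.
    by apply: eq_fsbigr => P _; rewrite mulrA.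
  by exists f.
have hom P : closed_points C P -> forall x, om P x -> colon n.+1 P (x * (eta P - y)).
  move=> clP; have [CP _] := clP.
  apply: (sections_generate Vv0 v00 CP) => [|v Vv].
    have [c0 cD cM] := colon_submodule D n.+1 CP; split=> [|a b ha hb|a b Pa hb] /=.
    - by rewrite mul0r.
    - by rewrite mulrDl; exact: cD.
    - by rewrite scaleKE -mulrA; exact: cM.
  have [_ /(_ P clP)] := hy v Vv; rewrite /=; congr (colon _ _ _).
  by kf; ring.
have hc P : closed_points C P -> colon n.+2 P (eta P - y).
  move=> clP w ow; rewrite big_ord_recl mulrCA mulrA.
  by apply: hom => // i; exact: ow.
rewrite -(trc_sum D (y * f0)) /pairing; apply: eq_fsbigr => P /set_mem clP.
have [CP _] := clP; have := trc_om clP (hf0 P CP _ (hc P clP)).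
rewrite mulrBl -mulN1r -[-1](rmorphN1 iota) addrC => h.
have := trcL D (-1) (y * f0) (eta P * f0) clP; rewrite h mulN1r => /esym/eqP.
by rewrite addrC subr_eq0 => /eqP.
Qed.
End CanonicalInduction.

(** * Curves with a function of low degree *)

Section Filtration.
Variables (k : closedFieldType) (C : curve k).
Local Notation K := (funfield C).
Local Notation iota := (const C).
Add Field Kfield11 : (@kfield_theory K).
Local Ltac kf := kfold (funfield C).
Implicit Types (P Q : set K) (z : K) (m : nat).
Local Notation peval := (peval iota).
Local Notation ksp := (@ksp _ _ iota K^o).
Local Notation dim := (@rdim _ _ iota K^o [set 0]).
Local Notation submod := (@submodule K K^o).
Variable x : K.

Definition filt P m := [set h : K | exists p : {poly K},
  [/\ (size p <= m.+1)%N, forall i, P p`_i & h = p.[x]]].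

Lemma filt_submodule P m : subring P -> submod P (filt P m).
Proof.
move=> sP; split.
- by exists 0; rewrite size_poly0 horner0; split=> // i; rewrite coef0; exact: subring0.
- move=> _ _ [p [sp Pp ->]] [q [sq Pq ->]]; exists (p + q); rewrite hornerD; split=> //.
    by rewrite (leq_trans (size_polyD _ _)) // geq_max sp.
  by move=> i; rewrite coefD; exact: subringD.
- move=> a _ Pa [p [sp Pp ->]]; exists (a *: p); rewrite hornerZ; split=> //.
    exact: leq_trans (size_scale_leq _ _) sp.
  by move=> i; rewrite coefZ; exact: subringM.
Qed.

Lemma filt_mono P m n : (m <= n)%N -> filt P m `<=` filt P n.
Proof. by move=> mn h [p [sp Pp ->]]; exists p; split=> //; exact: leq_trans sp _. Qed.

Lemma filt_sub P m : subring P -> P `<=` filt P m.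
Proof.
move=> sP a Pa; exists a%:P; rewrite hornerC; split=> //.
  by rewrite (leq_trans (size_polyC_leq1 _)).
by move=> i; rewrite coefC; case: ifP => // _; exact: subring0.
Qed.

Lemma filt0 P : filt P 0 `<=` P.
Proof.
move=> _ [p [sp Pp ->]]; rewrite (size1_polyC sp) hornerC; exact: Pp.
Qed.

Lemma filt_mulx P m h : subring P -> filt P m h -> filt P m.+1 (x * h).
Proof.
move=> sP [p [sp Pp ->]]; exists (p * 'X); rewrite hornerMX [x * _]mulrC; split=> //.
  by apply: leq_trans (size_polyMleq _ _) _; rewrite size_polyX addn2.
by move=> i; rewrite coefMX; case: ifP => // _; exact: subring0.
Qed.

Lemma filtS P m h : subring P -> filt P m.+1 h -> exists q c, [/\ filt P m q, P c & h = x * q + c].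
Proof.
move=> sP [p [sp Pp ->]]; elim/poly_ind: p sp Pp => [|p c _] sp Pp.
  exists 0, 0; rewrite horner0 mulr0 addr0; split; [|exact: subring0|by []].
  by case: (filt_submodule m sP).
exists p.[x], c; rewrite hornerMXaddC [x * _]mulrC; split=> //.
  exists p; split=> // [|i].
    move: sp; rewrite size_MXaddC; case: ifP => // /andP [/eqP -> _].
    by rewrite size_poly0.
  by have := Pp i.+1; rewrite coefD coefMX coefC addr0.
by have := Pp 0%N; rewrite coefD coefMX coefC add0r.
Qed.

Lemma filt_split P m a h : ksubring iota P -> filt P m h ->
  exists c l, [/\ P c, filt P m.-1 l & h = c + (x - iota a) * l].
Proof.
move=> kP; have sP := kP.1; elim: m h => [|m IH] h fh.
  exists h, 0; rewrite mulr0 addr0; split=> //; first exact: filt0.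
  by case: (filt_submodule 0 sP).
have [q [c [fq Pc ->]]] := filtS sP fh; have [c' [l [Pc' fl e]]] := IH q fq.
exists (iota a * c' + c), (q + iota a * l); split=> /=.
- by apply: subringD => //; apply: subringM => //; exact: ksubringC.
- have [_ fD fM] := filt_submodule m sP; apply: fD => //; apply: fM; first exact: ksubringC.
  by apply: filt_mono fl; exact: leq_pred.
by rewrite e; kf; ring.
Qed.

Lemma filt_adjoin P h : adjoin P x h -> exists m, filt P m h.
Proof. by move=> [p [Pp ->]]; exists (size p), p; split. Qed.

Lemma filt_peval P (p : {poly k}) : ksubring iota P -> filt P (size p) (peval p x).
Proof.
move=> kP; exists (map_poly iota p); split=> //; last by move=> i; rewrite coef_map; exact: ksubringC.
by rewrite size_map_poly.
Qed.

Lemma filt_mulX P m i h : subring P -> filt P m h -> filt P (i + m) (x ^+ i * h).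
Proof.
by move=> sP fh; elim: i => [|i IH]; rewrite ?mul1r // exprS -mulrA; exact: filt_mulx.
Qed.

Definition global_filt m := [set h : K | forall P, points C P -> filt P m h].
Local Notation G := global_filt.

Lemma ksp_global_filt m : ksp (G m).
Proof.
split=> [P CP|c u v hu hv P CP]; first by case: (filt_submodule m (point_sub CP)).
exact: (@kspL _ _ iota K^o) (submodule_ksp CP (filt_submodule m (point_sub CP))) (hu P CP) (hv P CP).
Qed.

Lemma global_filt0 : dim (G 0) 1.
Proof.
suff -> : G 0 = addl iota [set 0] (1 : K^o) by apply: dim_line; exact: oner_neq0.
rewrite predeqE => h; rewrite (line_mem iota (1 : K) h); split=> [hG|[c ->] P CP].
  have [c _ <-] : range iota h by apply: global_const => P CP; apply: filt0; exact: hG.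
  by exists c; rewrite mulr1.
by rewrite mulr1; apply: filt_sub (point_sub CP) _ _; exact: ksubringC (point_ksub CP).
Qed.

Lemma global_filtM m a h : G m h -> G m.+1 ((x - iota a) * h).
Proof.
move=> hG P CP; have sP := point_sub CP; rewrite mulrBl.
apply: (@kspB _ _ iota K^o _ _ _ (submodule_ksp CP (filt_submodule m.+1 sP))).
  by apply: filt_mulx => //; exact: hG.
apply: (@kspZ _ _ iota K^o _ _ _ (submodule_ksp CP (filt_submodule m.+1 sP))).
by apply: (filt_mono (leqnSn m)); exact: hG.
Qed.

(* If every [d+1] elements of [K] were independent over [k(x)] the multiples [x^i z_j] would
   exceed the given bound on the dimension of [G m]. *)
Lemma dependent_of_growth d c0 : ~ range iota x ->
    (forall m, exists2 n, dim (G m) n & (n <= d * m + c0)%N) ->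
  forall z : nat -> K, exists q : nat -> {poly k}, (exists2 j, (j <= d)%N & q j != 0) /\
    \sum_(j < d.+1) peval (q j) x * z j = 0.
Proof.
move=> nx growth z.
have clear_pole y : exists p N, p != 0 /\ G N (peval p x * y).
  have [l [ul lC lP]] := finsupp_seq (C := C) (finite_poles y).
  suff [p [N [p0 hp]]] : exists p N, p != 0 /\ forall P, P \in l -> filt P N (peval p x * y).
    exists p, (maxn N (size p)); split=> // P CP.
    have [->|PT] := pselect (P = setT).
      by apply: filt_sub => //; exact: point_sub (generic_point C).
    have clP : closed_points C P by apply/closed_point.
    have [Pl|nPl] := boolP (P \in l).
      by apply: filt_mono (hp P Pl); exact: leq_maxl.
    have Py : P y by apply: contrapT => nPy; rewrite lP in nPl.
    apply: (filt_mono (leq_maxr _ _)); rewrite mulrC.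
    by have [_ _ fM] := filt_submodule (size p) (point_sub CP); apply: fM => //; exact: filt_peval (point_ksub CP).
  elim: l {ul lP} lC => [|Q l IH] lC.
    by exists 1, 0%N; rewrite oner_neq0.
  have [|p [N [p0 hp]]] := IH; first by move=> P Pl; apply: lC; rewrite inE Pl orbT.
  have clQ : closed_points C Q by apply: lC; rewrite inE eqxx.
  have [CQ _] := clQ; have [dn [d0 Qd Qdy]] := point_denominator y CQ.
  have [r r0 hr] := dep_multiple x (dim1P C) d0.
  have kA := ksubring_adjoin x (point_ksub CQ).
  have [||h Ah eh] := hr _ kA.
  - exact: adjoin_sub (point_sub CQ) _ Qd.
  - exact: adjoin_gen (point_sub CQ).
  have Ary : adjoin Q x (peval (r * p) x * y).
    have -> : peval (r * p) x * y = peval p x * (h * (dn * y)).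
      by rewrite pevalM eh; kf; ring.
    apply: (subringM kA.1); first by apply: ksubring_peval => //; exact: adjoin_gen (point_sub CQ).
    by apply: (subringM kA.1) => //; exact: adjoin_sub (point_sub CQ) _ Qdy.
  have [N' hN'] := filt_adjoin Ary.
  exists (r * p), (maxn N' (size r + N)); split; first by rewrite mulf_neq0.
  move=> P; rewrite inE => /orP [/eqP ->|Pl]; first by apply: filt_mono hN'; exact: leq_maxl.
  apply: (filt_mono (leq_maxr _ _)); have [CP _] : closed_points C P by apply: lC; rewrite inE Pl orbT.
  have kP := point_ksub CP; rewrite pevalM -mulrA pevalE mulr_suml.
  have sF := submodule_ksp CP (filt_submodule (size r + N) kP.1).
  apply: (@ksp_sum _ _ iota K^o _ _ _ _ _ sF) => i _; rewrite -mulrA.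
  apply: (@kspZ _ _ iota K^o _ _ _ sF); apply: filt_mono (filt_mulX i kP.1 (hp P Pl)).
  by rewrite leq_add2r ltnW.
have [p [N [p0 hp]]] : exists p N, p != 0 /\ forall j, (j < d.+1)%N -> G N (peval p x * z j).
  elim: d.+1 => [|n [p [N [p0 hp]]]]; first by exists 1, 0%N; rewrite oner_neq0.
  have [r [N' [r0 hr]]] := clear_pole (z n).
  have mulG (q : {poly k}) M y : G M y -> G (size q + M) (peval q x * y).
    move=> hy P CP; have kP := point_ksub CP; rewrite pevalE mulr_suml.
    have sF := submodule_ksp CP (filt_submodule (size q + M) kP.1).
    apply: (@ksp_sum _ _ iota K^o _ _ _ _ _ sF) => i _; rewrite -mulrA.
    apply: (@kspZ _ _ iota K^o _ _ _ sF); apply: filt_mono (filt_mulX i kP.1 (hy P CP)).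
    by rewrite leq_add2r ltnW.
  exists (r * p), (maxn (size p + N') (size r + N)); split; first by rewrite mulf_neq0.
  move=> j; rewrite ltnS leq_eqVlt pevalM => /orP [/eqP ->|jn] P CP.
    apply: (filt_mono (leq_maxl _ _)); rewrite -mulrA mulrCA; exact: mulG.
  apply: (filt_mono (leq_maxr _ _)); rewrite -mulrA; apply: mulG CP => //; exact: hp.
pose M := (d * N + c0)%N.
pose e i : K^o := x ^+ (i %/ d.+1) * (peval p x * z (i %% d.+1)%N).
have [n Gn nle] := growth (M + N)%N.
have Ge i : (i <= n)%N -> G (M + N) (e i).
  move=> ile P CP; have lt := ltn_pmod i (isT : (0 < d.+1)%N).
  apply: filt_mono (filt_mulX (i %/ d.+1) (point_sub CP) (hp _ lt P CP)).
  rewrite leq_add2r -ltnS ltn_divLR // (leq_ltn_trans ile) // (leq_ltn_trans nle) // /M.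
  by nia.
have [r [r0 sr /= er]] := rdim_dep (ksp_0 iota K^o) Gn Ge.
pose q j := \poly_(l < M.+1) r`_(l * d.+1 + j).
have srM : (size r <= M.+1 * d.+1)%N.
  by rewrite (leq_trans sr) // (leq_ltn_trans nle) // /M; nia.
exists q; split.
  have sr0 : (0 < size r)%N by rewrite size_poly_gt0.
  pose i := (size r).-1; exists (i %% d.+1)%N; first by rewrite -ltnS ltn_pmod.
  have : r`_i != 0 by rewrite -/(lead_coef r) lead_coef_eq0.
  apply: contra_neq => q0; have := congr1 (fun s : {poly k} => s`_(i %/ d.+1)) q0.
  rewrite coef0 coef_poly -divn_eq ltn_divLR //.
  by rewrite (leq_trans _ srM) // /i prednK.
have p0x : peval p x != 0 by apply/eqP => /(peval_eq0 p0) [c ec]; apply: nx; exists c.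
apply: (mulfI p0x); rewrite mulr0; transitivity (lc iota r e) => //.
rewrite (@lcE _ _ _ _ _ _ e srM) mulr_sumr.
rewrite -(big_mkord xpredT (fun i => iota r`_i *: e i)) big_nat_mul.
rewrite (eq_bigr (fun j : 'I_d.+1 => \sum_(l < M.+1) iota r`_(l * d.+1 + j) * (x ^+ l * (peval p x * z j)))).
  rewrite exchange_big /= big_mkord; apply: eq_bigr => l _.
  rewrite mulSn -[X in index_iota X _]add0n big_addn addnK big_mkord; apply: eq_bigr => j _.
  rewrite /e scaleKE [(j + _)%N]addnC divnMDl // modnMDl divn_small // modn_small // addn0.
  by [].
move=> j _; have sq : (size (q j) <= M.+1)%N by exact: size_poly.
rewrite (peval_wide iota _ sq) mulr_suml mulr_sumr; apply: eq_bigr => l _.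
by rewrite coef_poly ltn_ord mulrCA -!mulrA.
Qed.

Local Notation X := (set K -> K^o).
Local Notation rdimX := (@rdim _ _ iota X).
Implicit Types nu : X.

Definition integral_reps : set X :=
  [set nu | finsupp nu /\ forall P, closed_points C P -> P (nu P)].

Definition divisible_reps a : set X := integral_reps `&`
  [set nu | forall P, closed_points C P -> ( *%R (x - iota a) @` P) (nu P)].

Definition reps_codim e := forall a, exists2 m, rdimX (divisible_reps a) integral_reps m & (m <= e)%N.

Lemma ksp_integral_reps : @ksubspace _ _ iota X integral_reps.
Proof.
split=> [|c u v [fu Pu] [fv Pv]].
  split=> [|P [CP _]]; last exact: subring0 (point_sub CP).
  by apply: (@sub_finite_set _ _ set0); [move=> P /=; rewrite eqxx|exact: finite_set0].
split=> [|P clP]; last by have [CP _] := clP; exact: (@kspL _ _ iota K^o) (point_ksp CP) (Pu P clP) (Pv P clP).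
have := finsuppB (-1) fv (finsuppB (- c) (finsuppB 1 fu fu) fu).
by rewrite /finsupp; congr (finite_set _); rewrite predeqE => P /=; rewrite !rmorphN rmorph1 !mulN1r !mul1r subrr sub0r mulNr opprK opprK addrC.
Qed.

Lemma ksp_divisible_reps a : @ksubspace _ _ iota X (divisible_reps a).
Proof.
apply: kspI; first exact: ksp_integral_reps.
have sP P : closed_points C P -> ksp ( *%R (x - iota a) @` P).
  by move=> [CP _]; apply: ksp_mul; exact: point_ksp.
split=> [P clP|c u v hu hv P clP]; first exact: (@ksp0 _ _ iota K^o _ (sP P clP)).
exact: (@kspL _ _ iota K^o) (sP P clP) (hu P clP) (hv P clP).
Qed.

Lemma klin_eval P : @klin _ _ iota X K^o (fun nu => nu P). Proof. by []. Qed.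

Lemma global_filt_split a m h : ~ range iota x -> G m.+1 h -> exists2 nu, integral_reps nu &
  forall P, closed_points C P -> ( *%R (x - iota a) @` filt P m) (h - nu P).
Proof.
move=> nx Gh; have xa0 : x - iota a != 0.
  by apply/eqP => /eqP; rewrite subr_eq0 => /eqP e; apply: nx; exists a.
have /choice [nu nuP] : forall P, exists c, closed_points C P ->
    [/\ P c, ( *%R (x - iota a) @` filt P m) (h - c) & P h -> P (x - iota a)^-1 -> c = 0].
  move=> P; have [clP|nclP] := pselect (closed_points C P); last by exists 0.
  have [CP _] := clP; have [[Ph Pxa]|nP] := pselect (P h /\ P (x - iota a)^-1).
    exists 0 => _; split=> //; first exact: subring0 (point_sub CP).
    exists (h / (x - iota a)); last by rewrite subr0 mulrC divfK.
    by apply: filt_sub (point_sub CP) _ _; exact: subringM (point_sub CP) _ _.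
  have [c [l [Pc fl e]]] := filt_split a (point_ksub CP) (Gh P CP).
  exists c => _; split=> // [|Ph Pxa]; last by case: nP.
  by exists l => //; rewrite e [c + _]addrC addrK.
exists (fun P => if P \in closed_points C then nu P else 0).
  split=> [|P clP]; last by rewrite mem_set //; have [] := nuP P clP.
  apply: (@sub_finite_set _ _ ([set P | points C P /\ ~ P h] `|` [set P | points C P /\ ~ P (x - iota a)^-1])).
    move=> P /=; case: ifPn => [/set_mem clP|]; last by rewrite eqxx.
    have [_ _ nu0] := nuP P clP; have [CP _] := clP => /eqP n0.
    have [Ph|] := pselect (P h); last by left.
    by right; split=> // Pxa; exact/n0/nu0.
  by rewrite finite_setU; split; exact: finite_poles.
by move=> P clP; rewrite mem_set //; have [] := nuP P clP.
Qed.

Lemma growth_step a m n : ~ range iota x ->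
    (forall nu : nat -> X, (forall i, (i <= n)%N -> integral_reps (nu i)) ->
      exists p : {poly k}, [/\ p != 0, (size p <= n.+1)%N &
        forall P, closed_points C P -> ( *%R (x - iota a) @` filt P m) (lc iota p nu P)]) ->
  exists2 j, @rdim _ _ iota K^o ( *%R (x - iota a) @` G m) (G m.+1) j & (j <= n)%N.
Proof.
move=> nx dep; have sxa P : points C P -> ksp ( *%R (x - iota a) @` filt P m).
  by move=> CP; apply: ksp_mul; exact: submodule_ksp CP (filt_submodule m (point_sub CP)).
have xa0 : x - iota a != 0.
  by apply/eqP => /eqP; rewrite subr_eq0 => /eqP e; apply: nx; exists a.
apply: rdim_of_dep => [|||e Ge]; first by apply: ksp_mul; exact: ksp_global_filt.
- exact: ksp_global_filt.
- by move=> _ [h Gh <-]; exact: global_filtM.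
have /choice [nu nuP] : forall i, exists nu, (i <= n)%N -> integral_reps nu /\
    forall P, closed_points C P -> ( *%R (x - iota a) @` filt P m) (e i - nu P).
  move=> i; have [ile|_] := boolP (i <= n)%N; last by exists 0.
  by have [nu Nnu hnu] := global_filt_split a nx (Ge i ile); exists nu.
have [i /nuP [] //|p [p0 sp hp]] := dep nu.
exists p; split=> //; exists (lc iota p e / (x - iota a)); last by rewrite mulrC divfK.
move=> P CP; have [->|PT] := pselect (P = setT).
  by apply: filt_sub => //; exact: point_sub (generic_point C).
have clP : closed_points C P by apply/closed_point.
have : ( *%R (x - iota a) @` filt P m) (lc iota p e).
  rewrite -(subrK (lc iota p nu P) (lc iota p e)).
  apply: (@kspD _ _ iota K^o _ _ _ (sxa P CP)); last exact: hp.
  rewrite (klin_lc p nu (klin_eval P)) -lc_sub; apply: (@lc_mem _ _ iota K^o _ _ _ (sxa P CP)) => i ip.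
  by have [|_ /(_ P clP)] := nuP i; first by rewrite -ltnS (leq_trans ip).
by case=> l fl <-; rewrite mulrC mulKf.
Qed.

Lemma growth_from d N1 n1 : ~ range iota x -> dim (G N1) n1 ->
    (forall m, (N1 <= m)%N -> exists a, exists2 j,
       @rdim _ _ iota K^o ( *%R (x - iota a) @` G m) (G m.+1) j & (j <= d)%N) ->
  forall m, exists2 n, dim (G m) n & (n <= d * m + n1)%N.
Proof.
move=> nx GN step; have mono m : (m <= N1)%N -> exists2 n, dim (G m) n & (n <= d * m + n1)%N.
  move=> mN; have sub : G m `<=` G N1 by move=> h Gh P CP; exact: filt_mono mN _ (Gh P CP).
  have [p [q [e Gp _]]] := dim_sub (ksp_global_filt m) sub GN.
  by exists p => //; rewrite e; lia.
elim=> [|m [n Gn nle]]; first by apply: mono.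
have [lem|] := leqP m.+1 N1; first exact: mono.
rewrite ltnS => /step [a [j rj jd]].
have xa0 : x - iota a != 0.
  by apply/eqP => /eqP; rewrite subr_eq0 => /eqP e; apply: nx; exists a.
exists (n + j)%N; last by rewrite mulnS; lia.
exact: (@rdim_trans _ _ iota K^o) (dim_mul xa0 Gn) rj.
Qed.

Lemma dependent_of_codim e : ~ range iota x -> reps_codim e ->
  forall z : nat -> K, exists q : nat -> {poly k}, (exists2 j, (j <= e)%N & q j != 0) /\
    \sum_(j < e.+1) peval (q j) x * z j = 0.
Proof.
move=> nx ce; apply: (dependent_of_growth nx (c0 := 1)).
apply: (growth_from nx global_filt0) => m _; exists 0.
apply: growth_step => // nu Nnu; have [j rj je] := ce 0.
have [|p [p0 sp [_ hp]]] := rdim_dep (ksp_divisible_reps 0) rj (e := nu).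
  by move=> i ij; apply: Nnu; exact: leq_trans ij je.
exists p; split=> // [|P clP]; first exact: leq_trans sp _.
have [l Pl <-] := hp P clP; exists l => //; apply: filt_sub => //.
by have [CP _] := clP; exact: point_sub.
Qed.

(* All but finitely many [a] will do, the residue ring of [P0[x]] being a proper quotient of [k[x]]. *)
Lemma irregular_point P0 : closed_points C P0 -> ~ P0 x -> exists a N1 l1,
  filt P0 N1 l1 /\ (x - iota a) * l1 = 1.
Proof.
move=> clP nPx; have [CP _] := clP; have kP := point_ksub CP; have sP := kP.1.
have kA := ksubring_adjoin x kP; have sA := kA.1; have Ax := adjoin_gen x sP.
have PA := @adjoin_sub _ P0 x sP.
have [s ms s0] := closed_neq0 clP; have [Ps _] := ms.
have [p p0 hp] := dep_multiple x (dim1P C) s0.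
have [h Ah eh] := hp _ kA (PA _ Ps) Ax.
have /closed_nonrootP [a na] := p0.
have xa0 : x - iota a != 0.
  apply/eqP => /eqP; rewrite subr_eq0 => /eqP e; apply: nPx; rewrite e.
  exact: ksubringC kP.
have [q q0 hq] := dep_multiple s (dim1P C) xa0.
have Axa : adjoin P0 x (x - iota a) by apply: subringB => //; exact: ksubringC kA.
have [h' Ah' eh'] := hq _ kA Axa (PA _ Ps).
have [i [q1 [eq q10]]] := poly_val q0.
have [_ _ u] := punit_peval CP ms q10.
have sE : s ^+ i = (x - iota a) * (h' * (peval q1 s)^-1).
  have u0 : peval q1 s != 0 by have [] := punit_peval CP ms q10.
  by apply: (mulIf u0); rewrite -!mulrA mulVf // mulr1 -eh' eq pevalM pevalXn.
have pE : exists2 h2, adjoin P0 x h2 & peval p x ^+ i = (x - iota a) * h2.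
  exists (h' * (peval q1 s)^-1 * h ^+ i); last by rewrite eh exprMn sE !mulrA.
  by apply: subringM => //; [apply: subringM => //; exact: PA|exact: subringX].
have [h2 Ah2 eh2] := pE.
pose r := (p ^+ i - (p.[a] ^+ i)%:P).
have /factor_theorem [r' er] : root r a.
  by rewrite /root /r !hornerE subrr.
have pa0 : iota (p.[a] ^+ i) != 0.
  by rewrite fmorph_eq0 expf_neq0 //; move: na; rewrite /root.
have e1 : peval p x ^+ i = iota (p.[a] ^+ i) + peval r' x * (x - iota a).
  have := congr1 (fun t => peval t x) er.
  rewrite /= pevalM pevalB pevalB pevalC pevalX pevalC => <-.
  by rewrite addrC subrK -!evkE rmorphXn.
have [|N1 fN] := @filt_adjoin P0 ((h2 - peval r' x) / iota (p.[a] ^+ i)).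
  apply: subringM => //; last by rewrite -fmorphV; exact: ksubringC kA.
  by apply: subringB => //; exact: ksubring_peval.
exists a, N1, ((h2 - peval r' x) / iota (p.[a] ^+ i)); split=> //.
by rewrite mulrA mulrBr -eh2 e1 [_ * peval r' x]mulrC addrK divff.
Qed.

(* Where neither [x] nor [1/x] is regular, [x - a] is a unit of [P0[x]] but [P0] is not contained
   in [(x - a) P0]: this gains one dimension in the growth of [G]. *)
Lemma dependent_of_irregular e P0 : ~ range iota x -> reps_codim e.+1 ->
    closed_points C P0 -> ~ P0 x -> ~ P0 x^-1 ->
  forall z : nat -> K, exists q : nat -> {poly k}, (exists2 j, (j <= e)%N & q j != 0) /\
    \sum_(j < e.+1) peval (q j) x * z j = 0.
Proof.
move=> nx ce clP nPx nPV; have [CP _] := clP; have kP := point_ksub CP.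
have [a [N1 [l1 [fl el]]]] := irregular_point clP nPx.
have n1 l : P0 l -> (x - iota a) * l <> 1.
  move=> Pl el1; have l0 : l != 0.
    by apply/eqP => e0; move/eqP: el1; rewrite e0 mulr0 eq_sym oner_eq0.
  have el2 : x = iota a + l^-1 by rewrite -[l^-1]mul1r -el1 mulfK // addrC subrK.
  have [ml|[_ _ Pl']] := pmax_or_unit CP Pl; last first.
    by apply: nPx; rewrite el2; apply: subringD => //; [exact: kP.1|exact: ksubringC].
  apply: nPV; have [u0 _ Pu] := punitD CP (punit_const CP (oner_neq0 k)) (pmaxM CP (ksubringC a kP) ml).
  have -> : x^-1 = l * (iota 1 + iota a * l)^-1.
    by rewrite el2 rmorph1 -[X in X^-1 = _](mulfK l0) mulrDl mulVf // invfM invrK [iota a * l + 1]addrC mulrC.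
  by apply: subringM => //; exact: kP.1.
have [n Gn _] : exists2 n, dim (G N1) n & (n <= e.+1 * N1 + 1)%N.
  apply: (growth_from nx global_filt0) => m _; exists 0.
  apply: growth_step => // nu Nnu; have [j rj je] := ce 0.
  have [|p [p0 sp [_ hp]]] := rdim_dep (ksp_divisible_reps 0) rj (e := nu).
    by move=> i ij; apply: Nnu; exact: leq_trans ij je.
  exists p; split=> // [|P clP']; first exact: leq_trans sp _.
  have [l Pl <-] := hp P clP'; exists l => //; apply: filt_sub => //.
  by have [CP' _] := clP'; exact: point_sub.
apply: (dependent_of_growth nx); apply: (growth_from nx Gn) => m Nm; exists a.
apply: growth_step => // nu Nnu; have [j rj je] := ce a.
pose nu' i : X := if i is i'.+1 then nu i' else delta1 P0 1.
have [|p] := rdim_dep (ksp_divisible_reps a) rj (e := nu').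
  move=> [|i] ij; last by apply: Nnu; have := leq_trans ij je.
  split=> [|P clP' /=]; first exact: finsupp_delta1.
  have [CP' _] := clP'; rewrite /delta1; case: ifP => _; first exact: subring1 (point_sub CP').
  exact: subring0 (point_sub CP').
elim/poly_ind: p => [|r c _]; first by case=> /eqP.
move=> [p0 sp [_ hp]].
have lcE' P : lc iota (r * 'X + c%:P) nu' P = lc iota r nu P + iota c * delta1 P0 1 P.
  have e0 : lc iota c%:P nu' = iota c *: nu' 0%N.
    by rewrite -[c%:P]alg_polyC lcZ -(expr0 'X) lcXn.
  have e1 : lc iota r nu = lc iota (r * 'X + c%:P) nu' - iota c *: nu' 0%N.
    by rewrite -e0 -lcB addrK mulrC lcXM.
  have -> : lc iota r nu P = lc iota (r * 'X + c%:P) nu' P - iota c * delta1 P0 1 P.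
    exact: (congr1 (fun f : X => f P) e1).
  by rewrite subrK.
have r0 : r != 0.
  apply/eqP => r0; have c0 : c != 0 by apply: contra_neq p0 => ->; rewrite r0 mul0r add0r.
  have [l Pl el'] := hp P0 clP; apply: (n1 (l / iota c)).
    by apply: subringM => //; [exact: kP.1|rewrite -fmorphV; exact: ksubringC].
  rewrite mulrA el' lcE' r0 /delta1 eqxx /lc size_poly0 big_ord0 add0r mulr1 divff //.
  by rewrite fmorph_eq0.
exists r; split=> // [|P clP'].
  move: (leq_trans sp (je : (j < e.+2)%N)); rewrite size_MXaddC (negPf r0) /= ltnS; exact.
have [CP' _] := clP'.
have -> : lc iota r nu P = lc iota (r * 'X + c%:P) nu' P - iota c * delta1 P0 1 P by rewrite lcE' addrK.
have sF : ksp ( *%R (x - iota a) @` filt P m).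
  by apply: ksp_mul; exact: submodule_ksp CP' (filt_submodule m (point_sub CP')).
apply: (@kspB _ _ iota K^o _ _ _ sF).
  by have [l Pl <-] := hp P clP'; exists l => //; apply: filt_sub => //; exact: point_sub.
apply: (@kspZ _ _ iota K^o _ _ _ sF); rewrite /delta1; case: eqVneq => [->|_].
  by exists l1 => //; exact: filt_mono Nm _ fl.
exact: (@ksp0 _ _ iota K^o _ sF).
Qed.
End Filtration.

Lemma rdim_le1 (k : closedFieldType) (K : fieldType) (iota : {rmorphism k -> K}) (X : lmodType K)
    (A B : set X) (R : X -> k -> Prop) : ksp iota A -> ksp iota B -> A `<=` B ->
    (forall u, B u -> exists a, R u a) ->
    (forall c u v a b, B u -> B v -> R u a -> R v b -> R (iota c *: u + v) (c * a + b)) ->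
    (forall u, B u -> R u 0 -> A u) ->
  exists2 m, rdim iota A B m & (m <= 1)%N.
Proof.
move=> sA sB AB tot lin R0; have [[u [Bu nAu]]|no] := pselect (exists u, B u /\ ~ A u); last first.
  exists 0%N => //; suff -> : B = A by exact: rdim0.
  by rewrite eqEsubset; split=> // u Bu; apply: contrapT => nu; apply: no; exists u.
exists 1%N => //; suff -> : B = addl iota A u by exact: rdim1.
have [a Ra] := tot u Bu; have a0 : a != 0 by apply/eqP => a0; apply: nAu; apply: R0 => //; rewrite -a0.
rewrite eqEsubset; split=> [w Bw|]; last by apply: addl_min.
have [b Rb] := tot w Bw; exists (b / a).
have e : w - iota (b / a) *: u = iota (- (b / a)) *: u + w by rewrite rmorphN scaleNr addrC.
rewrite e; apply: R0; first by apply: kspL.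
by have := lin (- (b / a)) _ _ _ _ Bu Bw Ra Rb; rewrite mulNr divfK // addNr.
Qed.

Section Progressions.
Variables (k : closedFieldType) (C : curve k) (D : dual_data C).
Local Notation K := (funfield C).
Local Notation iota := (const C).
Local Notation om := (om D).
Local Notation V := (canonical_sections D).
Local Notation pairing := (pairing D).
Add Field Kfield12 : (@kfield_theory K).
Local Ltac kf := kfold (funfield C).
Implicit Types (P Q : set K) (x y z c h : K) (m : nat).
Local Notation peval := (peval iota).
Local Notation X := (set K -> K^o).
Implicit Types nu : X.

Lemma structure_repartition rho : finsupp rho -> (forall w, V w -> pairing w rho = 0) ->
  exists h, forall P, closed_points C P -> P (rho P - h).
Proof.
move=> fr h0; apply: contrapT => nh; have [F FE] := structure_sheaf C.
have [|P CP|w [hw nz]] := om_rep D (F := F) (G := id) _ _ fr nh.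
- move=> P CP; have sP := point_sub CP; split; [exact: subring0|move=> u v; exact: (@subringD K P)|move=> u v; exact: (@subringM K P)].
- by rewrite FE.
move/eqP: nz; apply; apply: h0 => P CP.
by have := hw P 1 CP (subring1 (point_sub CP)); rewrite mul1r.
Qed.

Lemma divisible_codim1 x a (N1 : set X) : ~ range iota x ->
    (forall h, global_filt x 1 h -> exists b d, h = iota b + iota d * (x - iota a)) ->
    ksp iota N1 -> divisible_reps x a `<=` N1 -> N1 `<=` integral_reps (C := C) ->
    (forall nu, N1 nu -> exists h, forall P, closed_points C P -> P (nu P / (x - iota a) - h)) ->
  exists2 m, rdim iota (divisible_reps x a) N1 m & (m <= 1)%N.
Proof.
move=> nx G1 sN1 sub1 sub2 hN1; have xa0 : x - iota a != 0.
  by apply/eqP => /eqP; rewrite subr_eq0 => /eqP e; apply: nx; exists a.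
pose R (nu : X) b := exists h d, (forall P, closed_points C P -> P (nu P / (x - iota a) - h)) /\
  (x - iota a) * h = iota b + iota d * (x - iota a).
apply: (@rdim_le1 _ _ iota X _ _ R) => //; first exact: ksp_divisible_reps.
- move=> nu N1nu; have [h hh] := hN1 nu N1nu.
  have [|b [d e]] := G1 ((x - iota a) * h); last by exists b, h, d.
  move=> P CP; have sP := point_sub CP; have [->|PT] := pselect (P = setT).
    by apply: filt_sub => //; exact: point_sub (generic_point C).
  have clP : closed_points C P by apply/closed_point.
  have sF := submodule_ksp CP (filt_submodule x 1 sP).
  have -> : (x - iota a) * h = nu P - (x - iota a) * (nu P / (x - iota a) - h).
    have e0 : (x - iota a) * (nu P / (x - iota a)) = nu P by rewrite mulrC divfK.
    by rewrite mulrBr e0 subKr.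
  apply: (@kspB _ _ iota K^o _ _ _ sF).
    by apply: filt_sub => //; have [_] := sub2 _ N1nu; exact.
  rewrite mulrBl; apply: (@kspB _ _ iota K^o _ _ _ sF).
    by apply: filt_mulx => //; apply: filt_sub => //; exact: hh.
  apply: (@kspZ _ _ iota K^o _ _ _ sF); apply: filt_sub => //; exact: hh.
- move=> c u v b b' _ _ [h [d [hP e]]] [h' [d' [hP' e']]].
  exists (iota c * h + h'), (c * d + d'); split=> [P clP|].
    have [CP _] := clP.
    have := (@kspL _ _ iota K^o) _ c _ _ (point_ksp CP) (hP P clP) (hP' P clP).
    congr (P _); rewrite -[(iota c *: u + v) P]/(iota c * u P + v P) scaleKE.
    by rewrite mulrDl mulrBr opprD addrACA mulrA.
  rewrite mulrDr mulrCA e e' !rmorphD !rmorphM; kf; ring.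
move=> nu N1nu [h [d [hP]]]; rewrite rmorph0 add0r mulrC => /(mulIf xa0) eh.
have [fnu _] := sub2 _ N1nu; split; first exact: sub2.
move=> P clP; have [CP _] := clP.
exists (nu P / (x - iota a)); last by rewrite mulrC divfK.
rewrite -(subrK h (nu P / _)); apply: subringD; [exact: point_sub|exact: hP|].
by rewrite eh; exact: ksubringC (point_ksub CP).
Qed.

Definition rational_in x z := exists n d : {poly k}, d != 0 /\ z * peval d x = peval n x.

Lemma filtM x P m n u v : subring P -> filt x P m u -> filt x P n v -> filt x P (m + n) (u * v).
Proof.
move=> sP [p [sp Pp ->]] [q [sq Pq ->]]; exists (p * q); rewrite hornerM; split=> //.
  by apply: leq_trans (size_polyMleq _ _) _; rewrite -subn1 leq_subLR add1n -addnS -addSn leq_add.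
by move=> i; rewrite coefM; apply: subring_sum => // j _; exact: subringM.
Qed.

(* Where the denominator of [h] vanishes, resp. at infinity, some valuation ring of [K] has a
   centre on the curve and would contain the inverse of an element of its maximal ideal. *)
Lemma rational_filt x m h : ~ range iota x -> rational_in x h -> global_filt x m h ->
  exists2 p : {poly k}, (size p <= m.+1)%N & h = peval p x.
Proof.
move=> nx [n [d [d0 hd]]] Gh.
have kA y : ksubring iota [set peval p y | p in [set: {poly k}]].
  split; last by move=> _ [c _ <-]; exists c%:P => //; exact: pevalC.
  apply/subringP; split; first by exists 1 => //; rewrite -polyC1 pevalC rmorph1.
    by move=> _ _ [p _ <-] [q _ <-]; exists (p - q) => //; exact: pevalB.
  by move=> _ _ [p _ <-] [q _ <-]; exists (p * q) => //; exact: pevalM.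
have idA y (r : {poly k}) : ideal_in [set peval p y | p in [set: {poly k}]] [set peval (r * p) y | p in [set: {poly k}]].
  split.
  - by move=> _ [p _ <-]; exists (r * p).
  - by exists 0; rewrite ?mulr0 ?peval0.
  - by move=> _ _ [p _ <-] [q _ <-]; exists (p + q) => //; rewrite mulrDr pevalD.
  - move=> _ _ [p _ <-] [q _ <-]; exists (p * q) => //.
    by rewrite mulrCA [LHS]pevalM.
have nonunit y (r : {poly k}) : ~ range iota y -> (1 < size r)%N -> ~ [set peval (r * p) y | p in [set: {poly k}]] 1.
  move=> ny r1 [p _ /eqP]; rewrite -subr_eq0 -[1](rmorph1 iota) -(pevalC iota 1 y) -pevalB => /eqP /(peval_inj ny) /eqP.
  rewrite subr_eq0 => /eqP e; have [p0|p0] := eqVneq p 0.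
    by move/eqP: e; rewrite p0 mulr0 eq_sym polyC_eq0 oner_eq0.
  have r0 : r != 0 by rewrite -size_poly_gt0 ltnW.
  have : size (r * p) = 1%N by rewrite e size_polyC oner_neq0.
  rewrite size_mul // => e1; have p1 : (0 < size p)%N by rewrite size_poly_gt0.
  by move: r1 p1 e1; case: (size r) => [|[|a]] //; case: (size p) => // b _ _; rewrite addSn addnS.
have extend y (r : {poly k}) : ~ range iota y -> (1 < size r)%N -> exists V, [/\ valuation_ring iota V, V y,
    ~ V (peval r y)^-1 & exists2 P, points C P & P `<=` V].
  move=> ny r1; have [V [vV AV IV]] := valuation_extension (kA y) (idA y r) (nonunit y r ny r1).
  have [P [CP PV _]] := center vV; exists V; split=> //; last by exists P.
    by apply: AV; exists 'X => //; exact: pevalX.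
  apply: IV; first by exists 1 => //; rewrite mulr1.
  apply/eqP => r0; have rn0 : r != 0 by rewrite -size_poly_gt0 ltnW.
  by move: rn0; rewrite (peval_inj ny r0) eqxx.
have vsub V : valuation_ring iota V -> ksubring iota V by case.
have [p ep] : exists p : {poly k}, h = peval p x.
  pose e := gcdp n d; have e0 : e != 0 by rewrite gcdp_eq0 negb_and d0 orbT.
  pose n1 := n %/ e; pose d1 := d %/ e.
  have en : n = n1 * e by rewrite divpK // dvdp_gcdl.
  have ed : d = d1 * e by rewrite divpK // dvdp_gcdr.
  have hd1 : h * peval d1 x = peval n1 x.
    have e0x : peval e x != 0 by apply/eqP => /(peval_inj nx) e1; rewrite e1 eqxx in e0.
    by apply: (mulIf e0x); rewrite -mulrA -!pevalM -ed -en.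
  have d10 : d1 != 0 by apply: contra_neq d0 => z; rewrite ed z mul0r.
  have cop : coprimep n1 d1 by rewrite coprimep_div_gcd // d0 orbT.
  have [s1|] := leqP (size d1) 1.
    have [c c0 ec] : exists2 c, c != 0 & d1 = c%:P.
      by exists d1`_0; [|exact: size1_polyC]; move: d10; rewrite {1}(size1_polyC s1) polyC_eq0.
    exists (c^-1 *: n1); rewrite pevalZ -hd1 ec pevalC fmorphV mulrCA mulVf ?mulr1 //.
    by rewrite fmorph_eq0.
  move=> /(extend x d1 nx) [V [/vsub kV Vx nV [P CP PV]]].
  have /Bezout_eq1_coprimepP [[u v] /= euv] := cop.
  have Vh : V h.
    have [q [_ Pq ->]] := Gh P CP; rewrite horner_coef; apply: subring_sum => [|i _]; first exact: kV.1.
    by apply: subringM; [exact: kV.1|exact/PV/Pq|apply: subringX => //; exact: kV.1].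
  case: nV; have d1x : peval d1 x != 0 by apply/eqP => /(peval_inj nx) z; rewrite z eqxx in d10.
  have -> : (peval d1 x)^-1 = peval u x * h + peval v x.
    apply: (mulIf d1x); rewrite mulVf // mulrDl -mulrA hd1 -!pevalM -pevalD euv.
    by rewrite -polyC1 pevalC rmorph1.
  by apply: subringD; [exact: kV.1|apply: subringM => //; [exact: kV.1|]|]; exact: ksubring_peval.
exists p => //; rewrite leqNgt; apply/negP => sp.
have x0 : x != 0 by apply/eqP => x0; apply: nx; exists 0; rewrite ?rmorph0.
have nxV : ~ range iota x^-1 by move=> [c _ e]; apply: nx; exists c^-1; rewrite // fmorphV e invrK.
have [|V [/vsub kV Vx nV [P CP PV]]] := extend x^-1 'X nxV; first by rewrite size_polyX.
rewrite pevalX invrK in nV; apply: nV; have sV := kV.1.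
have xV i j : (i <= j)%N -> x ^+ i * x^-1 ^+ j = x^-1 ^+ (j - i).
  by move=> ij; rewrite -{1}(subnKC ij) exprD mulrA -exprMn divff // expr1n mul1r.
have Vh : V (h * x^-1 ^+ m).
  have [q [sq Pq ->]] := Gh P CP; rewrite (horner_coef_wide _ sq) mulr_suml.
  apply: subring_sum => // i _; rewrite -mulrA; apply: subringM => //; first exact/PV/Pq.
  by rewrite xV; [exact: subringX|rewrite -ltnS].
pose e := (size p).-2; have esz : size p = e.+2 by rewrite /e; case: (size p) sp => [|[]].
have me : (m <= e)%N by rewrite esz !ltnS in sp.
have Vh' : V (h * x^-1 ^+ e).
  by rewrite -(subnKC me) exprD mulrA; apply: subringM => //; exact: subringX.
have lc0 : iota p`_e.+1 != 0.
  have -> : p`_e.+1 = lead_coef p by rewrite /lead_coef esz.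
  by rewrite fmorph_eq0 lead_coef_eq0 -size_poly_gt0 esz.
have ex : h * x^-1 ^+ e = \sum_(i < e.+1) iota p`_i * x^-1 ^+ (e - i) + iota p`_e.+1 * x.
  rewrite ep pevalE mulr_suml esz big_ord_recr /=; congr (_ + _).
    by apply: eq_bigr => i _; rewrite -mulrA xV // -ltnS.
  by rewrite exprS -mulrA -mulrA -exprMn divff // expr1n mulr1.
have -> : x = (iota p`_e.+1)^-1 * (h * x^-1 ^+ e - \sum_(i < e.+1) iota p`_i * x^-1 ^+ (e - i)).
  by rewrite ex [_ + _ * x]addrC addrK mulKf.
apply: subringM => //; first by rewrite -fmorphV; exact: ksubringC.
apply: subringB => //; apply: subring_sum => // i _; apply: subringM => //; first exact: ksubringC.
exact: subringX.
Qed.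

Section OneProgression.
Variables (c x : K) (g : nat).
Hypotheses (c0 : c != 0) (nx : ~ range iota x) (Vx : V = progression iota c x g.+2).
Local Notation G := (global_filt (C := C) x).

Lemma section_peval (p : {poly k}) : (size p <= g.+2)%N -> V (c * peval p x).
Proof. by move=> sp; rewrite Vx; exists p. Qed.

Lemma section_power i : (i < g.+2)%N -> V (c * x ^+ i).
Proof. by move=> ig; rewrite Vx; exact: progression_pow. Qed.

Lemma om_power P i : points C P -> (i < g.+2)%N -> om P (c * x ^+ i).
Proof. by move=> CP /section_power; exact. Qed.

Lemma om_filt P h : points C P -> om P h -> filt x P g.+1 (h / c).
Proof.
move=> CP; have sP := point_sub CP; have [F0 FD FM] := filt_submodule x g.+1 sP.
apply: (sections_generate (section_power (isT : (0 < g.+2)%N)) _ CP (N := [set h | filt x P g.+1 (h / c)])).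
- by rewrite mulr1.
- split=> [|u v hu hv|a u Pa hu] /=; first by rewrite mul0r.
    by rewrite mulrDl; exact: FD.
  by rewrite scaleKE -mulrA; exact: FM.
- rewrite Vx => _ [p sp <-] /=; rewrite mulrC mulKf //.
  exists (map_poly iota p); rewrite size_map_poly; split=> // i; rewrite coef_map.
  exact: ksubringC (point_ksub CP).
Qed.

Lemma global_filt1 h a : G 1 h -> exists b d, h = iota b + iota d * (x - iota a).
Proof.
move=> Gh; have hV i : (i < g.+1)%N -> V (h * (c * x ^+ i)).
  move=> ig P CP; have sP := point_sub CP; have [q [b [/filt0 Pq Pb ->]]] := filtS sP (Gh P CP).
  rewrite mulrDl; apply: submoduleD (om_submodule D CP) _ _; last first.
    by apply: submoduleM (om_submodule D CP) Pb _; exact: om_power CP (leqW ig).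
  have -> : x * q * (c * x ^+ i) = q * (c * x ^+ i.+1) by rewrite exprS; kf; ring.
  by apply: submoduleM (om_submodule D CP) Pq _; exact: om_power CP _.
have := hV 0%N isT; rewrite Vx => -[p sp]; rewrite expr0 mulr1 [h * c]mulrC => /(mulfI c0) ep.
have := hV g (leqnn _); rewrite Vx => -[r sr]; rewrite mulrCA => /(mulfI c0); rewrite -ep.
rewrite -(pevalXn iota) -pevalM => /eqP; rewrite -subr_eq0 -pevalB => /eqP /(peval_inj nx) /eqP.
rewrite subr_eq0 => /eqP er; rewrite er in sr.
have sp2 : (size p <= 2)%N.
  have [->|p0] := eqVneq p 0; first by rewrite size_poly0.
  by move: sr; rewrite /= size_Mmonic ?monicXn // size_polyXn addnS addnC -[g.+2]addn2 leq_add2l.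
exists (p`_0 + p`_1 * a), p`_1.
rewrite (peval_wide iota _ sp2) !big_ord_recl big_ord0 /= expr0 expr1 rmorphD rmorphM.
by rewrite -[bump 0 0]/1%N; rewrite mulr1 addr0 mulrBr -addrA [_ * iota a + _]addrC subrK.
Qed.

Lemma progression_codim : reps_codim (C := C) x 2.
Proof.
move=> a; have xa0 : x - iota a != 0.
  by apply/eqP => /eqP; rewrite subr_eq0 => /eqP e; apply: nx; exists a.
pose phi (nu : X) := pairing c (fun P => nu P / (x - iota a)).
have lphi b u v : finsupp u -> finsupp v -> phi (iota b *: u + v) = b * phi u + phi v.
  move=> fu fv; have fM := finsuppM (x - iota a)^-1.
  have := pairingR D c (- b) (fM _ fv) (fM _ fu).
  rewrite mulNr opprK => e; rewrite [RHS]addrC -e; congr pairing; apply: boolp.funext => P.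
  by rewrite -[(iota b *: u + v) P]/(iota b * u P + v P) rmorphN mulNr opprK mulrDl mulrA [RHS]addrC.
pose N1 := integral_reps (C := C) `&` [set nu | phi nu = 0].
have phi0 : phi 0 = 0 by have := lphi (-1) 0 0; rewrite scaler0 addr0 mulN1r addNr; apply;
  apply: (@sub_finite_set _ _ set0); rewrite ?finite_set0 //; move=> P /=; rewrite eqxx.
have sN1 : ksp iota N1.
  have [N0 NL] := ksp_integral_reps C; split=> [|b u v [Nu hu] [Nv hv]]; first by split.
  by split; [exact: NL|rewrite /= (lphi b _ _ Nu.1 Nv.1) hu hv mulr0 addr0].
have hN1 nu : integral_reps (C := C) nu -> forall w, V w -> phi nu = 0 -> pairing w (fun P => nu P / (x - iota a)) = 0.
  move=> [fnu Pnu] w; rewrite Vx => -[p sp <-] hnu.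
  have /factor_theorem [r er] : root (p - (p.[a])%:P) a by rewrite /root !hornerE subrr.
  have sr : (size r <= g.+2)%N.
    have [->|r0] := eqVneq r 0; first by rewrite size_poly0.
    have : (size (p - (p.[a])%:P)%R <= g.+2)%N.
      rewrite (leq_trans (size_polyD _ _)) // geq_max sp size_polyN.
      exact: leq_trans (size_polyC_leq1 _) _.
    rewrite er size_Mmonic ?monicXsubC // size_XsubC addn2 /= => /ltnW; exact.
  have ep : c * peval p x = iota p.[a] * c + (x - iota a) * (c * peval r x).
    have := congr1 (fun t => peval t x) er.
    rewrite /= pevalM !pevalB !pevalC pevalX => /eqP; rewrite subr_eq => /eqP ->; kf; ring.
  rewrite ep pairingL; last exact: finsuppM.
  rewrite -/(phi nu) hnu mulr0 add0r /pairing.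
  apply: fsbig1 => P clP.
  have [CP _] := clP; rewrite mulrA divfK //; apply: trc_om => //.
  by apply: submoduleM (om_submodule D CP) (Pnu P clP) _; exact: section_peval CP.
have [m1 r1 m1le] : exists2 m, rdim iota (divisible_reps x a) N1 m & (m <= 1)%N.
  apply: (divisible_codim1 nx) => // [h|nu [Nnu dnu]|nu []//|nu [Nnu hnu]].
  - exact: global_filt1.
  - split=> //; rewrite /= /phi /pairing.
    apply: fsbig1 => P clP.
    have [CP _] := clP; have [l Pl <-] := dnu P clP; rewrite [_ * l / _]mulrAC divff // mul1r; apply: trc_om => //.
    apply: submoduleM (om_submodule D CP) Pl _.
    by have := om_power CP (isT : (0 < g.+2)%N); rewrite mulr1.
  - apply: structure_repartition; first by apply: finsuppM; case: Nnu.
    by move=> w Vw; apply: hN1.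
have [m2 r2 m2le] : exists2 m, rdim iota N1 (integral_reps (C := C)) m & (m <= 1)%N.
  apply: (@rdim_le1 _ _ iota X _ _ (fun nu b => phi nu = b)) => //.
  - exact: ksp_integral_reps.
  - by move=> nu []. 
  - by move=> nu; exists (phi nu).
  - by move=> b u v d d' Nu Nv <- <-; apply: lphi; [case: Nu|case: Nv].
exists (m1 + m2)%N; first exact: rdim_trans r1 r2.
by rewrite -(addn1 1) leq_add.
Qed.

Definition ompow n P := gen_submod (V := K^o) P
  [set s | exists2 w : 'I_n -> K, (forall i, om P (w i)) & s = \prod_i w i].

Lemma ompow_filt n P f : points C P -> ompow n P f -> filt x P (n * g.+1) (f / c ^+ n).
Proof.
move=> CP; have sP := point_sub CP; have [F0 FD FM] := filt_submodule x (n * g.+1) sP.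
apply: (gen_submod_min (N := [set f : K^o | filt x P (n * g.+1) (f / c ^+ n)])).
  split=> [|u v hu hv|a u Pa hu] /=; first by rewrite mul0r.
    by rewrite mulrDl; exact: FD.
  by rewrite scaleKE -mulrA; exact: FM.
move=> _ [w ow ->] /=; elim: n w ow {F0 FD FM} => [|n IH] w ow.
  by rewrite big_ord0 expr0 divr1; apply: filt_sub => //; exact: subring1.
rewrite big_ord_recl exprS invfM mulrACA mulSn; apply: filtM => //; first exact: om_filt.
exact: IH.
Qed.

Lemma powS_power n j : (j <= n * g.+1)%N -> powS V n (c ^+ n * x ^+ j).
Proof.
elim: n j => [|n IH] j jn.
  by move: jn; rewrite leqn0 => /eqP ->; exists 1; rewrite ?rmorph1 ?mulr1.
pose i := minn j g.+1.
have -> : c ^+ n.+1 * x ^+ j = c * x ^+ i * (c ^+ n * x ^+ (j - i)).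
  have ij : (i <= j)%N by exact: geq_minl.
  by rewrite exprS -{1}(subnKC ij) exprD; kf; ring.
apply: powSM; first by apply: section_power; rewrite ltnS geq_minr.
by apply: IH; move: jn; rewrite mulSn /i; lia.
Qed.

Lemma progression_rational n f : (forall z, rational_in x z) ->
  (forall P, points C P -> ompow n P f) -> powS V n f.
Proof.
move=> rat hf; have cn0 : c ^+ n != 0 by rewrite expf_neq0.
have [|p sp ep] := rational_filt nx (rat (f / c ^+ n)) (m := n * g.+1).
  by move=> P CP; apply: ompow_filt => //; exact: hf.
rewrite -(divfK cn0 f) ep pevalE mulr_suml.
apply: (@ksp_sum _ _ iota K^o) => [|i _]; first exact: ksp_powS.
rewrite -mulrA [x ^+ i * _]mulrC; apply: (@kspZ _ _ iota K^o); first exact: ksp_powS.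
by apply: powS_power; rewrite -ltnS (leq_trans (ltn_ord i)).
Qed.
End OneProgression.
End Progressions.

Section DoubleCovers.
Variables (k : closedFieldType) (C : curve k).
Local Notation K := (funfield C).
Local Notation iota := (const C).
Implicit Types (P Q : set K) (x y z : K).
Local Notation kt := {fraction {poly k}}.

Lemma chart_local_hom (f : {rmorphism kt -> K}) (t0 : kt) P : points C P ->
    (forall c, f (ratconst k c) = iota c) -> P (f t0) ->
  exists2 Q, spec (subalgebra_gen (ratconst k) [:: t0]) Q & local_hom f Q P.
Proof.
move=> CP fc Pt; have kP := point_ksub CP; have sP := kP.1.
set A := subalgebra_gen _ _.
have AP q : A q -> P (f q).
  move=> hq; apply: (hq (f @^-1` P)); split.
  - apply/subringP; split=> [|u v|u v] /=; rewrite ?rmorph1 ?rmorphB ?rmorphM.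
    + exact: subring1.
    + exact: subringB.
    + exact: subringM.
  - by move=> _ [c _ <-] /=; rewrite fc; exact: ksubringC.
  - by move=> u /=; rewrite inE => /eqP ->.
have sA : subring A.
  apply/subringP; split=> [|u v hu hv|u v hu hv] B hB; have [sB _ _] := hB.
  - exact: subring1.
  - by apply: subringB => //; [exact: hu|exact: hv].
  - by apply: subringM => //; [exact: hu|exact: hv].
pose p := [set q | A q /\ pmax P (f q)].
have pp : prime_ideal A p.
  split=> [q []//||u v [Au pu] [Av pv]|u v Au [Av pv]|u v Au Av [_]].
  - split; last by case=> _; rewrite rmorph1; exact: pmax1.
    split; first exact: subring0.
    rewrite rmorph0; split; first exact: subring0.
    by case=> /eqP.
  - by split; [exact: (subringD sA Au Av)|rewrite rmorphD; exact: pmaxD].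
  - by split; [exact: (subringM sA Au Av)|rewrite rmorphM; apply: pmaxM => //; exact: AP].
  - by rewrite rmorphM => /(pmax_prime CP (AP _ Au) (AP _ Av)) [h|h]; [left|right].
have unit s : A s -> ~ p s -> punit P (f s).
  by move=> As nps; have [h|//] := pmax_or_unit CP (AP _ As); case: nps.
exists (localization A p); first by exists p.
split=> [_ [a [s [Aa As nps ->]]]|q [a [s [Aa As nps eq]]] Pq].
  by rewrite fmorph_div; apply: subringM => //; [exact: AP|case: (unit s As nps)].
have s0 : s != 0 by have [+ _ _] := unit s As nps; rewrite fmorph_eq0.
have [pa|npa] := pselect (p a); last by exists s, a; split=> //; rewrite eq invf_div.
have [_ ma] := pa; have [us0 Ps Psv] := unit s As nps.
have [a0|a0] := eqVneq a 0.
  by exists a, s; split=> //; rewrite eq a0 mul0r invr0.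
case: ma => Pa []; split=> //; first by rewrite fmorph_eq0.
have -> : (f a)^-1 = (f q)^-1 * (f s)^-1.
  by rewrite -invfM -rmorphM eq mulrC mulrA [s * a]mulrC mulfK.
exact: subringM.
Qed.

Lemma hyperelliptic_of_double y z (ny : ~ range iota y) :
    (forall P, points C P -> P y \/ P y^-1) ->
    (forall a, z <> fev_morph ny a) ->
    (forall w, exists a b, w = fev_morph ny a + fev_morph ny b * z) ->
  hyperelliptic C.
Proof.
move=> reg nz gen; set f := fev_morph ny in nz gen *.
have fc c : f (ratconst k c) = iota c by rewrite /f fev_morph_tofrac pevalC.
have ft : f (tofrac 'X) = y by rewrite /f fev_morph_tofrac pevalX.
exists f; split; first split=> // P CP.
  have [Py|Py] := reg P CP.
    by have [|Q sQ hQ] := chart_local_hom CP fc (t0 := tofrac 'X); [rewrite ft|exists Q => //; left].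
  have [|Q sQ hQ] := chart_local_hom CP fc (t0 := (tofrac 'X)^-1); first by rewrite fmorphV ft.
  by exists Q => //; right.
exists (fun i : 'I_2 => if i == ord0 then 1 else z) => w.
have sumE (a : 'rV[kt]_2) : \sum_i f (a 0 i) * (if i == ord0 then 1 else z) =
    f (a 0 ord0) + f (a 0 (lift ord0 ord0)) * z.
  by rewrite !big_ord_recl big_ord0 /= mulr1 addr0.
have [a [b ew]] := gen w; exists (\row_i if i == ord0 then a else b); split.
  by rewrite sumE !mxE.
move=> a'; rewrite sumE ew => e.
have e1 : b = a' 0 (lift ord0 ord0).
  apply: contrapT => nb; have b0 : b - a' 0 (lift ord0 ord0) != 0 by rewrite subr_eq0; apply/eqP.
  apply: (nz ((a' 0 ord0 - a) / (b - a' 0 (lift ord0 ord0)))).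
  rewrite fmorph_div !rmorphB; have fb0 : f b - f (a' 0 (lift ord0 ord0)) != 0 by rewrite -rmorphB fmorph_eq0.
  apply: (mulIf fb0); rewrite divfK // mulrBr ![z * _]mulrC.
  by apply/eqP; rewrite subr_eq addrAC -e addrAC subrr add0r.
have e0 : a = a' 0 ord0.
  by apply: (fmorph_inj f); move: e; rewrite e1 => /addIr.
apply/rowP => i; rewrite mxE; case: (unliftP ord0 i) => [j ->|->]; last by rewrite eqxx.
by rewrite (ord1 j) /= e1.
Qed.
End DoubleCovers.

Section SmallCovers.
Variables (k : closedFieldType) (C : curve k).
Local Notation K := (funfield C).
Local Notation iota := (const C).
Implicit Types (P Q : set K) (x y z : K).
Local Notation peval := (peval iota).

Definition dependent e x := forall z : nat -> K, exists q : nat -> {poly k},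
  (exists2 j, (j <= e)%N & q j != 0) /\ \sum_(j < e.+1) peval (q j) x * z j = 0.

Lemma pevalN (p : {poly k}) x : peval (- p) x = - peval p x.
Proof. by rewrite -sub0r pevalB peval0 sub0r. Qed.

Lemma peval_neq0 x (p : {poly k}) : ~ range iota x -> p != 0 -> peval p x != 0.
Proof. by move=> nx; apply: contra_neq => /(peval_inj nx). Qed.

Lemma rational_of_dependent x : ~ range iota x -> dependent 1 x -> forall z, rational_in x z.
Proof.
move=> nx dep z; have [q [[j j1 qj]]] := dep (fun i => if i is 0 then 1 else z).
rewrite !big_ord_recl big_ord0 /= addr0 mulr1 -[bump 0 0]/1%N => e.
have q1 : q 1%N != 0.
  apply/eqP => q1; move: e; rewrite q1 peval0 mul0r addr0 => /(peval_inj nx) q0.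
  by case: j j1 qj => [|[|]] //; rewrite ?q0 ?q1 eqxx.
exists (- q 0%N), (q 1%N); split=> //.
by apply/eqP; rewrite pevalN -addr_eq0 addrC mulrC; apply/eqP.
Qed.

Lemma fev_rational x (nx : ~ range iota x) a : rational_in x (fev_morph nx a).
Proof.
have d0 := fden_neq0 a; exists (fnum a), (fden a); split=> //.
have -> : fev_morph nx a = peval (fnum a) x / peval (fden a) x by rewrite {1}[a]fracE fev_morphE.
by rewrite divfK //; exact: peval_neq0.
Qed.

Lemma hyperelliptic_of_dependent x z : ~ range iota x ->
    (forall P, points C P -> P x \/ P x^-1) -> dependent 2 x -> ~ rational_in x z ->
  hyperelliptic C.
Proof.
move=> nx reg dep nz; apply: (hyperelliptic_of_double (ny := nx) (z := z)) => // [a e|w].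
  by apply: nz; rewrite e; exact: fev_rational.
have [q [[j j2 qj]]] := dep (fun i => if i is i'.+1 then if i' is 0 then z else w else 1).
rewrite !big_ord_recl big_ord0 /= addr0 mulr1 -[bump 0 0]/1%N -[bump 0 1]/2%N => e.
have q2 : q 2%N != 0.
  apply/eqP => q2; move: e; rewrite q2 peval0 mul0r addr0 => e; apply: nz.
  have q1 : q 1%N != 0.
    apply/eqP => q1; move: e; rewrite q1 peval0 mul0r addr0 => /(peval_inj nx) q0.
    by case: j j2 qj => [|[|[|]]] //; rewrite ?q0 ?q1 ?q2 eqxx.
  exists (- q 0%N), (q 1%N); split=> //.
  by apply/eqP; rewrite pevalN -addr_eq0 addrC mulrC; apply/eqP.
exists (tofrac (- q 0%N) / tofrac (q 2%N)), (tofrac (- q 1%N) / tofrac (q 2%N)).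
have q2x := peval_neq0 nx q2; rewrite !fev_morphE //.
apply: (mulIf q2x); rewrite mulrDl divfK // mulrAC divfK // !pevalN.
move/eqP: e; rewrite addrA addrC addr_eq0 mulrC => /eqP ->.
by rewrite opprD mulNr.
Qed.
End SmallCovers.

Section SmallGenus.
Variables (k : closedFieldType) (C : curve k) (D : dual_data C).
Local Notation K := (funfield C).
Local Notation iota := (const C).
Local Notation om := (om D).
Local Notation V := (canonical_sections D).
Local Notation ompow := (ompow D).
Add Field Kfield15 : (@kfield_theory K).
Local Ltac kf := kfold (funfield C).
Implicit Types (P Q : set K) (x y z : K).
Local Notation peval := (peval iota).
Local Notation dim := (@rdim _ _ iota K^o [set 0]).

Theorem progression_powers g n f : ~ hyperelliptic C -> is_progression iota V g.+2 ->
  (forall P, points C P -> ompow n P f) -> powS V n f.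
Proof.
move=> nh [c [x [c0 nx Vx]]] hf; have co := progression_codim c0 nx Vx.
apply: (progression_rational c0 nx Vx) => // z; apply: contrapT => nz; apply: nh.
apply: (hyperelliptic_of_dependent (x := x) (z := z)) => // [P CP|]; last exact: dependent_of_codim.
have [Px|nPx] := pselect (P x); first by left.
right; apply: contrapT => nPV; apply: nz; apply: rational_of_dependent => //.
apply: (dependent_of_irregular nx co (P0 := P)) => //; apply/closed_point; split=> // e.
by apply: nPx; rewrite e.
Qed.

Lemma line_powers n f : dim V 1 -> (forall P, points C P -> ompow n P f) -> powS V n f.
Proof.
move=> V1 hf; have [c Vc c0] := dim_neq0 V1.
have VE v : V v -> exists b, v = iota b * c.
  move=> Vv; apply/line_mem.
  suff -> : addl iota [set 0] (c : K^o) = V by [].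
  apply: (dim_eq (dim_line iota c0) V1) => _ /line_mem [b ->].
  by apply: (@kspZ _ _ iota K^o) Vc; exact: ksp_sections.
have cn0 : c ^+ n != 0 by rewrite expf_neq0.
have omE P h : points C P -> om P h -> P (h / c).
  move=> CP; have sP := point_sub CP.
  apply: (sections_generate Vc c0 CP (N := [set h | P (h / c)])).
    split=> [|u v hu hv|a u Pa hu] /=; first by rewrite mul0r; exact: subring0.
      by rewrite mulrDl; exact: subringD.
    by rewrite scaleKE -mulrA; exact: subringM.
  by move=> v /VE [b ->] /=; rewrite mulfK //; exact: ksubringC (point_ksub CP).
have [b _ eb] : range iota (f / c ^+ n).
  apply: global_const => P CP; have sP := point_sub CP.
  apply: (gen_submod_min (N := [set h : K^o | P (h / c ^+ n)])) (hf P CP).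
    split=> [|u v hu hv|a u Pa hu] /=; first by rewrite mul0r; exact: subring0.
      by rewrite mulrDl; exact: subringD.
    by rewrite scaleKE -mulrA; exact: subringM.
  move=> _ [w ow ->] /=; rewrite -[in c ^+ n](card_ord n) -prodr_const -prodf_div.
  by elim/big_ind: _ => [|u v|i _]; [exact: subring1|exact: subringM|exact: omE].
rewrite -(divfK cn0 f) -eb; apply: (@kspZ _ _ iota K^o); first exact: ksp_powS.
rewrite -[in c ^+ n](card_ord n) -prodr_const; exact: powS_prod.
Qed.

Lemma socle P0 : closed_points C P0 -> exists2 u, ~ P0 u & forall r, pmax P0 r -> P0 (r * u).
Proof.
move=> clP; have [CP _] := clP; have sP := point_sub CP; have kP := point_ksp CP.
have [b mb b0] := closed_neq0 clP; have [Pb _] := mb.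
pose B : set K^o := *%R b @` P0.
have sB : @ksp _ _ iota K^o B by apply: ksp_mul.
have BP : B `<=` P0 by move=> _ [a Pa <-]; exact: subringM.
pose N v := addS B ( *%R v @` P0 : set K^o).
have sN v : @ksp _ _ iota K^o (N v) by apply: ksp_addS => //; exact: ksp_mul.
have NP v : P0 v -> N v `<=` P0.
  move=> Pv t [w /BP Pw [a Pa e]].
  rewrite -(subrK w t) -e; apply: subringD => //; exact: subringM.
have [n0 Bn0] := findim_point CP Pb b0.
have dimN v : P0 v -> exists n, @rdim _ _ iota K^o B (N v) n.
  move=> Pv; have [p [q [_ Np _]]] := rdim_mid sB (sN v) (addS_subl (ksp_mul v kP)) (NP v Pv) Bn0.
  by exists p.
suff main n : forall v, P0 v -> ~ B v -> @rdim _ _ iota K^o B (N v) n ->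
    exists2 u, ~ B u & forall r, pmax P0 r -> B (r * u).
  have B1 : ~ B 1.
    move=> [a Pa e]; apply: (pmax1 CP); rewrite -e mulrC.
    exact: pmaxM.
  have [n N1] := dimN 1 (subring1 sP); have [u nu hu] := main n 1 (subring1 sP) B1 N1.
  exists (u / b).
    by move=> Pub; apply: nu; exists (u / b) => //; rewrite mulrC divfK.
  by move=> r /hu [a Pa e]; rewrite mulrA -e mulrAC divff // mul1r.
elim/ltn_ind: n => n IH v Pv nBv Nn.
have [hv|no] := pselect (forall r, pmax P0 r -> B (r * v)); first by exists v.
have [r mr nr] : exists2 r, pmax P0 r & ~ B (r * v).
  by apply: contrapT => h; apply: no => r mr; apply: contrapT => nr; apply: h; exists r.
have [Pr _] := mr; have Prv : P0 (r * v) by exact: subringM.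
have Nv a : P0 a -> N v (v * a).
  by move=> Pa; exists 0; [exact: (@ksp0 _ _ iota K^o)|rewrite subr0; exists a].
have NN : N (r * v) `<=` N v.
  move=> w /= [w1 Bw1 [a Pa e]].
  rewrite -(subrK w1 w) -e; apply: (@kspD _ _ iota K^o _ _ _ (sN v)); last first.
    exact: (addS_subl (ksp_mul v kP) Bw1).
  by rewrite -mulrA mulrCA; apply: Nv; exact: subringM.
have [p [q [en Np Nq]]] := rdim_mid sB (sN (r * v)) (addS_subl (ksp_mul _ kP)) NN Nn.
apply: (IH p) Prv nr Np; rewrite en -[X in (X < _)%N]addn0 ltn_add2l lt0n.
apply/eqP => q0; rewrite q0 in Nq; have := rdim0E Nq => e0.
have : N (r * v) v by rewrite -e0; have := Nv 1 (subring1 sP); rewrite mulr1.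
move=> [_ [d Pd <-] [a Pa e]].
have ms : pmax P0 (- (r * a)).
  by rewrite -mulNr mulrC -mulN1r mulrA; apply: pmaxM => //; rewrite mulrN1; exact: subringN.
have [u0 _ Pu] := punitD CP (punit_const CP (oner_neq0 k)) ms.
apply: nBv; exists (d / (iota 1 - r * a)); first exact: subringM.
rewrite mulrA; apply: (mulIf u0); rewrite divfK // rmorph1 mulrBr mulr1.
by rewrite mulrCA mulrA e; kf; ring.
Qed.

Lemma even_or_odd_neq (p q : {poly k}) : q != 0 -> 'X * (q \Po 'X^2) != p \Po 'X^2.
Proof.
move=> q0; apply/eqP => /(congr1 (fun s : {poly k} => s`_(size q).-1.*2.+1)).
rewrite coefXM /= !coef_comp_poly_Xn // !dvdn2 /= odd_double /= -muln2 mulnK // => /eqP.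
by rewrite -/(lead_coef q) lead_coef_eq0 (negPf q0).
Qed.

Lemma hyperelliptic_genus0 : V = [set 0] -> hyperelliptic C.
Proof.
move=> V0; have [P0 clP] := closed_point_ex C; have [CP _] := clP; have sP := point_sub CP.
have [u nu hu] := socle clP.
have [|w|x hx] := structure_repartition (D := D) (rho := delta1 P0 u); first exact: finsupp_delta1.
  by rewrite V0 => ->; rewrite pairing_delta1 // mulr0 trc0.
have xP0 : P0 (u - x) by have := hx P0 clP; rewrite /delta1 eqxx.
have xP P : points C P -> P <> P0 -> P x.
  move=> CP' ne; have [->//|PT] := pselect (P = setT).
  have clP' : closed_points C P by apply/closed_point.
  have := hx P clP'; rewrite /delta1; case: eqVneq => // _; rewrite sub0r => /(subringN (point_sub CP')).
  by rewrite opprK.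
have nPx : ~ P0 x by move=> Px; apply: nu; rewrite -(subrK x u); exact: subringD.
have nx : ~ range iota x by move=> [c _ e]; apply: nPx; rewrite -e; exact: ksubringC (point_ksub CP).
have mx r : pmax P0 r -> P0 (r * x).
  move=> mr; have [Pr _] := mr; rewrite -(subKr u x) mulrBr.
  by apply: subringB => //; [exact: hu|exact: subringM].
have co : reps_codim (C := C) x 1.
  move=> a; apply: (divisible_codim1 nx) => //.
  - move=> h Gh; have [q [b [/filt0 Pq Pb eh]]] := filtS sP (Gh P0 CP).
    have [c mc] := residue clP Pq.
    have [d _ ed] : range iota (h - iota c * x).
      apply: global_const => P CP'; have sP' := point_sub CP'.
      have [->|ne] := pselect (P = P0).
        have -> : h - iota c * x = (q - iota c) * x + b by rewrite eh; kf; ring.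
        by apply: subringD => //; exact: mx.
      have Px := xP P CP' ne; have [q' [b' [/filt0 Pq' Pb' ->]]] := filtS sP' (Gh P CP').
      apply: subringB => //; first by apply: subringD => //; exact: subringM.
      by apply: subringM => //; exact: ksubringC (point_ksub CP').
    exists (d + c * a), c; rewrite rmorphD rmorphM ed; kf; ring.
  - exact: ksp_integral_reps.
  - by move=> ? [].
  move=> nu0 [fnu0 _]; apply: (structure_repartition (D := D)); first exact: finsuppM.
  move=> w; rewrite V0 => ->; rewrite /pairing; apply: fsbig1 => P clP'.
  by rewrite mulr0 trc0.
have rat := rational_of_dependent nx (dependent_of_codim nx co).
have PVx : P0 x^-1.
  apply: contrapT => nPV.
  have [q [[j j0 qj]]] := dependent_of_irregular nx co clP nPx nPV (fun _ => 1).
  move: j0 qj; rewrite leqn0 => /eqP -> q0; rewrite big_ord_recl big_ord0 addr0 mulr1 => /eqP.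
  by apply/negP; exact: peval_neq0.
pose y := x ^+ 2.
have compE (p : {poly k}) : peval (p \Po 'X^2) x = peval p y.
  by rewrite peval_comp pevalXn.
have ny : ~ range iota y.
  move=> [c _ ec]; have [] : exists c', x = iota c'; last by move=> c' e; apply: nx; exists c'.
  apply: (@peval_eq0 _ _ iota ('X^2 - c%:P)); last by rewrite pevalB pevalXn pevalC ec subrr.
  by rewrite -size_poly_eq0 size_XnsubC.
have nrat a : x <> fev_morph ny a.
  move=> e; have [n [d [d0]]] := fev_rational ny a; rewrite -e -!compE => e1.
  have /eqP := even_or_odd_neq n d0; apply.
  apply/eqP; rewrite -subr_eq0; apply/eqP/(peval_inj nx).
  by rewrite pevalB pevalM pevalX e1 subrr.
apply: (hyperelliptic_of_double (ny := ny) (z := x)) => // [P CP'|w].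
  have [->|ne] := pselect (P = P0); first by right; rewrite /y -exprVn; exact: subringX.
  by left; rewrite /y; apply: subringX; [exact: point_sub|exact: xP].
have [p [q [q0 e]]] := rat w.
have splitE (s : {poly k}) : peval s x = peval (even_poly s) y + peval (odd_poly s) y * x.
  by rewrite -{1}(poly_even_odd s) pevalD pevalM pevalX !compE.
pose dl := even_poly q ^+ 2 - 'X * odd_poly q ^+ 2.
have conj0 : peval (even_poly q) y - peval (odd_poly q) y * x != 0.
  apply/eqP => /eqP; rewrite subr_eq0 => /eqP e1.
  have [o0|o0] := eqVneq (odd_poly q) 0.
    have := peval_neq0 nx q0; rewrite splitE e1 o0 peval0 mul0r addr0 eqxx //.
  apply: (nrat (tofrac (even_poly q) / tofrac (odd_poly q))).
  by rewrite fev_morphE // e1 mulrC mulKf //; exact: peval_neq0.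
have dlE : peval dl y = peval q x * (peval (even_poly q) y - peval (odd_poly q) y * x).
  rewrite splitE /dl pevalB pevalM pevalX !expr2 !pevalM /y !expr2; kf; ring.
have dly0 : peval dl y != 0 by rewrite dlE mulf_neq0 // peval_neq0.
have dl0 : dl != 0 by apply: contra_neq dly0 => ->; rewrite peval0.
pose a := even_poly p * even_poly q - 'X * (odd_poly p * odd_poly q).
pose b := odd_poly p * even_poly q - even_poly p * odd_poly q.
exists (tofrac a / tofrac dl), (tofrac b / tofrac dl); rewrite !fev_morphE //.
apply: (mulIf dly0); rewrite mulrDl divfK // mulrAC divfK // {1}dlE mulrA e splitE.
rewrite /a /b !pevalB !pevalM pevalX /y !expr2; kf; ring.
Qed.
End SmallGenus.

Section SymmetricProducts.
Variables (K : fieldType) (W : vectType K) (n : nat).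

Lemma sprod_line (e : W) (x : 'I_n -> K) :
  sprod (fun i => x i *: e) = (\prod_i x i) *: sprod (fun _ => e).
Proof.
apply: boolp.funext => -[B [lB sB]].
rewrite -[LHS]/(B (fun i => x i *: e)) -[RHS]/((\prod_i x i) * B (fun _ => e)).
have B0 w i : B (dfwith w i 0) = 0.
  have := lB w i 1 0 0; rewrite scale1r addr0 mul1r => h.
  by apply: (addrI (B (dfwith w i 0))); rewrite addr0 -h.
have BZ w i a v : B (dfwith w i (a *: v)) = a * B (dfwith w i v).
  by have := lB w i a v 0; rewrite addr0 B0 addr0.
suff main (s : seq 'I_n) : uniq s -> B (fun i => if i \in s then x i *: e else e) =
    (\prod_(i <- s) x i) * B (fun _ => e).
  have := main (enum 'I_n) (enum_uniq _); rewrite big_enum /= => <-; congr B.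
  by apply: boolp.funext => i; rewrite mem_enum.
elim: s => [|i s IH] /=; first by rewrite big_nil mul1r.
move=> /andP [nis us]; rewrite big_cons -mulrA -(IH us); pose w j := if j \in s then x j *: e else e.
have -> : (fun j => if j \in s then x j *: e else e) = dfwith w i e.
  by apply: boolp.funext => j; case: dfwithP => //; rewrite /w (negPf nis).
rewrite -BZ; congr B; apply: boolp.funext => j; rewrite inE.
by case: dfwithP => [|j' ij]; rewrite ?eqxx // eq_sym (negPf ij).
Qed.
End SymmetricProducts.

Section Conversion.
Variables (k : closedFieldType) (C : curve k) (W : vectType (funfield C)).
Variables (omega : tfsheaf W) (D : dual_data C) (e : W).
Local Notation K := (funfield C).
Local Notation iota := (const C).
Hypothesis omE : forall P x, om D P x <-> omega P (x *: e).
Hypothesis line_e : forall v : W, exists x, v = x *: e.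
Variable n : nat.
Local Notation E := (sprod (fun _ : 'I_n => e)).

Lemma sympow_ompow P s : points C P -> sympow_sheaf n omega P s ->
  exists2 f, ompow D n P f & s = f *: E.
Proof.
move=> CP; have sP := point_sub CP.
have [F0 FD FM] := gen_submod_submodule (V := K^o) [set s | exists2 w : 'I_n -> K, (forall i, om D P (w i)) & s = \prod_i w i] sP.
apply: (gen_submod_min (N := [set s | exists2 f, ompow D n P f & s = f *: E])).
  split=> [|_ _ [f hf ->] [f' hf' ->]|a _ Pa [f hf ->]].
  - by exists 0; rewrite ?scale0r.
  - by exists (f + f'); rewrite ?scalerDl //; exact: FD.
  - by exists (a * f); rewrite ?scalerA //; exact: FM.
move=> _ [w ow ->]; have /choice [x xE] : forall i, exists x, w i = x *: e by move=> i; exact: line_e.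
have we : w = fun i => x i *: e by apply: boolp.funext => i.
exists (\prod_i x i); last by rewrite we sprod_line.
apply: gen_submod_mem => //; exists x => // i; apply/omE; rewrite -xE; exact: ow.
Qed.

Lemma powS_tensor m f : powS (canonical_sections D) m f ->
  exists z : seq (k * ('I_m -> K)), (forall cw, cw \in z -> forall i, canonical_sections D (cw.2 i)) /\
    f = \sum_(cw <- z) iota cw.1 * \prod_i cw.2 i.
Proof.
elim: m f => [|m IH] f.
  move=> [c _ <-]; exists [:: (c, fun _ => 0)]; split; first by move=> cw _ [].
  by rewrite big_seq1 big_ord0 mulr1.
move=> hf; apply: (hf [set f : K | exists z : seq (k * ('I_m.+1 -> K)),
    (forall cw, cw \in z -> forall i, canonical_sections D (cw.2 i)) /\
    f = \sum_(cw <- z) iota cw.1 * \prod_i cw.2 i]).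
  split; first by exists [::]; rewrite big_nil.
  move=> c _ _ [z [hz ->]] [z' [hz' ->]].
  exists ([seq (c * cw.1, cw.2) | cw <- z] ++ z'); split.
    move=> cw; rewrite mem_cat => /orP [/mapP [cw' /hz h ->] //|]; exact: hz'.
  rewrite big_cat big_map scaleKE mulr_sumr; congr (_ + _); apply: eq_bigr => cw _.
  by rewrite rmorphM mulrA.
move=> x y Vx /IH [z [hz ->]].
pose cons (w : 'I_m -> K) (i : 'I_m.+1) := if unlift ord0 i is Some j then w j else x.
exists [seq (cw.1, cons cw.2) | cw <- z]; split.
  move=> _ /mapP [cw /hz h ->] i /=; rewrite /cons.
  by case: unliftP => [j|] _; [exact: h|].
rewrite big_map mulr_sumr; apply: eq_bigr => cw _; rewrite mulrCA; congr (_ * _).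
rewrite big_ord_recl /= /cons unlift_none; congr (_ * _).
by apply: eq_bigr => i _; rewrite liftK.
Qed.

Lemma tensor_sympow f : powS (canonical_sections D) n f ->
  exists2 z, sym_tensors n (H0 C omega) z & sym_mult n z = f *: E.
Proof.
move=> /powS_tensor [z [hz ->]].
exists [seq (cw.1, fun i => cw.2 i *: e) | cw <- z].
  by move=> _ /mapP [cw /hz h ->] i P CP; apply/omE; exact: h.
rewrite /sym_mult big_map scaler_suml; apply: eq_bigr => cw _.
by rewrite sprod_line scalerA.
Qed.

End Conversion.

Lemma ompow_bidual (k : closedFieldType) (C : curve k) (D : dual_data C) n P f :
  points C P -> ompow D n P f -> bidual D n P f.
Proof.
move=> CP; apply: gen_submod_min => [|_ [w ow ->] t]; last exact.
have [o0 oD oM] := om_submodule D CP; split=> [t _|u v hu hv t ht|a u Pa hu t ht].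
- by rewrite mulr0.
- by rewrite mulrDr; apply: oD; [exact: hu|exact: hv].
- by rewrite scaleKE mulrCA; apply: oM => //; exact: hu.
Qed.

Theorem ompow_powS (k : closedFieldType) (C : curve k) (D : dual_data C) n f :
    ~ hyperelliptic C -> (0 < n)%N -> (forall P, points C P -> ompow D n P f) ->
  powS (canonical_sections D) n f.
Proof.
move=> nh; case: n => // n _ hf; have [g Vg] := om_findim D.
have {}Vg : rdim (const C) (X := (funfield C)^o) [set 0] (canonical_sections D) g := Vg.
case: g Vg => [|[|[|g]]] Vg.
- by case: nh; apply: hyperelliptic_genus0; exact: rdim0E Vg.
- exact: line_powers Vg hf.
- apply: (progression_powers (g := 0) nh _ hf).
  apply: (dim2_progression Vg (dim_line (const C) (oner_neq0 _)) Vg) => x y Vx /line_mem [c ->].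
  by rewrite mulr1 mulrC; apply: (@kspZ _ _ (const C) (funfield C)^o) Vx; exact: ksp_sections.
have [Vp|nVp] := pselect (is_progression (const C) (canonical_sections D) g.+3).
  exact: progression_powers nh Vp hf.
by apply: (canonical_powers Vg nVp) => P CP; apply: ompow_bidual => //; exact: hf.
Qed.

Lemma sympow_eq0 (k : closedFieldType) (C : curve k) (W : vectType (funfield C))
    (F : set (funfield C) -> set W) (e : W) n P s : (forall v : W, exists x, v = x *: e) ->
  sprod (fun _ : 'I_n => e) = 0 -> sympow_sheaf n F P s -> s = 0.
Proof.
move=> he E0 [m [a [x [_ hx ->]]]]; apply: big1 => i _.
have [w _ ->] := hx i; have /choice [y yE] : forall i, exists y, w i = y *: e by move=> j; exact: he.
have -> : w = fun i => y i *: e by apply: boolp.funext => j.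
by rewrite sprod_line E0 scaler0 scaler0.
Qed.

Theorem theorem3p7 (k : closedFieldType) (C : curve k)
    (W : vectType (funfield C)) (omega : tfsheaf W)
    (omega_dualizing : dualizing omega)
    (C_nonhyperelliptic : ~ hyperelliptic C)
    (nonGorenstein_unibranch : forall P, points C P ->
       ~ gorenstein omega P -> unibranch C P)
    (n : nat) (n_ge1 : (1 <= n)%N) :
  set_surj (sym_tensors n (H0 C omega)) (H0 C (sympow_sheaf n omega))
    (sym_mult n).
Proof.
move=> s hs; have [tr trH trU] := omega_dualizing.
have zero : s = 0 -> [set sym_mult n z | z in sym_tensors n (H0 C omega)] s.
  by move=> ->; exists [::] => //; rewrite /sym_mult big_nil.
have CT := generic_point C.
have [[w w0]|no] := pselect (exists w : W, w != 0); last first.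
  apply: zero; apply: (sympow_eq0 (e := 0) _ _ (hs _ CT)) => [v|].
    exists 0; rewrite scaler0; apply/eqP; apply: contrapT => /negP v0; apply: no.
    by exists v.
  have := @sprod_line _ W n 0 (fun _ => 0).
  rewrite prodr_const card_ord expr0n eqn0Ngt n_ge1 [RHS]scale0r => <-.
  by congr sprod; apply: boolp.funext => i; rewrite scaler0.
have [e [D [e0 omE]]] := dual_data_of omega_dualizing w0.
have line v : exists x, v = x *: e by exact: dualizing_dim1 trH trU _ _ e0.
have [E0|E0] := eqVneq (sprod (fun _ : 'I_n => e)) 0.
  by apply: zero; exact: sympow_eq0 line E0 (hs _ CT).
have [f _ es] := sympow_ompow omE line CT (hs _ CT).
have [|z Vz ez] := tensor_sympow omE (f := f) (n := n); last by exists z => //; rewrite ez.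
apply: ompow_powS => // P CP; have [f' hf' es'] := sympow_ompow omE line CP (hs _ CP).
suff -> : f = f' by [].
apply/eqP; rewrite -subr_eq0; apply: contraNT E0 => ne.
have := congr1 (fun v => v - f' *: sprod (fun _ : 'I_n => e)) es.
rewrite es' subrr -scalerBl => /esym/eqP; rewrite scaler_eq0 (negPf ne) /= => /eqP ->.
by rewrite eqxx.
Qed.
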